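(* Consider the RKCDG method (described in the context) for the linear advection equation with an $r$th-order, $s$-stage explicit Runge--Kutta method, on a quasi-uniform 1D mesh or a uniform 2D Cartesian mesh with periodic boundary conditions, and fix an integer $m\ge1$. Let $\zeta$ be the termination index, $\rho$ the contribution index and $a^{(\zeta)}_{\zeta\zeta}$ the diagonal entry defined in the context via the matrix transferring process, and let $\lambda=\tau/h$. Then: (1) If $\rho=\zeta$ and $a^{(\zeta)}_{\zeta\zeta}<0$, the method is monotonically stable: there is a constant $C>0$ such that $\|\boldsymbol u_h^{n+m}\|\le\|\boldsymbol u_h^n\|$ whenever $\tau\le Ch$. (2) If $\rho=\zeta$ and $a^{(\zeta)}_{\zeta\zeta}>0$, the method is weak$(2\zeta)$ stable: for sufficiently small $\lambda$ there is a constant $C>0$ such that $\|\boldsymbol u_h^{n+m}\|^2\le(1+C\tau)\|\boldsymbol u_h^n\|^2$ when $\tau\le h^{1+\frac1{2\zeta-1}}$. (3) If $\rho<\zeta$, the method is weak$(2\rho+1)$ stable: for sufficiently small $\lambda$ there is a constant $C>0$ such that $\|\boldsymbol u_h^{n+m}\|^2\le(1+C\tau)\|\boldsymbol u_h^n\|^2$ when $\tau\le h^{1+\frac1{2\rho}}$.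
   Context: Linear advection: $u_t+\boldsymbol\beta\cdot\nabla u=0$ with constant nonzero $\boldsymbol\beta$ (in 1D, $f(u)=\beta_1u$; in 2D, $\boldsymbol f(u)=(\beta_1u,\beta_2u)$). CDG setting: a primal mesh (1D cells $[x_{i-\frac12},x_{i+\frac12}]$; 2D Cartesian cells $[x_{i-\frac12},x_{i+\frac12}]\times[y_{j-\frac12},y_{j+\frac12}]$) and the dual mesh whose cells join neighbouring primal cell centers ($[x_i,x_{i+1}]$, resp. $[x_i,x_{i+1}]\times[y_j,y_{j+1}]$); $V_h$, $W_h$ are the spaces of discontinuous piecewise polynomials of degree $\le k$ on the primal and dual meshes; $h$ is the mesh size; $\langle\boldsymbol u,\boldsymbol\phi\rangle=\int_\Omega u_1\phi_1+u_2\phi_2$, $\|\cdot\|$ the induced norm. The CDG operator is (1D, $\tau_{\max}=C_{\rm CFL}h/|\beta_1|$) $\mathcal H(\boldsymbol u,\boldsymbol\phi)=-\frac1{\tau_{\max}}\int_\Omega(u_1-u_2)(\phi_1-\phi_2)+\int_\Omega f(u_2)\partial_x\phi_1+f(u_1)\partial_x\phi_2-\sum_i\big(f(u_2)_{i+\frac12}(\phi_1)^-_{i+\frac12}-f(u_2)_{i-\frac12}(\phi_1)^+_{i-\frac12}+f(u_1)_{i+1}(\phi_2)^-_{i+1}-f(u_1)_i(\phi_2)^+_i\big)$, with one-sided traces $\phi^\pm$, and analogously in 2D ($\tau_{\max}=C_{\rm CFL}/(|\beta_1|/h_x+|\beta_2|/h_y)$; volume term $\int\boldsymbol f(u_2)\cdot\nabla\phi_1+\boldsymbol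 f(u_1)\cdot\nabla\phi_2$ and edge terms $-\int_{\partial C}\boldsymbol f(u_2)\cdot\boldsymbol n\,\phi_1$ over primal cells $C$, $-\int_{\partial D}\boldsymbol f(u_1)\cdot\boldsymbol n\,\phi_2$ over dual cells $D$, with interior traces of $\phi$ and outward normals). RKCDG method: given $\boldsymbol u_h^n\in V_h\times W_h$, set $\boldsymbol u_h^{n,0}=\boldsymbol u_h^n$, $\langle\boldsymbol u_h^{n,l+1},\boldsymbol\varphi\rangle=\sum_{0\le m'\le l}\big(c_{lm'}\langle\boldsymbol u_h^{n,m'},\boldsymbol\varphi\rangle+\tau d_{lm'}\mathcal H(\boldsymbol u_h^{n,m'},\boldsymbol\varphi)\big)$ for all $\boldsymbol\varphi\in V_h\times W_h$, $l=0,\dots,s-1$, and $\boldsymbol u_h^{n+1}=\boldsymbol u_h^{n,s}$; $c_{lm'},d_{lm'}$ are the RK coefficients and $\tau$ the time step. Temporal difference operators: $\mathbb D_0\boldsymbol u=\boldsymbol u$, and $\langle\mathbb D_i\boldsymbol u,\boldsymbol\varphi\rangle=\tau\mathcal H(\mathbb D_{i-1}\boldsymbol u,\boldsymbol\varphi)$ for all $\boldsymbol\varphi\in V_h\times W_h$, $i\ge1$. There are constants $\alpha_0>0,\alpha_1,\dots,\alpha_{ms}$ (depending only on the RK method and $m$) with $\alpha_0\boldsymbol u_h^{n+m}=\sum_{0\le i\le ms}\alpha_i\mathbb D_i\boldsymbol u_h^n$. Matrix transferring process: symmetric matrices $\mathbb A^{(0)}=(a^{(0)}_{ij})$, $\mathbb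 B^{(0)}=(b^{(0)}_{ij})$ indexed by $0\le i,j\le ms$ with $a^{(0)}_{00}=0$, $a^{(0)}_{ij}=\alpha_i\alpha_j$ for $i+j>0$, $\mathbb B^{(0)}=0$; for $\ell\ge0$ (entries with $i\ge j$, the rest by symmetry): $a^{(\ell+1)}_{ij}=0$ if $0\le j\le\ell$; $a^{(\ell+1)}_{\ell+1,\ell+1}=a^{(\ell)}_{\ell+1,\ell+1}-2a^{(\ell)}_{\ell+2,\ell}$; $a^{(\ell+1)}_{i,\ell+1}=a^{(\ell)}_{i,\ell+1}-a^{(\ell)}_{i+1,\ell}$ for $\ell+2\le i\le ms-1$; $a^{(\ell+1)}_{ij}=a^{(\ell)}_{ij}$ otherwise; and $b^{(\ell+1)}_{i\ell}=2a^{(\ell)}_{i+1,\ell}$ for $\ell\le i\le ms-1$, $b^{(\ell+1)}_{ij}=b^{(\ell)}_{ij}$ otherwise. The process stops at the first $\ell=\zeta$ with $a^{(\zeta)}_{\zeta\zeta}\ne0$; $\zeta$ is the termination index. With $\mathbb B^{(\zeta)}_\kappa$ the $(\kappa+1)$-th order leading principal submatrix of $\mathbb B^{(\zeta)}$, the contribution index is $\rho=\max\{\kappa:0\le\kappa\le\zeta,\ \mathbb B^{(\zeta)}_{\kappa-1}\text{ positive definite}\}$. *)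

(* Defs.v *)
From HB Require Import structures.
From mathcomp Require Import all_boot all_order all_algebra.
From mathcomp Require Import all_classical all_reals all_analysis.
Set Implicit Arguments. Unset Strict Implicit. Unset Printing Implicit Defensive.
Import Order.TTheory GRing.Theory Num.Theory.
Import numFieldNormedType.Exports.
Local Open Scope classical_set_scope.
Local Open Scope ring_scope.

(* Stage polynomials of the RK method applied to y' = z y:
   P_0 = 1,  P_{l+1} = sum_{m' <= l} (c_{l m'} + d_{l m'} z) P_{m'}.        *)
Fixpoint rk_stages (R : ringType) (c d : nat -> nat -> R) (l : nat)
  : seq {poly R} :=
  match l with
  | 0 => [:: 1]
  | l'.+1 => let ps := rk_stages c d l' in
      rcons ps (\sum_(i < l'.+1)
                  (c l' i *: nth 0 ps i + d l' i *: ('X * nth 0 ps i)))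
  end.

(* stability polynomial R(z) of the s-stage method: u^{n+1} = R(tau L) u^n *)
Definition rk_poly (R : ringType) (c d : nat -> nat -> R) (s : nat) : {poly R} :=
  nth 0 (rk_stages c d s) s.

(* An explicit s-stage RK method in Shu--Osher form with coefficients
   c_{l m'}, d_{l m'} (0 <= m' <= l <= s-1), consistent (sum_{m'} c_{l m'} = 1),
   of order r (on linear problems: R(z) = sum_{i<=r} z^i/i! + O(z^{r+1})). *)
Definition rk_method (R : numFieldType) (s r : nat) (c d : nat -> nat -> R) : Prop :=
  (0 < s)%N /\ (0 < r)%N /\
  (forall l, (l < s)%N -> \sum_(i < l.+1) c l i = 1) /\
  (forall i, (i <= r)%N -> (rk_poly c d s)`_i = (i`!)%:R^-1).

(* alpha_i, 0 <= i <= m s : alpha_0 u^{n+m} = sum_i alpha_i D_i u^n,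
   i.e. the coefficients of R(z)^m (normalised so that alpha_0 = 1). *)
Definition rk_alpha (R : ringType) (c d : nat -> nat -> R) (s m i : nat) : R :=
  ((rk_poly c d s) ^+ m)`_i.

(* Symmetric (ms+1)x(ms+1) matrices are represented as functions nat->nat->R,
   with all entries outside 0..ms equal to 0.  Entries are computed on the
   lower triangle (i >= j) and extended by symmetry. *)

Definition A0 (R : ringType) (c d : nat -> nat -> R) (s m : nat) (i j : nat) : R :=
  if (m * s < i)%N || (m * s < j)%N then 0
  else if (i == 0)%N && (j == 0)%N then 0
  else rk_alpha c d s m i * rk_alpha c d s m j.

Definition mtp_stepA_low (R : ringType) (N l : nat) (a : nat -> nat -> R) (i j : nat) : R :=
  if (N < i)%N then 0
  else if (j <= l)%N then 0
  else if (i == l.+1) && (j == l.+1) then a l.+1 l.+1 - 2 * a l.+2 l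
  else if (j == l.+1) && (l.+2 <= i)%N && (i <= N.-1)%N then a i l.+1 - a i.+1 l
  else a i j.

Definition mtp_stepB_low (R : ringType) (N l : nat) (a b : nat -> nat -> R) (i j : nat) : R :=
  if (N < i)%N then 0
  else if (j == l) && (l <= i)%N && (i <= N.-1)%N then 2 * a i.+1 l
  else b i j.

Definition symmetrize (R : Type) (f : nat -> nat -> R) (i j : nat) : R :=
  f (maxn i j) (minn i j).

Fixpoint mtp (R : ringType) (c d : nat -> nat -> R) (s m l : nat)
  : (nat -> nat -> R) * (nat -> nat -> R) :=
  match l with
  | 0 => (A0 c d s m, fun _ _ => 0)
  | l'.+1 => let ab := mtp c d s m l' in
      (symmetrize (mtp_stepA_low (m * s) l' ab.1),
       symmetrize (mtp_stepB_low (m * s) l' ab.1 ab.2))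
  end.

Definition mtpA (R : ringType) (c d : nat -> nat -> R) (s m l : nat) := (mtp c d s m l).1.
Definition mtpB (R : ringType) (c d : nat -> nat -> R) (s m l : nat) := (mtp c d s m l).2.

Definition termination_index (R : ringType) (c d : nat -> nat -> R) (s m zeta : nat) : Prop :=
  mtpA c d s m zeta zeta zeta != 0 /\
  (forall l, (l < zeta)%N -> mtpA c d s m l l l = 0).

Definition posdef (R : realFieldType) (n : nat) (M : 'M[R]_n) : Prop :=
  forall v : 'cV[R]_n, v != 0 -> 0 < ((v^T *m M *m v) 0 0).

Definition lead_sub (R : Type) (f : nat -> nat -> R) (n : nat) : 'M[R]_n :=
  \matrix_(i < n, j < n) f i j.

(* contribution index: max kappa in [0, zeta] such that B^{(zeta)}_{kappa-1}
   (the leading principal submatrix of order kappa) is positive definite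
   (the empty matrix, kappa = 0, counts as positive definite). *)
Definition contribution_index (R : realFieldType) (c d : nat -> nat -> R)
    (s m zeta rho : nat) : Prop :=
  (rho <= zeta)%N /\ posdef (lead_sub (mtpB c d s m zeta) rho) /\
  (forall kappa, (rho < kappa)%N -> (kappa <= zeta)%N ->
     ~ posdef (lead_sub (mtpB c d s m zeta) kappa)).

(* U j l = stage l of time step n+j  (U 0 0 = u_h^n, U m 0 = u_h^{n+m}).
   ip = L^2 inner product <.,.>, H = CDG operator; the test functions range
   over all of V_h x W_h (every element of the state type X is in the space). *)
Definition rk_traj (R : ringType) (X : Type) (ip H : X -> X -> R) (s : nat)
    (c d : nat -> nat -> R) (tau : R) (m : nat) (U : nat -> nat -> X) : Prop :=
  (forall j, (j < m)%N -> U j.+1 0%N = U j s) /\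
  (forall j l, (j < m)%N -> (l < s)%N -> forall phi : X,
     ip (U j l.+1) phi =
       \sum_(i < l.+1) (c l i * ip (U j i) phi + tau * d l i * H (U j i) phi)).

(* A family of discretizations indexed by meshes M : I with adm M:
   mesh size h M, inner product ip M, CDG operator H M. *)
Definition monotone_stable (R : realType) (I X : Type) (adm : I -> Prop)
    (h : I -> R) (ip H : I -> X -> X -> R) (s : nat) (c d : nat -> nat -> R)
    (m : nat) : Prop :=
  exists C : R, 0 < C /\
   forall M : I, adm M -> forall tau : R, 0 < tau -> tau <= C * h M ->
   forall U, rk_traj (ip M) (H M) s c d tau m U ->
     Num.sqrt (ip M (U m 0%N) (U m 0%N)) <= Num.sqrt (ip M (U 0%N 0%N) (U 0%N 0%N)).

Definition weak_stable (R : realType) (I X : Type) (adm : I -> Prop)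
    (h : I -> R) (ip H : I -> X -> X -> R) (s : nat) (c d : nat -> nat -> R)
    (m q : nat) : Prop :=
  exists lambda0 : R, 0 < lambda0 /\
  exists C : R, 0 < C /\
   forall M : I, adm M -> forall tau : R, 0 < tau -> tau / h M <= lambda0 ->
   tau <= h M `^ (1 + ((q.-1)%:R)^-1) ->
   forall U, rk_traj (ip M) (H M) s c d tau m U ->
     Num.sqrt (ip M (U m 0%N) (U m 0%N)) ^+ 2
       <= (1 + C * tau) * Num.sqrt (ip M (U 0%N 0%N) (U 0%N 0%N)) ^+ 2.

Definition Rint (R : realType) (a b : R) (f : R -> R) : R :=
  Rintegral (@lebesgue_measure R) `[a, b] f.

Definition peval (R : ringType) (k : nat) (p : nat -> R) (x : R) : R :=
  \sum_(a < k.+1) p a * x ^+ a.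
Definition pderiv (R : ringType) (k : nat) (p : nat -> R) (x : R) : R :=
  \sum_(a < k.+1) p a * a%:R * x ^+ a.-1.

Definition peval2 (R : ringType) (k : nat) (p : nat -> nat -> R) (x y : R) : R :=
  \sum_(a < k.+1) \sum_(b < (k.+1 - a)%N) p a b * x ^+ a * y ^+ b.
Definition pdx2 (R : ringType) (k : nat) (p : nat -> nat -> R) (x y : R) : R :=
  \sum_(a < k.+1) \sum_(b < (k.+1 - a)%N) p a b * a%:R * x ^+ a.-1 * y ^+ b.
Definition pdy2 (R : ringType) (k : nat) (p : nat -> nat -> R) (x y : R) : R :=
  \sum_(a < k.+1) \sum_(b < (k.+1 - a)%N) p a b * b%:R * x ^+ a * y ^+ b.-1.

Definition ind (R : realType) (a b x : R) : R := if (a <= x) && (x < b) then 1 else 0.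

(* Mesh (N, xf): x_{i-1/2} = xf i (i = 0..N), xf 0 = 0, xf N = L.
   Primal cell i (0 <= i < N) = [xf i, xf (i+1)], center x_i = cen xf i.
   Dual cell i = [x_i, x_{i+1}] with x_N := x_0 + L (periodicity).
   A state u = (u1, u2): u1 i = coefficients (global coordinate) of the degree-
   <= k polynomial on primal cell i, u2 i = same on dual cell i.            *)

Definition cen (R : fieldType) (xf : nat -> R) (i : nat) : R := (xf i + xf i.+1) / 2.
Definition cenp (R : fieldType) (N : nat) (L : R) (xf : nat -> R) (i : nat) : R :=
  if i == N then cen xf 0 + L else cen xf i.

Definition h1 (R : realType) (N : nat) (xf : nat -> R) : R :=
  \big[Num.max/0]_(i < N) (xf i.+1 - xf i).

Definition adm1 (R : realType) (L sigma : R) (M : nat * (nat -> R)) : Prop :=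
  let: (N, xf) := M in
  (0 < N)%N /\ xf 0%N = 0 /\ xf N = L /\
  (forall i, (i < N)%N -> xf i < xf i.+1) /\
  (forall i j, (i < N)%N -> (j < N)%N -> xf i.+1 - xf i <= sigma * (xf j.+1 - xf j)).

Definition state1 (R : Type) : Type := ((nat -> nat -> R) * (nat -> nat -> R))%type.

Definition ev1 (R : realType) (k N : nat) (xf : nat -> R) (u : nat -> nat -> R) (x : R) : R :=
  \sum_(i < N) ind (xf i) (xf i.+1) x * peval k (u i) x.
Definition ev1' (R : realType) (k N : nat) (xf : nat -> R) (u : nat -> nat -> R) (x : R) : R :=
  \sum_(i < N) ind (xf i) (xf i.+1) x * pderiv k (u i) x.
Definition ev2 (R : realType) (k N : nat) (L : R) (xf : nat -> R) (v : nat -> nat -> R) (x : R) : R :=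
  \sum_(i < N) ind (cenp N L xf i) (cenp N L xf i.+1) x * peval k (v i) x
  + ind 0 (cen xf 0) x * peval k (v N.-1) (x + L).
Definition ev2' (R : realType) (k N : nat) (L : R) (xf : nat -> R) (v : nat -> nat -> R) (x : R) : R :=
  \sum_(i < N) ind (cenp N L xf i) (cenp N L xf i.+1) x * pderiv k (v i) x
  + ind 0 (cen xf 0) x * pderiv k (v N.-1) (x + L).

Definition ip1 (R : realType) (k : nat) (L : R) (M : nat * (nat -> R)) (u phi : state1 R) : R :=
  let: (N, xf) := M in
  Rint 0 L (fun x => ev1 k N xf u.1 x * ev1 k N xf phi.1 x)
  + Rint 0 L (fun x => ev2 k N L xf u.2 x * ev2 k N L xf phi.2 x).

Definition H1 (R : realType) (k : nat) (beta CFL L : R) (M : nat * (nat -> R))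
    (u phi : state1 R) : R :=
  let: (N, xf) := M in
  let taumax := CFL * h1 N xf / `|beta| in
  let U1 := ev1 k N xf u.1 in let U2 := ev2 k N L xf u.2 in
  let P1 := ev1 k N xf phi.1 in let P2 := ev2 k N L xf phi.2 in
  - taumax^-1 * Rint 0 L (fun x => (U1 x - U2 x) * (P1 x - P2 x))
  + Rint 0 L (fun x => beta * U2 x * ev1' k N xf phi.1 x
                       + beta * U1 x * ev2' k N L xf phi.2 x)
  - \sum_(i < N)
      (  beta * U2 (xf i.+1) * peval k (phi.1 i) (xf i.+1)
       - beta * U2 (xf i) * peval k (phi.1 i) (xf i)
       + beta * peval k (u.1 (i.+1 %% N)%N) (cen xf (i.+1 %% N)%N)
              * peval k (phi.2 i) (cenp N L xf i.+1)
       - beta * peval k (u.1 i) (cen xf i) * peval k (phi.2 i) (cen xf i)).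

(* Mesh (Nx, Ny): hx = Lx/Nx, hy = Ly/Ny; primal cell (i,j) =
   [i hx, (i+1) hx] x [j hy, (j+1) hy]; dual cell (i,j) =
   [(i+1/2) hx, (i+3/2) hx] x [(j+1/2) hy, (j+3/2) hy] (periodic).
   u1 i j, u2 i j = coefficients (global coordinates) of P^k polynomials.     *)

Definition state2 (R : Type) : Type :=
  ((nat -> nat -> nat -> nat -> R) * (nat -> nat -> nat -> nat -> R))%type.

(* periodic pieces of the primal mesh in one direction, covering [0, L + h):
   piece i (i <= N) = [i h, (i+1) h), cell i %% N, coordinate shift -L if i = N *)
Definition pidx (N i : nat) : nat := (i %% N)%N.
Definition psh (R : ringType) (N : nat) (L : R) (i : nat) : R := if i == N then - L else 0.
(* pieces of the dual mesh in one direction, covering [0, L + h/2):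
   piece 0 = [0, h/2) (dual cell N-1, shift +L), piece i+1 = [(i+1/2)h, (i+3/2)h) *)
Definition dlo (R : fieldType) (h : R) (i : nat) : R :=
  if i == 0%N then 0 else (i%:R - 2^-1) * h.
Definition dhi (R : fieldType) (h : R) (i : nat) : R :=
  if i == 0%N then h / 2 else (i%:R + 2^-1) * h.
Definition didx (N i : nat) : nat := if i == 0%N then N.-1 else i.-1.
Definition dsh (R : ringType) (L : R) (i : nat) : R := if i == 0%N then L else 0.

Definition ev1_2 (R : realType) (Nx Ny : nat) (Lx Ly : R)
    (ev : (nat -> nat -> R) -> R -> R -> R)
    (u : nat -> nat -> nat -> nat -> R) (x y : R) : R :=
  let hx := Lx / Nx%:R in let hy := Ly / Ny%:R in
  \sum_(i < Nx.+1) \sum_(j < Ny.+1)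
     ind (i%:R * hx) (i.+1%:R * hx) x * ind (j%:R * hy) (j.+1%:R * hy) y *
     ev (u (pidx Nx i) (pidx Ny j)) (x + psh Nx Lx i) (y + psh Ny Ly j).

Definition ev2_2 (R : realType) (Nx Ny : nat) (Lx Ly : R)
    (ev : (nat -> nat -> R) -> R -> R -> R)
    (v : nat -> nat -> nat -> nat -> R) (x y : R) : R :=
  let hx := Lx / Nx%:R in let hy := Ly / Ny%:R in
  \sum_(i < Nx.+1) \sum_(j < Ny.+1)
     ind (dlo hx i) (dhi hx i) x * ind (dlo hy j) (dhi hy j) y *
     ev (v (didx Nx i) (didx Ny j)) (x + dsh Lx i) (y + dsh Ly j).

Definition h2 (R : realType) (Lx Ly : R) (M : nat * nat) : R :=
  Num.max (Lx / M.1%:R) (Ly / M.2%:R).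

Definition adm2 (R : realType) (Lx Ly sigma : R) (M : nat * nat) : Prop :=
  (0 < M.1)%N /\ (0 < M.2)%N /\
  Lx / M.1%:R <= sigma * (Ly / M.2%:R) /\ Ly / M.2%:R <= sigma * (Lx / M.1%:R).

Definition intO2 (R : realType) (Lx Ly : R) (f : R -> R -> R) : R :=
  Rint 0 Lx (fun x => Rint 0 Ly (fun y => f x y)).

Definition ip2 (R : realType) (k : nat) (Lx Ly : R) (M : nat * nat) (u phi : state2 R) : R :=
  let: (Nx, Ny) := M in
  intO2 Lx Ly (fun x y => ev1_2 Nx Ny Lx Ly (peval2 k) u.1 x y
                          * ev1_2 Nx Ny Lx Ly (peval2 k) phi.1 x y)
  + intO2 Lx Ly (fun x y => ev2_2 Nx Ny Lx Ly (peval2 k) u.2 x y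
                            * ev2_2 Nx Ny Lx Ly (peval2 k) phi.2 x y).

(* CDG operator, f(u) = (beta1 u, beta2 u),
   tau_max = CFL / (|beta1|/hx + |beta2|/hy).  Edge terms: outward normals,
   interior traces of the test function on each primal / dual cell. *)
Definition H2 (R : realType) (k : nat) (beta1 beta2 CFL Lx Ly : R) (M : nat * nat)
    (u phi : state2 R) : R :=
  let: (Nx, Ny) := M in
  let hx := Lx / Nx%:R in let hy := Ly / Ny%:R in
  let taumax := CFL / (`|beta1| / hx + `|beta2| / hy) in
  let U1 := ev1_2 Nx Ny Lx Ly (peval2 k) u.1 in
  let U2 := ev2_2 Nx Ny Lx Ly (peval2 k) u.2 in
  let P1 := ev1_2 Nx Ny Lx Ly (peval2 k) phi.1 in
  let P2 := ev2_2 Nx Ny Lx Ly (peval2 k) phi.2 in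
  let P1x := ev1_2 Nx Ny Lx Ly (pdx2 k) phi.1 in
  let P1y := ev1_2 Nx Ny Lx Ly (pdy2 k) phi.1 in
  let P2x := ev2_2 Nx Ny Lx Ly (pdx2 k) phi.2 in
  let P2y := ev2_2 Nx Ny Lx Ly (pdy2 k) phi.2 in
  - taumax^-1 * intO2 Lx Ly (fun x y => (U1 x y - U2 x y) * (P1 x y - P2 x y))
  + intO2 Lx Ly (fun x y => beta1 * U2 x y * P1x x y + beta2 * U2 x y * P1y x y
                            + beta1 * U1 x y * P2x x y + beta2 * U1 x y * P2y x y)
  - \sum_(i < Nx) \sum_(j < Ny)
      (let xl := i%:R * hx in let xr := i.+1%:R * hx in
       let yb := j%:R * hy in let yt := j.+1%:R * hy in
       let p := peval2 k (phi.1 i j) in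
         Rint yb yt (fun y => beta1 * U2 xr y * p xr y)
       - Rint yb yt (fun y => beta1 * U2 xl y * p xl y)
       + Rint xl xr (fun x => beta2 * U2 x yt * p x yt)
       - Rint xl xr (fun x => beta2 * U2 x yb * p x yb))
  - \sum_(i < Nx) \sum_(j < Ny)
      (let xl := (i%:R + 2^-1) * hx in let xr := (i.+1%:R + 2^-1) * hx in
       let yb := (j%:R + 2^-1) * hy in let yt := (j.+1%:R + 2^-1) * hy in
       let p := peval2 k (phi.2 i j) in
         Rint yb yt (fun y => beta1 * U1 xr y * p xr y)
       - Rint yb yt (fun y => beta1 * U1 xl y * p xl y)
       + Rint xl xr (fun x => beta2 * U1 x yt * p x yt)
       - Rint xl xr (fun x => beta2 * U1 x yb * p x yb)).

Definition stability_conclusions (R : realType) (I X : Type) (adm : I -> Prop)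
    (h : I -> R) (ip H : I -> X -> X -> R) (s : nat) (c d : nat -> nat -> R)
    (m zeta rho : nat) : Prop :=
  [/\ (rho = zeta -> mtpA c d s m zeta zeta zeta < 0 ->
         monotone_stable adm h ip H s c d m),
      (rho = zeta -> 0 < mtpA c d s m zeta zeta zeta ->
         weak_stable adm h ip H s c d m (2 * zeta)) &
      ((rho < zeta)%N -> weak_stable adm h ip H s c d m (2 * rho).+1)].

(* Main.v *)
(** Write w_0 = u^n and let w_{i+1} be the Riesz representative of tau H(w_i, .),
    so that u^{n+m} = sum_i alpha_i w_i up to null vectors of the (only
    semidefinite) inner product.  The advective part of H is skew on every half
    cell cut out by the two overlapping meshes, hence
    H(u, v) + H(v, u) = - (2 / tau_max) <u_1 - u_2, v_1 - v_2>, and the matrix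
    transferring process is exactly summation by parts with this identity:
      |u^{n+m}|^2 - |u^n|^2 = sum a^(zeta)_ij <w_i, w_j>
                              - (tau / tau_max) sum b^(zeta)_ij J(w_i, w_j),
    with J(u, v) = <u_1 - u_2, v_1 - v_2>.  Inverse inequalities give
    |w_{i+1}| <= C lambda |w_i|, so the first sum is
    (a^(zeta)_{zeta zeta} + O(lambda)) |w_zeta|^2.  The positive definite block
    of order rho makes the second sum nonnegative up to O(|w_rho|^2), because
    completing squares (Schur complements) transfers positivity from numbers to
    Gram matrices.  Finally |w_i| <= (C lambda)^i |u^n|, and rho >= 1 because
    b_00 = 2 alpha_0 alpha_1 = 2 m.

    Riesz representation on a finite-dimensional space also yields the
    coercivity of positive definite matrices and the inverse inequalities: a
    linear functional vanishing on null vectors is bounded by the seminorm.  In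
    two dimensions the local estimates follow from the one-dimensional ones by
    integrating in the transverse variable. *)

Require Import Defs.
From HB Require Import structures.
From mathcomp Require Import all_boot all_order all_algebra.
From mathcomp Require Import all_classical all_reals all_analysis.
From mathcomp Require Import zify ring lra.
Set Implicit Arguments. Unset Strict Implicit. Unset Printing Implicit Defensive.
Import Order.TTheory GRing.Theory Num.Theory.
Local Open Scope ring_scope.

(** * Positive semidefinite forms *)

Section BilinearForms.
Variables (R : realFieldType) (X : lmodType R).
Implicit Types (f : X -> X -> R) (u v w : X).

(** A state is a pair of unrestricted coefficient functions, so coefficients outside the range of
    cells or degrees of a mesh are null vectors of the inner product. Equalities of states are
    therefore out of reach: the RK relations are used only after testing with [phi], and [H] has to
    be shown blind to null vectors in both arguments.

    No constant may depend on the mesh. What comes from the matrices of the transferring process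
    depends on the RK data alone, which is why coercivity is stated for all spaces and all
    semidefinite forms at once. The mesh enters only through [e = K * (tau / h)], with one [K] for
    the whole family.

    Skew symmetry is purely local: at either end of a half cell, the flux terms of [(u, v)] and
    [(v, u)] add up to the boundary value of [u_2 v_1 + u_1 v_2]. Neighbours and periodicity come in
    only when the edges of the dual cells are regrouped by halves of primal cells.

    The odd exponent of the third case arises because the dissipation error [|w_rho|^2] is
    multiplied by [tau / tau_max], one more factor of order lambda. *)

Definition bilin f :=
  (forall a u v w, f (a *: u + v) w = a * f u w + f v w) /\
  (forall a u v w, f w (a *: u + v) = a * f w u + f w v).

Definition psd_form f :=
  [/\ bilin f, forall u v, f u v = f v u & forall u, 0 <= f u u].

Variable f : X -> X -> R.
Hypothesis bf : bilin f.

Lemma bilinDl u v w : f (u + v) w = f u w + f v w.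
Proof. by have := bf.1 1 u v w; rewrite scale1r mul1r. Qed.
Lemma bilinDr u v w : f w (u + v) = f w u + f w v.
Proof. by have := bf.2 1 u v w; rewrite scale1r mul1r. Qed.
Lemma bilin0l w : f 0 w = 0.
Proof. by apply: (@addrI _ (f 0 w)); rewrite -bilinDl !addr0. Qed.
Lemma bilin0r w : f w 0 = 0.
Proof. by apply: (@addrI _ (f w 0)); rewrite -bilinDr !addr0. Qed.
Lemma bilinZl a u w : f (a *: u) w = a * f u w.
Proof. by have := bf.1 a u 0 w; rewrite !addr0 bilin0l addr0. Qed.
Lemma bilinZr a u w : f w (a *: u) = a * f w u.
Proof. by have := bf.2 a u 0 w; rewrite !addr0 bilin0r addr0. Qed.
Lemma bilinBl u v w : f (u - v) w = f u w - f v w.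
Proof. by rewrite bilinDl -scaleN1r bilinZl mulN1r. Qed.
Lemma bilin_suml (I : Type) (r : seq I) (P : pred I) (c : I -> R) (x : I -> X) w :
  f (\sum_(i <- r | P i) c i *: x i) w = \sum_(i <- r | P i) c i * f (x i) w.
Proof.
elim/big_rec2: _ => [|i y1 y2 _ <-]; first exact: bilin0l.
by rewrite bf.1.
Qed.
Lemma bilin_sumr (I : Type) (r : seq I) (P : pred I) (c : I -> R) (x : I -> X) w :
  f w (\sum_(i <- r | P i) c i *: x i) = \sum_(i <- r | P i) c i * f w (x i).
Proof.
elim/big_rec2: _ => [|i y1 y2 _ <-]; first exact: bilin0r.
by rewrite bf.2.
Qed.

Hypothesis sf : forall u v, f u v = f v u.
Hypothesis pf : forall u, 0 <= f u u.

Lemma psd_cauchy_schwarz u v : f u v ^+ 2 <= f u u * f v v.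
Proof.
have key t : 0 <= t ^+ 2 * f v v + 2 * t * f u v + f u u.
  have := pf (t *: v + u); rewrite bf.1 !bf.2 (sf v u); congr (_ <= _); ring.
have [c0|cn0] := eqVneq (f v v) 0.
  rewrite c0 mulr0; have [->|bn0] := eqVneq (f u v) 0; first by rewrite expr0n.
  (* Without the quadratic term, [key] is affine in [t]; this [t] would give it the value -1. *)
  have := key (- (f u u + 1) / (2 * f u v)); rewrite c0.
  have -> : (- (f u u + 1) / (2 * f u v)) ^+ 2 * 0 +
     2 * (- (f u u + 1) / (2 * f u v)) * f u v + f u u = -1 by field; rewrite bn0.
  lra.
have cp : 0 < f v v by rewrite lt_neqAle eq_sym cn0 pf.
have := key (- f u v / f v v).
have -> : (- f u v / f v v) ^+ 2 * f v v + 2 * (- f u v / f v v) * f u v + f u u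
  = (f u u * f v v - f u v ^+ 2) / f v v by field.
by rewrite pmulr_lge0 ?invr_gt0// subr_ge0.
Qed.

Lemma psd_null u v : f v v = 0 -> f u v = 0.
Proof.
move=> v0; have := psd_cauchy_schwarz u v; rewrite v0 mulr0 => h.
by apply/eqP; rewrite -sqrf_eq0 eq_le h sqr_ge0.
Qed.

(** The free weight [t] later lets a small share of the coercive part absorb the cross terms. *)
Lemma psd_amgm (t : R) u v : 0 < t -> 2 * `|f u v| <= t * f u u + t^-1 * f v v.
Proof.
move=> t0; have h (s : R) : s ^+ 2 = 1 -> 2 * (s * f u v) <= t * f u u + t^-1 * f v v.
  move=> s1; have := pf ((- (s * t)) *: u + v); rewrite bf.1 !bf.2 (sf v u).
  have -> : - (s * t) * (- (s * t) * f u u + f u v) + (- (s * t) * f u v + f v v)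
    = s ^+ 2 * t ^+ 2 * f u u - 2 * s * t * f u v + f v v by ring.
  rewrite s1 -(pmulr_rge0 _ (_ : 0 < t^-1)) ?invr_gt0//.
  have -> : t^-1 * (1 * t ^+ 2 * f u u - 2 * s * t * f u v + f v v)
    = t * f u u + t^-1 * f v v - 2 * (s * f u v) by field; rewrite gt_eqF.
  by rewrite subr_ge0.
case: (ger0P (f u v)) => _; [have := h 1 | have := h (-1)];
  rewrite ?mul1r ?mulN1r; apply; ring.
Qed.

End BilinearForms.

(** * Riesz representation for a semidefinite form *)

Section Riesz.
Variables (R : realFieldType) (X : lmodType R).
Variables (ip : X -> X -> R) (l : X -> R) (n : nat) (e : 'I_n -> X).
Hypothesis psd : psd_form ip.
Hypothesis lin : forall a u v, l (a *: u + v) = a * l u + l v.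
Hypothesis l_null : forall v, ip v v = 0 -> l v = 0.
Hypothesis span : forall x, exists c : 'I_n -> R,
  let z := x - \sum_i c i *: e i in ip z z = 0.

(** The Gram matrix [G] may be singular, as the [e i] need not be independent. The row [b] of values
    of [l] still lies in its row space: a column of the cokernel gives a combination of the [e i]
    that is a null vector, and [l] vanishes there. *)
Lemma riesz : exists w, forall x, ip w x = l x.
Proof.
have [bf sf pf] := psd.
have l0 : l 0 = 0.
  by have := lin 1 0 0; rewrite scale1r mul1r addr0 -{1}[l 0]addr0 => /addrI.
have lsum (c : 'I_n -> R) : l (\sum_i c i *: e i) = \sum_i c i * l (e i).
  by elim/big_rec2: _ => // i y1 y2 _ <-; rewrite lin.
pose G : 'M[R]_n := \matrix_(i, j) ip (e i) (e j).
pose b : 'rV[R]_n := \row_j l (e j).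
have /submxP[c bE] : (b <= G)%MS.
  rewrite submxE; apply/eqP/rowP => k; rewrite mxE.
  have col0 i : \sum_j ip (e i) (e j) * cokermx G j k = 0.
    have := congr1 (fun M : 'M[R]_n => M i k) (mulmx_coker G); rewrite /= mxE [RHS]mxE => h.
    by rewrite -[RHS]h; apply: eq_bigr => j _; rewrite [G i j]mxE.
  pose v := \sum_j cokermx G j k *: e j.
  have v0 : ip v v = 0.
    rewrite {1}/v bilin_suml// big1// => i _.
    rewrite /v bilin_sumr//.
    under eq_bigr do rewrite mulrC.
    by rewrite col0 mulr0.
  rewrite [RHS]mxE; have := l_null v0; rewrite lsum => h.
  by rewrite -[RHS]h; apply: eq_bigr => j _; rewrite mxE mulrC.
exists (\sum_i c 0 i *: e i) => x.
have [d] := span x; set s := \sum_i d i *: e i => /= z0.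
have -> : x = s + (x - s) by rewrite addrC subrK.
rewrite bilinDr// (psd_null bf sf pf _ z0) addr0.
have := lin 1 s (x - s); rewrite scale1r mul1r => ->.
rewrite (l_null z0) addr0 lsum bilin_sumr//; apply: eq_bigr => j _; congr (_ * _).
have /rowP/(_ j) := bE; rewrite !mxE => ->.
by rewrite bilin_suml//; apply: eq_bigr => i _; rewrite mxE.
Qed.

Lemma riesz_bound : exists C, 0 <= C /\ forall x, l x ^+ 2 <= C * ip x x.
Proof.
have [w hw] := riesz; have [bf sf pf] := psd; exists (ip w w); split => // x.
by rewrite -hw; exact: psd_cauchy_schwarz.
Qed.

End Riesz.

(** * Quadratic forms on scalars and on Gram matrices *)

Section Gram.
Variable R : realFieldType.

(** With [X := R^o] and the product as [f] this is the ordinary quadratic form of [b], so that one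
    completion of squares serves numbers and Gram matrices alike. *)
Definition qform (X : lmodType R) (f : X -> X -> R) (n : nat) (b : nat -> nat -> R)
  (w : nat -> X) := \sum_(i < n) \sum_(j < n) b i j * f (w i) (w j).

Definition pos_quad (n : nat) (b : nat -> nat -> R) :=
  forall v : nat -> R, (exists2 i, (i < n)%N & v i != 0) ->
    0 < @qform R^o (fun x y => x * y) n b v.

Definition schur (b : nat -> nat -> R) (i j : nat) : R :=
  b i.+1 j.+1 - b i.+1 0%N * b 0%N j.+1 / b 0%N 0%N.

Lemma sum_nat_recl n (F : nat -> R) :
  \sum_(i < n.+1) F i = F 0%N + \sum_(i < n) F i.+1.
Proof. by rewrite big_ord_recl. Qed.

Lemma qform_schur (X : lmodType R) (f : X -> X -> R) n b (w : nat -> X) :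
  bilin f -> (forall u v, f u v = f v u) ->
  (forall i j, b i j = b j i) -> b 0%N 0%N != 0 ->
  let z := w 0%N + \sum_(j < n) (b 0%N j.+1 / b 0%N 0%N) *: w j.+1 in
  qform f n.+1 b w = b 0%N 0%N * f z z + qform f n (schur b) (w \o succn).
Proof.
move=> bf sf sb b0 z; rewrite /qform.
rewrite (sum_nat_recl n (fun i => \sum_(j < n.+1) b i j * f (w i) (w j))).
rewrite (sum_nat_recl n (fun j => b 0%N j * f (w 0%N) (w j))).
set s := \sum_(j < n) (b 0%N j.+1 / b 0%N 0%N) *: w j.+1 in z *.
have fw i : f (w i) s = \sum_(j < n) b 0%N j.+1 / b 0%N 0%N * f (w i) (w j.+1).
  by rewrite bilin_sumr.
have -> : f z z = f (w 0%N) (w 0%N) + 2 * f (w 0%N) s + f s s.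
  by rewrite /z bilinDl// !bilinDr// (sf s); ring.
have -> : \sum_(j < n) b 0%N j.+1 * f (w 0%N) (w j.+1) = b 0%N 0%N * f (w 0%N) s.
  by rewrite fw mulr_sumr; apply: eq_bigr => j _; field.
under eq_bigr => i _ do rewrite (sum_nat_recl n (fun j => b i.+1 j * f (w i.+1) (w j))).
rewrite big_split /=.
have -> : \sum_(i < n) b i.+1 0%N * f (w i.+1) (w 0%N) = b 0%N 0%N * f (w 0%N) s.
  by rewrite fw mulr_sumr; apply: eq_bigr => j _; rewrite sf sb; field.
have -> : \sum_(i < n) \sum_(j < n) schur b i j * f (w i.+1) (w j.+1) =
   \sum_(i < n) \sum_(j < n) b i.+1 j.+1 * f (w i.+1) (w j.+1) - b 0%N 0%N * f s s.
  rewrite {1}/s bilin_suml// mulr_sumr -sumrB; apply: eq_bigr => i _.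
  rewrite fw !mulr_sumr -sumrB; apply: eq_bigr => j _.
  by rewrite /schur (sb i.+1 0%N); field.
ring.
Qed.

Lemma pos_quad_gram (X : lmodType R) (f : X -> X -> R) n b (w : nat -> X) :
  psd_form f -> (forall i j, b i j = b j i) -> pos_quad n b -> 0 <= qform f n b w.
Proof.
move=> [bf sf pf]; elim: n b w => [|n IH] b w sb pb; first by rewrite /qform big_ord0.
have b0 : 0 < b 0%N 0%N.
  have := pb (fun i => (i == 0%N)%:R); rewrite /qform.
  rewrite big_ord_recl big_ord_recl [X in _ * _ + X]big1 ?addr0; last by move=> i _; rewrite mulr0 mulr0.
  rewrite [X in _ + X]big1 ?addr0; last first.
    by move=> i _; rewrite big1// => j _; rewrite mul0r mulr0.
  by rewrite !mulr1; apply; exists 0%N; rewrite //= oner_neq0.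
rewrite qform_schur// ?gt_eqF// addr_ge0//; first by rewrite mulr_ge0// ltW.
apply: IH => [i j|v [i ltin vi]]; first by rewrite /schur sb (sb 0%N) (sb i.+1 0%N); ring.
(* The first coordinate is chosen to cancel the completed square, which leaves the form of the Schur
   complement at [v]. *)
pose v' k := if k is k'.+1 then v k' else - \sum_(j < n) b 0%N j.+1 / b 0%N 0%N * v j.
have := pb v'; rewrite (@qform_schur R^o) ?gt_eqF//; last 2 first.
- by split=> [a x y z|a x y z]; rewrite /GRing.scale/=; ring.
- by move=> x y; rewrite mulrC.
have -> : v' 0%N + \sum_(j < n) (b 0%N j.+1 / b 0%N 0%N : R^o) *: (v' j.+1 : R^o) = 0.
  by rewrite /v' addrC; apply/eqP; rewrite subr_eq0.
rewrite mulr0 mulr0 add0r; apply; by exists i.+1.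
Qed.

(** By [riesz_bound] each squared coordinate is at most [C i] times the form. With [S] the sum of
    the [C i], subtracting [(S + 1)^-1] times the identity keeps [b] positive on scalars, hence
    nonnegative on Gram matrices. So [e] is independent of [X], [f] and [w]. *)
Lemma pos_quad_coercive n b : (forall i j, b i j = b j i) -> pos_quad n b ->
  exists2 e : R, 0 < e & forall (X : lmodType R) (f : X -> X -> R) (w : nat -> X),
    psd_form f -> e * \sum_(i < n) f (w i) (w i) <= qform f n b w.
Proof.
move=> sb pb.
pose ip (v w : 'rV[R]_n) : R := \sum_(i < n) \sum_(j < n) b i j * (v 0 i * w 0 j).
pose ext (v : 'rV[R]_n) (i : nat) : R := if insub i is Some k then v 0 k else 0.
have extE v (i : 'I_n) : ext v i = v 0 i.
  by rewrite /ext insubT//= => lt; congr (v 0 _); apply: val_inj.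
have ipE v : ip v v = @qform R^o (fun x y => x * y) n b (ext v).
  by apply: eq_bigr => i _; apply: eq_bigr => j _; rewrite !extE.
have ipp v : v != 0 -> 0 < ip v v.
  move=> vn0; rewrite ipE; apply: pb.
  have /rV0Pn[i vi] := vn0; exists i => //; by rewrite extE.
have psd : psd_form ip.
  split=> [|u v|v].
  - split=> a u v w; rewrite /ip mulr_sumr -big_split; apply: eq_bigr => i _;
    rewrite mulr_sumr -big_split; apply: eq_bigr => j _; rewrite !mxE /=; ring.
  - rewrite /ip exchange_big /=; apply: eq_bigr => i _; apply: eq_bigr => j _.
    by rewrite (sb j) (mulrC (u 0 j)).
  - have [->|/ipp/ltW//] := eqVneq v 0.
    by rewrite /ip big1// => i _; rewrite big1// => j _; rewrite mxE mul0r mulr0.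
have bd i : exists C, 0 <= C /\ forall v : 'rV[R]_n, v 0 i ^+ 2 <= C * ip v v.
  apply: (@riesz_bound R _ ip (fun v : 'rV[R]_n => v 0 i) n (fun i => delta_mx 0 i)) => //.
  - by move=> a u v; rewrite !mxE.
  - by move=> v v0; have [->|/ipp] := eqVneq v 0; rewrite ?mxE// v0 ltxx.
  - move=> v; exists (fun i => v 0 i); rewrite -row_sum_delta subrr.
    by rewrite /= /ip big1// => k _; rewrite big1// => j _; rewrite mxE mul0r mulr0.
have [C hC] : exists C : 'I_n -> R, forall i, 0 <= C i /\ forall v : 'rV[R]_n, v 0 i ^+ 2 <= C i * ip v v.
  by apply: (fin_all_exists bd).
pose S := \sum_i C i.
have S0 : 0 <= S by apply: sumr_ge0 => i _; have [] := hC i.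
exists (S + 1)^-1; first by rewrite invr_gt0; lra.
move=> X f w pf.
pose b' i j := b i j - (i == j)%:R * (S + 1)^-1.
have eqb (Y : lmodType R) (g : Y -> Y -> R) (y : nat -> Y) :
  qform g n b' y = qform g n b y - (S + 1)^-1 * \sum_(i < n) g (y i) (y i).
  rewrite /qform mulr_sumr -sumrB; apply: eq_bigr => i _.
  under eq_bigr => j _ do rewrite /b' mulrBl.
  rewrite sumrB; congr (_ - _); rewrite (bigD1 i)//= eqxx mul1r big1 ?addr0// => j ji.
  by rewrite eq_sym (inj_eq val_inj) (negPf ji) !mul0r.
suff : 0 <= qform f n b' w by rewrite eqb subr_ge0.
apply: pos_quad_gram => // [i j|v vn0]; first by rewrite /b' sb eq_sym.
rewrite eqb subr_gt0.
pose r : 'rV[R]_n := \row_i v i.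
have -> : qform (X := R^o) (fun x y => x * y) n b v = ip r r.
  by apply: eq_bigr => i _; apply: eq_bigr => j _; rewrite !mxE.
have rn0 : r != 0.
  have [i lti vi] := vn0; apply/rV0Pn; exists (Ordinal lti); by rewrite mxE.
rewrite mulrC ltr_pdivrMr; last lra.
have : \sum_(i < n) v i * v i <= S * ip r r.
  rewrite /S mulr_suml; apply: ler_sum => i _; have [_ /(_ r)] := hC i.
  by rewrite mxE expr2.
have := ipp _ rn0; nra.
Qed.

End Gram.

(** * The matrix transferring process *)

Section MatrixTransfer.
Variable R : realFieldType.
Implicit Types (a b f g k : nat -> nat -> R).

(* Weights turning a sum over the lower triangle into the full sum of a symmetric
   matrix, so that the process can be followed on its lower entries only. *)
Definition tri_weight (i j : nat) : R :=
  if i == j then 1 else if (j < i)%N then 2 else 0.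

Definition tri_sum n f g : R :=
  \sum_(j < n) \sum_(i < n) tri_weight i j * f i j * g i j.

(** After doubling both sides, the weights at [(i, j)] and [(j, i)] add up to 2 for every pair,
    diagonal or not. *)
Lemma tri_sumE n f g : (forall i j, f i j = f j i) -> (forall i j, g i j = g j i) ->
  \sum_(i < n) \sum_(j < n) f i j * g i j = tri_sum n f g.
Proof.
move=> fs gs.
have E : tri_sum n f g = \sum_(i < n) \sum_(j < n) tri_weight i j * f i j * g i j.
  by rewrite /tri_sum exchange_big.
have H2 : 2 * \sum_(i < n) \sum_(j < n) f i j * g i j = 2 * tri_sum n f g.
  have -> : 2 * tri_sum n f g = tri_sum n f g + tri_sum n f g by ring.
  rewrite {1}E /tri_sum.
  rewrite mulr_sumr -big_split; apply: eq_bigr => i _ /=.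
  rewrite mulr_sumr -big_split; apply: eq_bigr => j _ /=.
  rewrite (fs j) (gs j) -!mulrA -mulrDl; congr (_ * _).
  rewrite /tri_weight eq_sym; by case: (ltngtP i j) => _; ring.
by apply: (mulfI (_ : 2 != 0 :> R)) H2; rewrite pnatr_eq0.
Qed.

Lemma tri_sum_symmetrize n f g : tri_sum n (symmetrize f) g = tri_sum n f g.
Proof.
apply: eq_bigr => j _; apply: eq_bigr => i _.
rewrite /symmetrize /tri_weight; case: (ltngtP i j) => [h|h|->].
- by rewrite !mul0r.
- by [].
- by [].
Qed.

Lemma symmetrizeC f i j : symmetrize f i j = symmetrize f j i.
Proof. by rewrite /symmetrize maxnC minnC. Qed.

(** One summation by parts on column [l]: by [gk], [g i.+1 l] is traded for [g i l.+1], which lies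
    in column [l.+1], and for [k i l], which goes to [b]. The diagonal entry [a l l] is not traded
    and has to vanish. The trade stops at row [N], because row [N.+1] of [a] is zero. *)
Lemma mtp_step_energy N l (mu : R) a b g k :
  (l < N)%N -> (forall i j, (N < i)%N -> a i j = 0) ->
  (forall i j, (j < l)%N -> a i j = 0) -> a l l = 0 ->
  (forall i, (l <= i)%N -> b i l = 0) ->
  (forall i j, g i j = g j i) ->
  (forall i j, g i.+1 j + g i j.+1 = - 2 * mu * k i j) ->
  tri_sum N.+1 a g - mu * tri_sum N.+1 b k =
  tri_sum N.+1 (mtp_stepA_low N l a) g - mu * tri_sum N.+1 (mtp_stepB_low N l a b) k.
Proof.
move=> lN aN al all0 bl gs gk.
apply/eqP; rewrite -subr_eq0; apply/eqP.
set a' := mtp_stepA_low N l a; set b' := mtp_stepB_low N l a b.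
pose D j := \sum_(i < N.+1) (tri_weight i j * (a i j - a' i j) * g i j
                              - mu * (tri_weight i j * (b i j - b' i j) * k i j)).
have -> : tri_sum N.+1 a g - mu * tri_sum N.+1 b k -
    (tri_sum N.+1 a' g - mu * tri_sum N.+1 b' k) = \sum_(j < N.+1) D j.
  rewrite /tri_sum !mulr_sumr -!sumrB; apply: eq_bigr => j _.
  rewrite !mulr_sumr -!sumrB; apply: eq_bigr => i _; ring.
have D0 (j : 'I_N.+1) : j != l :> nat -> j != l.+1 :> nat -> D j = 0.
  move=> /negPf jl /negPf jl1; rewrite /D big1// => i _.
  rewrite /a' /b' /mtp_stepA_low /mtp_stepB_low jl jl1 !andbF /=.
  have -> : (N < i)%N = false by rewrite ltnNge -ltnS ltn_ord.
  case: leqP => [jl'|_]; last by ring.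
  rewrite (al _ _ (_ : j < l)%N); last by rewrite ltn_neqAle jl jl'.
  ring.
have lN1 : (l < N.+1)%N by rewrite ltnS ltnW.
have l1N1 : (l.+1 < N.+1)%N by rewrite ltnS.
rewrite (bigD1 (Ordinal lN1)) //= (bigD1 (Ordinal l1N1)) /=; last first.
  by rewrite -val_eqE /= eqn_leq ltnn.
rewrite big1 ?addr0; last first.
  by move=> j /andP[j1 j2]; apply: D0; [exact: j1|exact: j2].
rewrite -big_split /=.
(* Columns [l] and [l.+1] are taken together, since row by row their joint change is an increment of
   [e]; the sum telescopes to zero. *)
pose e i := if (l < i)%N then 2 * a i l * g i l else 0.
rewrite (eq_bigr (fun i : 'I_N.+1 => - (e i.+1 - e i))).
  rewrite sumrN -(big_mkord xpredT (fun i => e i.+1 - e i)) telescope_sumr//.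
  rewrite /e ltn0 subr0; case: ifP => _; by rewrite ?aN// ?mulr0 ?mul0r oppr0.
move=> i _; have iN : (i <= N)%N by rewrite -ltnS ltn_ord.
rewrite /a' /b' /mtp_stepA_low /mtp_stepB_low /e !eqxx leqnn ltnn.
have -> : (N < i)%N = false by rewrite ltnNge iN.
have -> : (l.+1 == l) = false by rewrite eqn_leq ltnn.
rewrite /tri_weight !andbT /=.
have gk' := gk i l.
have [il|il|il] := ltngtP (i : nat) l.
- have -> : (i == l.+1 :> nat) = false by lia.
  have -> : (l.+1 < i)%N = false by lia.
  have -> : (l < i.+1)%N = false by lia.
  by ring.
- rewrite bl ?(ltnW il)//; have -> : (l < i.+1)%N by lia.
  have [i1|i1|i1] := ltngtP (i : nat) l.+1.
  + lia.
  + rewrite /=; have [i2|i2] := leqP i N.-1.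
      transitivity (2 * a i l * g i l + 2 * a i.+1 l * (g i l.+1 + 2 * mu * k i l)); first by ring.
      have -> : g i l.+1 = - 2 * mu * k i l - g i.+1 l by rewrite -gk' addrC addKr.
      by ring.
    have -> : a i.+1 l = 0 by apply: aN; lia.
    by ring.
  (* The receiving entry is diagonal and has weight 1, while the entry that is moved has weight 2:
     this is the factor 2 in the diagonal rule of the process. *)
  + rewrite /= -i1 in gk' *.
    have [i2|i2] := leqP i N.-1.
      transitivity (2 * a i l * g i l + 2 * a i.+1 l * (g i i + 2 * mu * k i l)).
        by ring.
      have -> : g i i = - 2 * mu * k i l - g i.+1 l by rewrite -gk' addrC addKr.
      by ring.
    have -> : a i.+1 l = 0 by apply: aN; lia.
    by ring.
(* At [i = l] the two terms of [gk] coincide by symmetry, which matches the weight 1 of the entry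
   [b l l]. *)
- rewrite il bl// in gk' *.
  have -> : (l == l.+1) = false by lia.
  have -> : (l.+1 < l)%N = false by lia.
  have -> : (l <= N.-1)%N by lia.
  rewrite ltnS leqnn /=.
  have -> : mu * (1 * (0 - 2 * a l.+1 l) * k l l) = a l.+1 l * (- 2 * mu * k l l) by ring.
  rewrite -gk' (gs l l.+1) all0; ring.
Qed.

Variables (c d : nat -> nat -> R) (s m : nat).
Let N := (m * s)%N.
Let A := mtpA c d s m.
Let B := mtpB c d s m.

Lemma mtpA_sym l i j : A l i j = A l j i.
Proof.
case: l => [|l]; last exact: symmetrizeC.
by rewrite /A /mtpA /= /A0 orbC andbC; case: ifP => // _; case: ifP => // _; rewrite mulrC.
Qed.

Lemma mtpB_sym l i j : B l i j = B l j i.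
Proof. by case: l => [//|l]; exact: symmetrizeC. Qed.

Lemma mtpA_out l i j : (N < i)%N -> A l i j = 0.
Proof.
case: l => [|l] Ni; first by rewrite /A /mtpA /= /A0 Ni.
by rewrite /A /mtpA /= /symmetrize /mtp_stepA_low leq_max Ni.
Qed.

Lemma mtpA_low l i j : (j < l)%N -> A l i j = 0.
Proof.
case: l => // l jl; rewrite /A /mtpA /= /symmetrize /mtp_stepA_low.
by case: ifP => // _; have -> : (minn i j <= l)%N by lia.
Qed.

Lemma mtpB_high l i j : (l <= i)%N -> (l <= j)%N -> B l i j = 0.
Proof.
elim: l i j => [//|l IH] i j li lj.
rewrite /B /mtpB /= /symmetrize /mtp_stepB_low; case: ifP => // _.
have -> : (minn i j == l) = false by lia.
by rewrite /=; apply: IH; lia.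
Qed.

Lemma mtp_energy l (mu : R) g k :
  (forall l', (l' < l)%N -> A l' l' l' = 0) -> (l <= N)%N ->
  (forall i j, g i j = g j i) ->
  (forall i j, g i.+1 j + g i j.+1 = - 2 * mu * k i j) ->
  tri_sum N.+1 (A 0) g = tri_sum N.+1 (A l) g - mu * tri_sum N.+1 (B l) k.
Proof.
move=> Al lN gs gk; elim: l Al lN => [|l IH] Al lN.
  rewrite [X in _ - _ * X]big1 ?mulr0 ?subr0// => j _; rewrite big1// => i _.
  by rewrite /B /mtpB /= mulr0 mul0r.
rewrite IH; [|by move=> l' h; apply: Al; lia|lia].
rewrite (@mtp_step_energy N l mu _ _ g k) //.
- by rewrite [in RHS]/A [in RHS]/B /mtpA /mtpB /= !tri_sum_symmetrize.
- exact: mtpA_out.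
- exact: mtpA_low.
- exact: Al.
- by move=> i li; exact: mtpB_high.
Qed.
End MatrixTransfer.

(** * Stage polynomials and temporal differences *)

Section RungeKutta.
Variables (R : realFieldType) (c d : nat -> nat -> R).

Definition rk_stage l : {poly R} := nth 0 (rk_stages c d l) l.

Lemma size_rk_stages l : size (rk_stages c d l) = l.+1.
Proof. by elim: l => //= l IH; rewrite size_rcons IH. Qed.

Lemma nth_rk_stages l i : (i <= l)%N -> nth 0 (rk_stages c d l) i = rk_stage i.
Proof.
elim: l => [|l IH]; first by rewrite leqn0 => /eqP->.
rewrite leq_eqVlt => /orP[/eqP->//|il].
by rewrite /= nth_rcons size_rk_stages il IH.
Qed.

Lemma rk_stageS l : rk_stage l.+1 =
  \sum_(i < l.+1) (c l i *: rk_stage i + d l i *: ('X * rk_stage i)).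
Proof.
rewrite /rk_stage /= nth_rcons size_rk_stages ltnn eqxx.
by apply: eq_bigr => i _; rewrite nth_rk_stages// -ltnS ltn_ord.
Qed.

Lemma size_rk_stage l : (size (rk_stage l) <= l.+1)%N.
Proof.
elim/ltn_ind: l => -[_|l IH]; first by rewrite /rk_stage /= size_poly1.
rewrite rk_stageS; apply: (leq_trans (size_sum _ _ _)); apply/bigmax_leqP => i _.
have h := IH i (ltn_ord i); have il := ltn_ord i.
apply: (leq_trans (size_polyD _ _)); rewrite geq_max; apply/andP; split.
  by apply: (leq_trans (size_scale_leq _ _)); lia.
apply: (leq_trans (size_scale_leq _ _)); rewrite mulrC.
apply: (leq_trans (size_polyMleq _ _)); rewrite size_polyX; lia.
Qed.

Lemma size_rk_polyX s m : (size (rk_poly c d s ^+ m) <= (m * s).+1)%N.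
Proof.
apply: (leq_trans (size_poly_exp_leq _ _)); rewrite ltnS (mulnC m) leq_mul2r -subn1 leq_subLR add1n.
by apply/orP; right; exact: size_rk_stage.
Qed.

Lemma rk_alpha0 s r m : rk_method s r c d -> rk_alpha c d s m 0 = 1.
Proof.
move=> [_ [_ [_ /(_ 0%N (leq0n _))]]]; rewrite fact0 invr1 /rk_alpha => p0.
elim: m => [|m IH]; first by rewrite expr0 coef1.
by rewrite exprS coef0M IH p0 mulr1.
Qed.

Lemma rk_alpha1 s r m : rk_method s r c d -> rk_alpha c d s m 1 = m%:R.
Proof.
move=> rk; have [_ [r0 [_ /(_ 1%N r0)]]] := rk; rewrite factS fact0 invr1 /rk_alpha => p1.
have p0 : (rk_poly c d s)`_0 = 1 by have := rk_alpha0 1 rk; rewrite /rk_alpha expr1.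
elim: m => [|m IH]; first by rewrite expr0 coef1.
rewrite exprS coefM big_ord_recl big_ord1 /= subn0 IH p0 mul1r p1 mul1r.
have -> : (rk_poly c d s ^+ m)`_(1 - bump 0 0) = 1 by exact: (rk_alpha0 m rk).
by rewrite -natr1.
Qed.

(** The first step writes this entry; the later ones write only columns with positive index and
    their mirror rows. *)
Lemma mtpB00 s r m l : rk_method s r c d -> (0 < m)%N -> (0 < l)%N ->
  0 < mtpB c d s m l 0 0.
Proof.
move=> rk m0; have [s0 _] := rk.
elim: l => // -[_ _|l IH _].
  rewrite /mtpB /= /symmetrize /mtp_stepB_low /= /A0 /=.
  have -> : (m * s < 1)%N = false by nia.
  by rewrite orbF /= (rk_alpha1 m rk) (rk_alpha0 m rk) mulr1 mulr_gt0// ltr0n.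
by have := IH isT; rewrite /mtpB /= /symmetrize /mtp_stepB_low /=.
Qed.

Variables (X : lmodType R) (ip H : X -> X -> R) (tau : R) (w : nat -> X).
Implicit Types (p q : {poly R}).
Hypotheses (psd : psd_form ip) (bH : bilin H).
Hypothesis H_null : forall u v, ip u u = 0 -> H u v = 0.
Hypothesis wS : forall i phi, ip (w i.+1) phi = tau * H (w i) phi.

(** The polynomial [p] of the discrete operator [tau L], applied to [w 0], with [w i] in the role of
    the power [(tau L)^i (w 0)]. *)
Definition poly_comb (p : {poly R}) : X := \sum_(i < size p) p`_i *: w i.

Lemma poly_comb_widen p n : (size p <= n)%N -> poly_comb p = \sum_(i < n) p`_i *: w i.
Proof.
move=> pn; rewrite /poly_comb (big_ord_widen n (fun i => p`_i *: w i) pn) big_mkcond.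
apply: eq_bigr => i _; case: ltnP => // h.
by rewrite nth_default// scale0r.
Qed.

Lemma poly_combD p q : poly_comb (p + q) = poly_comb p + poly_comb q.
Proof.
set n := maxn (size p) (size q).
rewrite (poly_comb_widen (size_polyD _ _)) (@poly_comb_widen p n) ?leq_maxl//.
rewrite (@poly_comb_widen q n) ?leq_maxr// -big_split.
by apply: eq_bigr => i _; rewrite coefD scalerDl.
Qed.

Lemma poly_combZ a p : poly_comb (a *: p) = a *: poly_comb p.
Proof.
rewrite (poly_comb_widen (size_scale_leq _ _)) /poly_comb scaler_sumr.
by apply: eq_bigr => i _; rewrite coefZ scalerA.
Qed.

Lemma poly_combX p phi : ip (poly_comb ('X * p)) phi = tau * H (poly_comb p) phi.
Proof.
have [bi _ _] := psd.
have sz : (size ('X * p)%R <= (size p).+1)%N.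
  by apply: (leq_trans (size_polyMleq _ _)); rewrite size_polyX addSn.
rewrite (poly_comb_widen sz) big_ord_recl coefXM eqxx scale0r add0r.
rewrite bilin_suml// /poly_comb bilin_suml// mulr_sumr.
by apply: eq_bigr => i _; rewrite coefXM lift0 /= wS mulrCA.
Qed.

Lemma traj_poly s m (U : nat -> nat -> X) :
  w 0%N = U 0%N 0%N -> rk_traj ip H s c d tau m U ->
  forall phi, ip (U m 0%N) phi = ip (poly_comb (rk_poly c d s ^+ m)) phi.
Proof.
move=> w0 [Unext Ustage]; have [bi si pi] := psd.
(* Stages are known only up to null vectors, so feeding them into the next stage requires that [H]
   does not see the difference. *)
have HE (x y : X) : (forall phi, ip x phi = ip y phi) -> forall phi, H x phi = H y phi.
  move=> e phi; apply/eqP; rewrite -subr_eq0 -bilinBl//; apply/eqP/H_null.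
  by rewrite bilinBl// e subrr.
suff : forall j, (j <= m)%N -> forall phi,
    ip (U j 0%N) phi = ip (poly_comb (rk_poly c d s ^+ j)) phi by exact.
elim=> [_ phi|j IH jm phi].
  by rewrite expr0 /poly_comb size_poly1 big_ord1 coef1 scale1r w0.
suff stage l : (l <= s)%N -> forall phi,
    ip (U j l) phi = ip (poly_comb (rk_stage l * rk_poly c d s ^+ j)) phi.
  by rewrite Unext// stage// -exprS.
elim/ltn_ind: l => -[_ _|l IHl ls] psi.
  by rewrite IH 1?ltnW// /rk_stage /= mul1r.
rewrite Ustage// rk_stageS mulr_suml.
rewrite (big_morph poly_comb poly_combD (_ : poly_comb 0 = 0)); last first.
  by rewrite /poly_comb size_poly0 big_ord0.
rewrite (big_morph (ip^~ psi) (fun x y => bilinDl bi x y psi) (bilin0l bi psi)).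
apply: eq_bigr => i _.
have il : (i <= s)%N by apply: leq_trans ls; exact/ltnW/ltn_ord.
rewrite mulrDl -!scalerAl -(mulrA 'X) poly_combD !poly_combZ bilinDl// !bilinZl//.
rewrite poly_combX -(HE _ _ (IHl i (ltn_ord i) il)) -(IHl i (ltn_ord i) il).
by congr (_ + _); rewrite mulrCA mulrA.
Qed.

End RungeKutta.

(** * Energy estimates *)

Section Estimates.
Variable R : realFieldType.

Definition abs_sum n (a : nat -> nat -> R) := \sum_(i < n) \sum_(j < n) `|a i j|.

Lemma abs_sum_ge0 n a : 0 <= abs_sum n a.
Proof. by apply: sumr_ge0 => i _; apply: sumr_ge0. Qed.

(** Apart from [(z, z)], every nonzero entry has both indices at least [z] and one of them larger;
    by Cauchy-Schwarz the decay of the larger one yields a factor [e]. *)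
Lemma energy_upper (X : lmodType R) (ip : X -> X -> R) (w : nat -> X) n z
    (a : nat -> nat -> R) (e : R) :
  psd_form ip -> (z < n)%N -> (forall i j, (i < z)%N || (j < z)%N -> a i j = 0) ->
  0 <= e <= 1 -> (forall i, ip (w i.+1) (w i.+1) <= e ^+ 2 * ip (w i) (w i)) ->
  \sum_(i < n) \sum_(j < n) a i j * ip (w i) (w j) <=
    (a z z + abs_sum n a * e) * ip (w z) (w z).
Proof.
move=> [bi si pi] zn az /andP[e0 e1] wS.
set y := fun i => ip (w i) (w i).
have ydec i j : y (i + j)%N <= y i.
  elim: j => [|j IH]; first by rewrite addn0.
  rewrite addnS; apply: le_trans IH; apply: (le_trans (wS _)).
  by rewrite ler_piMl ?pi// expr_le1.
have yz i : (z <= i)%N -> y i <= y z by move=> zi; rewrite -(subnKC zi) ydec.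
have yz1 i : (z < i)%N -> y i <= e ^+ 2 * y z.
  by move=> zi; apply: le_trans (wS z); rewrite -(subnKC zi) ydec.
have cs (i j : nat) : (z <= i)%N -> (z <= j)%N -> ((z < i) || (z < j))%N -> `|ip (w i) (w j)| <= e * y z.
  move=> zi zj zij; rewrite -(@ler_pXn2r _ 2%N) ?nnegrE ?mulr_ge0 ?pi//.
  rewrite real_normK ?num_real//; apply: le_trans (psd_cauchy_schwarz bi si pi _ _) _.
  rewrite exprMn; have yz0 : 0 <= y z := pi _.
  case/orP: zij => h.
    have := yz1 _ h; have := yz _ zj; have := pi (w j); have := pi (w i); rewrite -/(y i) -/(y j).
    move=> yi0 yj0 hj hi; apply: (@le_trans _ _ (e ^+ 2 * y z * y z)); last by rewrite expr2 mulrA.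
    by rewrite ler_pM.
  have := yz1 _ h; have := yz _ zi; have := pi (w j); have := pi (w i); rewrite -/(y i) -/(y j).
  move=> yi0 yj0 hj hi; apply: (@le_trans _ _ (y z * (e ^+ 2 * y z))); first by rewrite ler_pM.
  by rewrite (expr2 (y z)) mulrCA.
have -> : (a z z + abs_sum n a * e) * ip (w z) (w z) =
  \sum_(i < n) \sum_(j < n) (((i == z :> nat) && (j == z :> nat))%:R * (a z z * y z)
     + `|a i j| * (e * y z)).
  under eq_bigr => i _ do rewrite big_split -mulr_suml -mulr_suml.
  rewrite big_split -mulr_suml -mulr_suml mulrDl -mulrA; congr (_ + _).
  rewrite (bigD1 (Ordinal zn)) //= (bigD1 (Ordinal zn)) //= eqxx.
  rewrite big1 ?addr0 => [|j jz]; last first.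
    by move: jz; rewrite -val_eqE => /negPf /= ->.
  rewrite big1 ?addr0 ?mul1r// => i iz; rewrite big1// => j _.
  by move: iz; rewrite -val_eqE => /negPf /= ->.
apply: ler_sum => i _; apply: ler_sum => j _.
have [ijz|] := boolP ((i < z) || (j < z))%N.
  have -> : (i == z :> nat) && (j == z :> nat) = false by lia.
  by rewrite az// !mul0r add0r !mulr_ge0// pi.
rewrite negb_or -!leqNgt => /andP[iz jz].
case: (boolP ((i == z :> nat) && (j == z :> nat))) => [/andP[/eqP iE /eqP jE]|h].
  rewrite iE jE -/(y z); by rewrite mul1r lerDl mulr_ge0// mulr_ge0// pi.
rewrite mul0r add0r; apply: le_trans (ler_norm _) _; rewrite normrM ler_wpM2l//.
by apply: cs => //; lia.
Qed.

(** The leading block controls [S], the sum of the jumps of index below [rho]. All other entries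
    involve an index at least [rho]; their part in [S] is absorbed, the rest is charged to [Y]. The
    factor 2 in front of [Y] comes from [J u u <= 2 * ip u u]. *)
Lemma dissipation_lower n rho (b : nat -> nat -> R) :
  (forall i j, b i j = b j i) -> (rho <= n)%N -> pos_quad rho b ->
  exists2 C : R, 0 <= C & forall (X : lmodType R) (J : X -> X -> R) (w : nat -> X) (Y : R),
    psd_form J -> (forall i, (rho <= i)%N -> J (w i) (w i) <= 2 * Y) -> 0 <= Y ->
    - C * Y <= \sum_(i < n) \sum_(j < n) b i j * J (w i) (w j).
Proof.
move=> sb rn pb; have [eps eps0 coer] := pos_quad_coercive sb pb.
set beta : R := abs_sum n b + 1.
have beta1 : 0 < beta by rewrite /beta; have := abs_sum_ge0 n b; lra.
(* This weight makes all cross terms together cost at most half of [eps * S]. *)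
set t : R := eps / beta; have t0 : 0 < t by rewrite divr_gt0.
exists (beta * (t^-1 + 2)).
  by rewrite mulr_ge0 ?ltW// addr_gt0 ?invr_gt0.
move=> X J w Y psd JY Y0; have [bJ sJ pJ] := psd.
set S := \sum_(i < rho) J (w i) (w i).
have S0 : 0 <= S by apply: sumr_ge0.
have JS i : (i < rho)%N -> J (w i) (w i) <= S.
  by move=> ir; rewrite /S (bigD1 (Ordinal ir)) //= lerDl sumr_ge0.
(* A common bound for all entries with an index at least [rho]: [4 * Y] covers two such indices, the
   other terms a mixed pair. *)
set Z := 2^-1 * (t * S + (2 * t^-1 + 4) * Y).
have Z0 : 0 <= Z.
  have h2 : 0 <= t * S by rewrite mulr_ge0// ltW.
  have h3 : 0 <= t^-1 * Y by rewrite mulr_ge0// invr_ge0 ltW.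
  rewrite /Z; lra.
have cross (i j : nat) : (rho <= i)%N -> `|J (w i) (w j)| <= Z.
  move=> ri; have JiY := JY _ ri.
  have t1 : 0 < t^-1 by rewrite invr_gt0.
  have [jr|rj] := ltnP j rho.
    have := psd_amgm bJ sJ pJ (w j) (w i) t0; rewrite sJ => h.
    have h2 : t * J (w j) (w j) <= t * S by rewrite ler_pM2l// JS.
    have h3 : t^-1 * J (w i) (w i) <= t^-1 * (2 * Y) by rewrite ler_pM2l.
    rewrite /Z; lra.
  have := psd_amgm bJ sJ pJ (w j) (w i) ltr01; rewrite sJ invr1 !mul1r => h.
  have JjY := JY _ rj.
  have h2 : 0 <= t * S by rewrite mulr_ge0// ltW.
  have h3 : 0 <= t^-1 * Y by rewrite mulr_ge0// ltW.
  rewrite /Z; lra.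
(* The entries of the leading block are charged as well, which is harmless as [Z] is nonnegative and
   lets the charges sum to [abs_sum n b * Z]. *)
have main : \sum_(i < n) \sum_(j < n) (((i < rho) && (j < rho))%N%:R * (b i j * J (w i) (w j)) - `|b i j| * Z)
   <= \sum_(i < n) \sum_(j < n) b i j * J (w i) (w j).
  apply: ler_sum => i _; apply: ler_sum => j _.
  case: (boolP ((i < rho) && (j < rho))%N) => h.
    by rewrite mul1r gerBl mulr_ge0.
  rewrite mul0r sub0r lerNl; apply: le_trans (ler_norm _) _.
  rewrite normrN normrM ler_wpM2l//.
  have [ri|ir] := leqP rho i; first exact: cross.
  by rewrite sJ; apply: cross; lia.
apply: le_trans main.
have -> : \sum_(i < n) \sum_(j < n) (((i < rho) && (j < rho))%N%:R * (b i j * J (w i) (w j)) - `|b i j| * Z)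
  = qform J rho b w - abs_sum n b * Z.
  under eq_bigr => i _ do rewrite sumrB -mulr_suml.
  rewrite sumrB -mulr_suml; congr (_ - _).
  rewrite /qform (big_ord_widen n (fun i => \sum_(j < rho) b i j * J (w i) (w j)) rn) [RHS]big_mkcond /=.
  apply: eq_bigr => i _; case: ltnP => _ /=; last by rewrite big1// => j _; rewrite mul0r.
  rewrite (big_ord_widen n (fun j => b i j * J (w i) (w j)) rn) [RHS]big_mkcond /=.
  by apply: eq_bigr => j _; case: ltnP => _ /=; rewrite ?mul1r ?mul0r.
have := coer _ _ w psd; rewrite -/S => h.
have h2 : abs_sum n b * Z <= beta * Z by rewrite ler_wpM2r// /beta lerDl.
have h3 : beta * Z = 2^-1 * (eps * S) + beta * (t^-1 + 2) * Y.
  rewrite /Z /t; field; rewrite !gt_eqF//.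
have : 0 <= eps * S by rewrite mulr_ge0// ltW.
lra.
Qed.

Lemma posdef_pos_quad (b : nat -> nat -> R) n : posdef (lead_sub b n) -> pos_quad n b.
Proof.
move=> pd v [i lti vi]; pose r : 'cV[R]_n := \col_i v i.
have rn0 : r != 0.
  by apply/cV0Pn; exists (Ordinal lti); rewrite mxE.
have := pd r rn0; rewrite mxE; congr (0 < _).
rewrite /qform exchange_big; apply: eq_bigr => j _ /=.
rewrite !mxE mulr_suml; apply: eq_bigr => k _; rewrite !mxE; ring.
Qed.

Lemma pos_quad_posdef1 (b : nat -> nat -> R) : 0 < b 0%N 0%N -> posdef (lead_sub b 1).
Proof.
move=> b0 v vn0; rewrite mxE big_ord1 mxE big_ord1 !mxE.
have v0 : v 0 0 != 0.
  by apply: contra_neq vn0 => h; apply/colP => i; rewrite !ord1 h mxE.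
have -> : v 0 0 * b (0 : 'I_1) (0 : 'I_1) * v 0 0 = b 0%N 0%N * v 0 0 ^+ 2 by rewrite /=; ring.
by rewrite mulr_gt0// lt_neqAle sqr_ge0 eq_sym sqrf_eq0 v0.
Qed.

End Estimates.

(** * Stability of abstract CDG schemes *)

Section Scheme.
Variable R : realType.

(** All that the stability proof uses of a mesh. The bound on [H] is additive so that it passes to
    sums over cells term by term; rescaling an argument recovers the product form. The space is
    spanned only up to null vectors, and [th] stands for [1 / tau_max]. *)
Record cdg_scheme (X : lmodType R) (K h : R) (ip H : X -> X -> R) : Prop := CdgScheme {
  cdg_h : 0 < h;
  cdg_ip : psd_form ip;
  cdg_H : bilin H;
  cdg_bound : forall u v, h * (2 * `|H u v|) <= K * (ip u u + ip v v);
  cdg_span : exists n (e : 'I_n -> X), forall x, exists c : 'I_n -> R,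
    let z := x - \sum_i c i *: e i in ip z z = 0;
  cdg_jump : exists J (th : R), [/\ psd_form J, forall u, J u u <= 2 * ip u u,
    forall u v, H u v + H v u = - 2 * th * J u v, 0 <= th & h * th <= K] }.

Section OneScheme.
Variables (X : lmodType R) (K h : R) (ip H : X -> X -> R).
Hypotheses (K0 : 0 < K) (cdg : cdg_scheme K h ip H).

(** Rescaling a null [v] leaves the right side of [cdg_bound] at [K * ip u u], while a nonzero
    [H u v] would make the left side grow without bound. *)
Lemma cdg_null u v : ip v v = 0 -> H u v = 0.
Proof.
move=> v0; have [_ bf] := cdg_H cdg; have h0 := cdg_h cdg.
apply/eqP; rewrite -normr_eq0; apply/eqP/le_anti; rewrite normr_ge0 andbT leNgt.
apply/negP => Hp; have [bi _ pi] := cdg_ip cdg.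
set D := K * ip u u; have D0 : 0 <= D by rewrite mulr_ge0 ?pi// ltW.
have t0 : 0 < (D + 1) / (h * `|H u v|) by rewrite divr_gt0 ?mulr_gt0// ltr_wpDl.
have := cdg_bound cdg u (((D + 1) / (h * `|H u v|)) *: v).
rewrite (bilinZr (cdg_H cdg)) (bilinZr bi) (bilinZl bi) v0 !mulr0 addr0 -/D.
rewrite normrM gtr0_norm//.
have -> : h * (2 * ((D + 1) / (h * `|H u v|) * `|H u v|)) = 2 * (D + 1).
  by field; rewrite !gt_eqF.
lra.
Qed.

Lemma cdg_nulll u v : ip u u = 0 -> H u v = 0.
Proof.
move=> u0; have [J [th [psdJ Jip HJ _ _]]] := cdg_jump cdg.
have [bJ sJ pJ] := psdJ.
have := HJ u v; rewrite (cdg_null _ u0) addr0 => ->.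
rewrite sJ (psd_null bJ sJ pJ) ?mulr0//.
by apply/le_anti; rewrite pJ andbT; have := Jip u; rewrite u0 mulr0.
Qed.

Lemma temporal_differences (tau : R) u : exists w : nat -> X, w 0%N = u /\
  forall i phi, ip (w i.+1) phi = tau * H (w i) phi.
Proof.
have [n [e sp]] := cdg_span cdg.
have ex x : exists w, forall phi, ip w phi = tau * H x phi.
  apply: (@riesz _ _ ip (fun phi => tau * H x phi) n e (cdg_ip cdg)) => //.
    by move=> a y z; rewrite (cdg_H cdg).2; ring.
  by move=> v /cdg_null ->; rewrite mulr0.
(* [T] represents [tau L] up to null vectors; linearity of [T] is not claimed, only the tested
   relation between successive iterates. *)
have [T hT] := choice ex.
by exists (fun i => iter i T u); split => // i phi; rewrite iterS hT.
Qed.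

Lemma temporal_difference_decay (tau : R) (w : nat -> X) : 0 < tau ->
  (forall i phi, ip (w i.+1) phi = tau * H (w i) phi) ->
  forall i, ip (w i.+1) (w i.+1) <= (K * (tau / h)) ^+ 2 * ip (w i) (w i).
Proof.
move=> tau0 wS i; set e := K * (tau / h); have h0 := cdg_h cdg.
have e0 : 0 < e by rewrite mulr_gt0// divr_gt0.
have [bi _ pi] := cdg_ip cdg.
(* With [e * h = K * tau] the left side is at least [2 * K * y1], and the right side is
   [K * (e ^+ 2 * y + y1)]; one copy of [y1] cancels. *)
have := cdg_bound cdg (e *: w i) (w i.+1).
rewrite (bilinZl (cdg_H cdg)) (bilinZl bi) (bilinZr bi) normrM gtr0_norm//.
set y := ip (w i) _; set y1 := ip (w i.+1) _ => hb.
have y1E : y1 <= tau * `|H (w i) (w i.+1)|.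
  by rewrite /y1 wS; apply: ler_wpM2l; [exact: ltW|exact: ler_norm].
have eh : e * h = K * tau by rewrite /e; field; rewrite gt_eqF.
have : K * (2 * y1) <= K * (e * (e * y) + y1).
  apply: le_trans hb.
  have -> : h * (2 * (e * `|H (w i) (w i.+1)|)) = (e * h) * 2 * `|H (w i) (w i.+1)| by ring.
  rewrite eh; have : K * y1 <= K * (tau * `|H (w i) (w i.+1)|) by rewrite ler_pM2l.
  lra.
by rewrite ler_pM2l// expr2; lra.
Qed.

End OneScheme.

Variables (s r : nat) (c d : nat -> nat -> R) (m zeta rho : nat).
Hypotheses (rk : rk_method s r c d) (m0 : (1 <= m)%N)
  (term : termination_index c d s m zeta)
  (contrib : contribution_index c d s m zeta rho).

Let a := mtpA c d s m zeta zeta zeta.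

Lemma termination_le : (zeta <= m * s)%N.
Proof.
rewrite leqNgt; apply/negP => h; have [/eqP nz _] := term; apply: nz.
exact: mtpA_out.
Qed.

Lemma termination_gt0 : (0 < zeta)%N.
Proof.
have [/eqP nz _] := term; rewrite lt0n; apply/eqP => z0; apply: nz.
by rewrite z0 /mtpA /= /A0 ltn0.
Qed.

Lemma contribution_gt0 : (0 < rho)%N.
Proof.
have [_ [_ cmax]] := contrib; rewrite lt0n; apply/negP => /eqP r0.
apply: (cmax 1%N); rewrite ?r0 ?termination_gt0//.
by apply: pos_quad_posdef1; apply: (mtpB00 rk m0); exact: termination_gt0.
Qed.

(** Since [alpha_0 = 1], the zero at [(0, 0)] in [A0] amounts to subtracting the old energy. The
    Gram matrices of [ip] and [J] on the temporal differences satisfy the shift identity of the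
    process with [mu = tau * th]. *)
Lemma energy_balance (X : lmodType R) (ip J H : X -> X -> R) (th tau : R)
    (w : nat -> X) (U : nat -> nat -> X) :
  psd_form ip -> psd_form J -> bilin H ->
  (forall u v, ip u u = 0 -> H u v = 0) ->
  (forall u v, H u v + H v u = - 2 * th * J u v) ->
  (forall i phi, ip (w i.+1) phi = tau * H (w i) phi) -> w 0%N = U 0%N 0%N ->
  rk_traj ip H s c d tau m U ->
  ip (U m 0%N) (U m 0%N) - ip (U 0%N 0%N) (U 0%N 0%N) =
  \sum_(i < (m * s).+1) \sum_(j < (m * s).+1) mtpA c d s m zeta i j * ip (w i) (w j)
  - tau * th * \sum_(i < (m * s).+1) \sum_(j < (m * s).+1) mtpB c d s m zeta i j * J (w i) (w j).
Proof.
move=> psdi psdJ bH Hn HJ wS w0 tr; have [bi si pi] := psdi; have [bJ sJ pJ] := psdJ.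
set N := (m * s)%N.
have gs i j : ip (w i) (w j) = ip (w j) (w i) by [].
have ks i j : J (w i) (w j) = J (w j) (w i) by [].
rewrite (tri_sumE _ (mtpA_sym c d s m zeta) gs) (tri_sumE _ (mtpB_sym c d s m zeta) ks).
have [_ Al] := term.
rewrite -(@mtp_energy _ c d s m zeta (tau * th) (fun i j => ip (w i) (w j)) (fun i j => J (w i) (w j))) //; last 2 first.
- exact: termination_le.
- by move=> i j; rewrite (si (w i)) !wS -mulrDr HJ; ring.
rewrite -(tri_sumE _ (mtpA_sym c d s m 0) gs).
have tp := traj_poly psdi bH Hn wS w0 tr.
rewrite tp si tp (poly_comb_widen w (size_rk_polyX c d s m)) -/N.
rewrite bilin_suml//.
under eq_bigr => i _ do rewrite bilin_sumr// mulr_sumr.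
rewrite -w0; apply/eqP; rewrite subr_eq addrC; apply/eqP.
rewrite (eq_bigr (fun i : 'I_N.+1 => \sum_(j < N.+1) ((((i : nat) == 0%N) && ((j : nat) == 0%N))%:R
    * ip (w 0%N) (w 0%N) + mtpA c d s m 0 i j * ip (w i) (w j)))); last first.
  move=> i _; apply: eq_bigr => j _; rewrite /mtpA /= /A0 -/N.
  have -> : (N < i)%N || (N < j)%N = false.
    by have := ltn_ord i; have := ltn_ord j; lia.
  case: ifP => [/andP[/eqP-> /eqP->]|_]; last by rewrite mul0r add0r mulrA.
  have := rk_alpha0 m rk; rewrite /rk_alpha => ->. by rewrite /= !mul1r mul0r addr0.
under eq_bigr => i _ do rewrite big_split -mulr_suml.
rewrite big_split -mulr_suml; congr (_ + _).
rewrite big_ord_recl big_ord_recl /= big1 ?addr0 => [|j _]; last by [].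
by rewrite big1 ?addr0 ?mul1r// => i _; rewrite big1.
Qed.

(** [C] is fixed before the space, the mesh and [K], so it depends on the RK coefficients and the
    indices only. The sequence [y] collects the squared norms of the temporal differences; what
    remains afterwards concerns real numbers. The dissipation error gets its factor [e] from
    [tau * th <= e]. *)
Lemma stability_estimate : exists2 C : R, 0 <= C &
  forall (X : lmodType R) (K h : R) (ip H : X -> X -> R), 0 < K -> cdg_scheme K h ip H ->
  forall (tau : R) (U : nat -> nat -> X), 0 < tau -> rk_traj ip H s c d tau m U ->
  let e := K * (tau / h) in e <= 1 ->
  exists y : nat -> R, [/\ y 0%N = ip (U 0%N 0%N) (U 0%N 0%N),
    forall i, 0 <= y i, forall i, y i.+1 <= e ^+ 2 * y i &
    ip (U m 0%N) (U m 0%N) - y 0%N <= (a + C * e) * y zeta + C * e * y rho].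
Proof.
have [rz [pd _]] := contrib.
have rN : (rho <= (m * s).+1)%N by apply: (leq_trans rz); exact/leqW/termination_le.
have [C C0 dis] := dissipation_lower (mtpB_sym c d s m zeta) rN (posdef_pos_quad pd).
set CA := abs_sum (m * s).+1 (mtpA c d s m zeta).
have CA0 : 0 <= CA by exact: abs_sum_ge0.
exists (C + CA); first by rewrite addr_ge0.
move=> X K h ip H K0 cdg tau U tau0 tr e e1.
have [J [th [psdJ Jip HJ th0 thK]]] := cdg_jump cdg.
have psdi := cdg_ip cdg; have [bi si pi] := psdi.
have [w [w0 wS]] := temporal_differences K0 cdg tau (U 0%N 0%N).
have h0 := cdg_h cdg.
have e0 : 0 < e by rewrite mulr_gt0// divr_gt0.
have dec := temporal_difference_decay K0 cdg tau0 wS; rewrite -/e in dec.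
exists (fun i => ip (w i) (w i)); split => //; first by rewrite w0.
rewrite w0 (energy_balance psdi psdJ (cdg_H cdg) (cdg_nulll K0 cdg) HJ wS w0 tr).
have up := @energy_upper _ X ip w (m * s).+1 zeta (mtpA c d s m zeta) e psdi.
have {}up := up termination_le.
have {}up : \sum_(i < (m * s).+1) \sum_(j < (m * s).+1) mtpA c d s m zeta i j * ip (w i) (w j) <=
   (a + CA * e) * ip (w zeta) (w zeta).
  apply: up => //; last by rewrite ltW.
  by move=> i j /orP[h1|h1]; [rewrite mtpA_sym|]; exact: mtpA_low.
have ydec i j : ip (w (i + j)%N) (w (i + j)%N) <= ip (w i) (w i).
  elim: j => [|j IH]; first by rewrite addn0.
  rewrite addnS; apply: le_trans IH; apply: (le_trans (dec _)).
  by rewrite ler_piMl ?pi// expr_le1// ltW.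
have := dis X J w (ip (w rho) (w rho)) psdJ.
have Jr i : (rho <= i)%N -> J (w i) (w i) <= 2 * ip (w rho) (w rho).
  by move=> ri; apply: (le_trans (Jip _)); rewrite ler_pM2l// -(subnKC ri) ydec.
move=> /(_ Jr (pi _)).
set SB := \sum_(i < _) _ => hSB.
have mu0 : 0 <= tau * th by rewrite mulr_ge0// ltW.
have mue : tau * th <= e.
  rewrite /e mulrA ler_pdivlMr// (mulrC K) -mulrA ler_pM2l//; by rewrite mulrC.
have d1 : - (tau * th * SB) <= C * e * ip (w rho) (w rho).
  have q1 : tau * th * (- (C * ip (w rho) (w rho))) <= tau * th * SB by rewrite ler_wpM2l//; lra.
  have q2 : (tau * th) * (C * ip (w rho) (w rho)) <= e * (C * ip (w rho) (w rho)).
    by rewrite ler_wpM2r// mulr_ge0// pi.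
  lra.
have q3 : 0 <= C * e * ip (w zeta) (w zeta) by apply: mulr_ge0 (pi _); apply: mulr_ge0 => //; exact: ltW.
have q4 : 0 <= CA * e * ip (w rho) (w rho) by apply: mulr_ge0 (pi _); apply: mulr_ge0 => //; exact: ltW.
lra.
Qed.

(** The exponent is [q / (q - 1)]: raising the condition to the power [q - 1] gives
    [tau^(q-1) <= h^q], and a factor [tau / h^q] on both sides concludes. *)
Lemma cfl_power (tau h : R) q : (1 < q)%N -> 0 < h -> 0 < tau ->
  tau <= h `^ (1 + ((q.-1)%:R)^-1) -> (tau / h) ^+ q <= tau.
Proof.
case: q => [//|[//|q]] _ h0 tau0 /= th.
have : tau ^+ q.+1 <= h ^+ q.+2.
  have hh : h `^ (1 + q.+1%:R^-1) ^+ q.+1 = h ^+ q.+2.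
    rewrite -powR_mulrn ?powR_ge0// -powRrM -powR_mulrn ?ltW//; congr (_ `^ _).
    by rewrite mulrDl mul1r mulVf ?pnatr_eq0// -(natr1 q.+1).
  rewrite -hh ler_pXn2r// ?nnegrE ?powR_ge0// ltW//.
move=> hq; rewrite expr_div_n exprS ler_pdivrMr ?exprn_gt0// ler_pM2l//.
Qed.

Variables (I : Type) (X : lmodType R) (adm : I -> Prop) (h : I -> R) (ip H : I -> X -> X -> R).
Variable K : R.
Hypotheses (K0 : 0 < K) (cdg : forall M, adm M -> cdg_scheme K (h M) (ip M) (H M)).

Lemma weak_stable_power q : (1 < q)%N ->
  (exists2 D : R, 0 <= D & forall M tau U, adm M -> 0 < tau -> rk_traj (ip M) (H M) s c d tau m U ->
    let e := K * (tau / h M) in e <= 1 ->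
    ip M (U m 0%N) (U m 0%N) - ip M (U 0%N 0%N) (U 0%N 0%N) <= D * e ^+ q * ip M (U 0%N 0%N) (U 0%N 0%N)) ->
  weak_stable adm h ip H s c d m q.
Proof.
(* [K^-1] ensures [e <= 1]. In the growth rate, [cfl_power] bounds [e ^+ q] by [K ^+ q * tau]; the
   summand 1 makes the constant positive. *)
move=> q1 [D D0 est]; exists K^-1; split; first by rewrite invr_gt0.
exists (D * K ^+ q + 1); split; first by rewrite ltr_wpDl// mulr_ge0// exprn_ge0// ltW.
move=> M aM tau tau0 lam tauh U tr; have cd := cdg aM; have h0 := cdg_h cd.
have [_ _ pi] := cdg_ip cd.
rewrite !sqr_sqrtr ?pi//.
have e1 : K * (tau / h M) <= 1 by rewrite mulrC -ler_pdivlMr// div1r.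
have := est M tau U aM tau0 tr e1; set y := ip M (U 0%N 0%N) _ => hy.
have y0 : 0 <= y by exact: pi.
have := cfl_power q1 h0 tau0 tauh => hq.
have : D * (K * (tau / h M)) ^+ q * y <= D * K ^+ q * tau * y.
  rewrite exprMn mulrA ler_wpM2r// ler_wpM2l// mulr_ge0// exprn_ge0// ltW//.
have : 0 <= tau * y by rewrite mulr_ge0// ltW.
lra.
Qed.

Lemma stability_of_scheme : stability_conclusions adm h ip H s c d m zeta rho.
Proof.
have [C C0 est] := stability_estimate.
have r0 := contribution_gt0; have z0 := termination_gt0.
have ydec (y : nat -> R) (e : R) : 0 <= e -> (forall i, 0 <= y i) ->
    (forall i, y i.+1 <= e ^+ 2 * y i) -> forall i, y i <= e ^+ (2 * i) * y 0%N.
  move=> e0 y0 yS; elim=> [|i IH]; first by rewrite muln0 expr0 mul1r.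
  apply: (le_trans (yS i)); rewrite mulnS exprD -mulrA ler_wpM2l// exprn_ge0//.
split => [rz an|rz ap|rz].
- have {}an : a < 0 by exact: an.
  have D0 : 0 < 2 * C + 1 - a by lra.
  (* The condition becomes [e * (2 * C + 1 - a) <= - a], which yields both [a + 2 * C * e <= 0] and,
     the quotient being at most 1, [e <= 1]. *)
  exists (K^-1 * (- a / (2 * C + 1 - a))); split.
    by rewrite mulr_gt0 ?invr_gt0// divr_gt0// oppr_gt0.
  move=> M aM tau tau0 tauh U tr; have cd := cdg aM; have h0 := cdg_h cd.
  have [_ _ pi] := cdg_ip cd.
  have eK : K * (tau / h M) <= - a / (2 * C + 1 - a).
    by rewrite mulrC -ler_pdivlMr// ler_pdivrMr// (mulrC _ K^-1).
  have e1 : K * (tau / h M) <= 1.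
    by apply: le_trans eK _; rewrite ler_pdivrMr//; lra.
  have [y [y0 yp yS hy]] := est _ _ _ _ _ K0 cd tau U tau0 tr e1.
  apply: ler_wsqrtr; rewrite -subr_le0 -y0; apply: (le_trans hy).
  rewrite rz -mulrDl; apply: mulr_le0_ge0 => //.
  move: eK; rewrite ler_pdivlMr// -/a; set e := K * _ in e1 * => eK.
  have e0 : 0 <= e by rewrite ltW// mulr_gt0// divr_gt0.
  have : 0 <= e * (1 - a) by rewrite mulr_ge0//; lra.
  lra.
- have {}ap : 0 < a by exact: ap.
  apply: weak_stable_power; first by lia.
  exists (a + 2 * C); first by rewrite addr_ge0 ?mulr_ge0// ltW.
  move=> M tau U aM tau0 tr e e1; have cd := cdg aM; have h0 := cdg_h cd.
  have [y [y0 yp yS hy]] := est _ _ _ _ _ K0 cd tau U tau0 tr e1.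
  have e0 : 0 <= e by rewrite ltW// mulr_gt0// divr_gt0.
  rewrite -y0; apply: (le_trans hy); rewrite rz -mulrDl -/e.
  apply: (@le_trans _ _ ((a + 2 * C) * y zeta)).
    have : C * e <= C by rewrite ler_piMr.
    by move=> ?; rewrite ler_wpM2r//; lra.
  by rewrite -mulrA ler_wpM2l ?ydec//; have := ltW ap; rewrite -/a; lra.
- apply: weak_stable_power; first by lia.
  have a0 : 0 <= `|a| by [].
  exists (`|a| + 2 * C); first by rewrite addr_ge0 ?mulr_ge0.
  move=> M tau U aM tau0 tr e e1; have cd := cdg aM; have h0 := cdg_h cd.
  have [y [y0 yp yS hy]] := est _ _ _ _ _ K0 cd tau U tau0 tr e1.
  have e0 : 0 <= e by rewrite ltW// mulr_gt0// divr_gt0.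
  have ee : e ^+ 2 <= e by rewrite expr2 ler_piMr.
  have e21 : e ^+ 2 <= 1 by rewrite expr_le1.
  have ymon i j : y (i + j)%N <= y i.
    elim: j => [|j IH]; first by rewrite addn0.
    rewrite addnS; apply: le_trans IH; apply: (le_trans (yS _)).
    by rewrite ler_piMl.
  (* As [zeta] exceeds [rho], the leading term is no larger in order than the dissipation error
     [e * y rho]; the latter fixes the power [2 * rho + 1]. *)
  have yz : y zeta <= e * y rho.
    have -> : zeta = (rho.+1 + (zeta - rho.+1))%N by lia.
    apply: (le_trans (ymon _ _)); apply: (le_trans (yS _)).
    by rewrite ler_wpM2r.
  rewrite -y0; apply: (le_trans hy); rewrite -/e.
  apply: (@le_trans _ _ ((`|a| + 2 * C) * e * y rho)).
    have aC : a + C * e <= `|a| + C.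
      have : C * e <= C by rewrite ler_piMr.
      have := ler_norm a; lra.
    have q1 : (a + C * e) * y zeta <= (`|a| + C) * y zeta by rewrite ler_wpM2r.
    have q2 : (`|a| + C) * y zeta <= (`|a| + C) * (e * y rho) by rewrite ler_wpM2l// addr_ge0.
    lra.
  have -> : (`|a| + 2 * C) * e ^+ (2 * rho).+1 * y 0%N =
    (`|a| + 2 * C) * e * (e ^+ (2 * rho) * y 0%N) by rewrite exprS; ring.
  apply: ler_wpM2l; last exact: ydec.
  by rewrite mulr_ge0// addr_ge0 ?mulr_ge0.
Qed.

End Scheme.

(** * Integrals of polynomial functions *)

Import numFieldNormedType.Exports.
(* mathcomp-reals has another [Rint], the predicate of integer-valued reals. *)
Import Defs.
Local Open Scope classical_set_scope.
Local Open Scope ring_scope.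

Section PolynomialIntegrals.
Variable R : realType.
Implicit Types (f g F : R -> R) (a b s : R) (p q : {poly R}).
Notation mu := (@lebesgue_measure R).

(** Every integrand of the scheme is polynomial on each piece, so the rules below need no separate
    integrability condition. *)
Definition polyfun f := exists p : {poly R}, forall x, f x = p.[x].

Lemma polyfun_horner p : polyfun (fun x => p.[x]).
Proof. by exists p. Qed.
Lemma polyfun_cst (c : R) : polyfun (fun=> c).
Proof. by exists c%:P => x; rewrite hornerC. Qed.
Lemma polyfun_id : polyfun (fun x => x).
Proof. by exists 'X => x; rewrite hornerX. Qed.
Lemma polyfunD f g : polyfun f -> polyfun g -> polyfun (fun x => f x + g x).
Proof. by move=> [p hp] [q hq]; exists (p + q) => x; rewrite hornerD hp hq. Qed.
Lemma polyfunN f : polyfun f -> polyfun (fun x => - f x).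
Proof. by move=> [p hp]; exists (- p) => x; rewrite hornerN hp. Qed.
Lemma polyfunM f g : polyfun f -> polyfun g -> polyfun (fun x => f x * g x).
Proof. by move=> [p hp] [q hq]; exists (p * q) => x; rewrite hornerM hp hq. Qed.
Lemma polyfun_comp f g : polyfun f -> polyfun g -> polyfun (fun x => f (g x)).
Proof. by move=> [p hp] [q hq]; exists (p \Po q) => x; rewrite horner_comp hp hq. Qed.
Lemma polyfun_sum (I : Type) (r : seq I) (f : I -> R -> R) :
  (forall i, polyfun (f i)) -> polyfun (fun x => \sum_(i <- r) f i x).
Proof.
move=> pf; elim: r => [|i r IH].
  by exists 0 => x; rewrite big_nil horner0.
by have [p hp] := polyfunD (pf i) IH; exists p => x; rewrite big_cons hp.
Qed.

(** At [i = 0] the division by zero returns 0, the constant term. *)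
Definition primitive p : {poly R} := \poly_(i < (size p).+1) (p`_i.-1 / i%:R).

Lemma deriv_primitive p : (primitive p)^`() = p.
Proof.
apply/polyP => i; rewrite coef_deriv coef_poly ltnS /=.
case: ltnP => h; first by rewrite -[LHS]mulr_natr mulfVK// pnatr_eq0.
by rewrite mul0rn nth_default.
Qed.

Lemma polyfun_integrable a b f : polyfun f -> mu.-integrable `[a, b] (EFin \o f).
Proof.
move=> [p hp]; have -> : f = horner p by apply/funext.
apply: continuous_compact_integrable; first exact: segment_compact.
by apply: continuous_subspaceT => x; exact: continuous_horner.
Qed.

Lemma Rint_poly a b p : a < b ->
  Rint a b (fun x => p.[x]) = (primitive p).[b] - (primitive p).[a].
Proof.
move=> ab; rewrite /Rint /Rintegral (@continuous_FTC2 _ _ (horner (primitive p))) //.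
- by apply: continuous_subspaceT => x; exact: continuous_horner.
- split.
  + by move=> x _; exact: derivable_horner.
  + by apply: cvg_at_right_filter; exact: continuous_horner.
  + by apply: cvg_at_left_filter; exact: continuous_horner.
- by move=> x _; rewrite -derivE deriv_primitive.
Qed.

Lemma eq_Rint a b f g : (forall x, a <= x <= b -> f x = g x) -> Rint a b f = Rint a b g.
Proof.
by move=> fg; apply: eq_Rintegral => x; rewrite inE /= in_itv /= => /fg.
Qed.

Lemma RintD a b f g : polyfun f -> polyfun g ->
  Rint a b (fun x => f x + g x) = Rint a b f + Rint a b g.
Proof. by move=> pf pg; rewrite /Rint RintegralD//; exact: polyfun_integrable. Qed.

Lemma RintZ a b (c : R) f : polyfun f -> Rint a b (fun x => c * f x) = c * Rint a b f.
Proof. by move=> pf; rewrite /Rint RintegralZl//; exact: polyfun_integrable. Qed.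

Lemma RintN a b f : polyfun f -> Rint a b (fun x => - f x) = - Rint a b f.
Proof.
move=> pf; rewrite -mulN1r -RintZ//.
by apply: eq_Rint => x _; rewrite mulN1r.
Qed.

Lemma RintB a b f g : polyfun f -> polyfun g ->
  Rint a b (fun x => f x - g x) = Rint a b f - Rint a b g.
Proof. by move=> pf pg; rewrite RintD ?RintN//; exact: polyfunN. Qed.

Lemma Rint0 a b : Rint a b (fun=> 0) = 0 :> R.
Proof. by rewrite /Rint /Rintegral integral0. Qed.

Lemma Rint_sum a b (I : Type) (r : seq I) (f : I -> R -> R) :
  (forall i, polyfun (f i)) ->
  Rint a b (fun x => \sum_(i <- r) f i x) = \sum_(i <- r) Rint a b (f i).
Proof.
move=> pf; elim: r => [|i r IH].
  by rewrite big_nil -[RHS](Rint0 a b); apply: eq_Rint => x _; rewrite big_nil.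
rewrite big_cons -IH -RintD//; last exact: polyfun_sum.
by apply: eq_Rint => x _; rewrite big_cons.
Qed.

Lemma Rint_ge0 a b f : (forall x, a <= x <= b -> 0 <= f x) -> 0 <= Rint a b f.
Proof. by move=> f0; apply: Rintegral_ge0 => x /=; rewrite in_itv /= => /f0. Qed.

Lemma le_Rint a b f g : polyfun f -> polyfun g ->
  (forall x, a <= x <= b -> f x <= g x) -> Rint a b f <= Rint a b g.
Proof.
move=> pf pg fg; apply: le_Rintegral; [by []|exact: polyfun_integrable..|].
by move=> x /=; rewrite in_itv /= => /fg.
Qed.

Lemma deriv_eq0 p : p^`() = 0 -> p = (p`_0)%:P.
Proof.
move=> p'0; apply/polyP => -[|i]; rewrite coefC//=.
have /eqP := congr1 (fun q : {poly R} => q`_i) p'0.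
by rewrite coef_deriv coef0 mulrn_eq0 /= => /eqP.
Qed.

Lemma Rint_deriv a b p : a < b -> Rint a b (fun x => p^`().[x]) = p.[b] - p.[a].
Proof.
move=> ab; rewrite Rint_poly//.
have e : (primitive p^`() - p)^`() = 0 by rewrite derivB deriv_primitive subrr.
have : (primitive p^`() - p).[b] = (primitive p^`() - p).[a].
  by rewrite (deriv_eq0 e) !hornerC.
by rewrite !hornerD !hornerN; lra.
Qed.

(** Both sides are increments of one primitive, the right one after composition with the affine map;
    the chain rule for polynomials replaces a change of measure. *)
Lemma Rint_affine a b f : a < b -> polyfun f ->
  Rint a b f = (b - a) * Rint 0 1 (fun t => f (a + (b - a) * t)).
Proof.
move=> ab [p hp].
have -> : Rint a b f = Rint a b (fun x => p.[x]) by apply: eq_Rint => x _.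
pose l : {poly R} := a%:P + (b - a) *: 'X.
have lE t : l.[t] = a + (b - a) * t by rewrite hornerD hornerC hornerZ hornerX.
rewrite -RintZ; last first.
  by exists (p \Po l) => t; rewrite horner_comp lE hp.
rewrite Rint_poly//; set P := primitive p.
have -> : Rint 0 1 (fun t => (b - a) * f (a + (b - a) * t)) =
    Rint 0 1 (fun t => ((P \Po l)^`()).[t]).
  apply: eq_Rint => t _; rewrite deriv_comp hornerM horner_comp deriv_primitive lE hp.
  by rewrite derivD derivC add0r derivZ derivX hornerZ hornerC mulr1 mulrC.
by rewrite Rint_deriv// !horner_comp !lE mulr0 mulr1 addr0 subrKC.
Qed.

Lemma Rint_shift a b s f : a < b -> polyfun f ->
  Rint (a + s) (b + s) f = Rint a b (fun x => f (x + s)).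
Proof.
move=> ab pf.
rewrite [LHS]Rint_affine ?ltrD2r// [RHS]Rint_affine//; last first.
  by apply: polyfun_comp pf (polyfunD polyfun_id (polyfun_cst s)).
have -> : b + s - (a + s) = b - a by ring.
by congr (_ * _); apply: eq_Rint => t _; congr f; ring.
Qed.

(** The integrals of the square over [[0, x]] and [[x, 1]] are nonnegative with sum zero, so the
    primitive [Q] is constant on the open interval. A polynomial with that many roots is constant,
    and [p ^+ 2] is its derivative. *)
Lemma Rint_sqr_eq0 p : Rint 0 1 (fun x => p.[x] ^+ 2) = 0 -> p = 0.
Proof.
have E b c : Rint b c (fun x => p.[x] ^+ 2) = Rint b c (fun x => (p ^+ 2).[x]).
  by apply: eq_Rint => x _; rewrite horner_exp.
set Q := primitive (p ^+ 2); move=> I0.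
have Q0 x : 0 < x < 1 -> Q.[x] = Q.[0].
  move=> /andP[x0 x1].
  have h1 : 0 <= Rint 0 x (fun x => p.[x] ^+ 2) by apply: Rint_ge0 => y _; exact: sqr_ge0.
  have h2 : 0 <= Rint x 1 (fun x => p.[x] ^+ 2) by apply: Rint_ge0 => y _; exact: sqr_ge0.
  move: I0 h1 h2; rewrite !E !Rint_poly// -/Q; lra.
have QC : Q - Q.[0]%:P = 0.
  apply: contraTeq isT => Qn0.
  (* The points 1/2, 1/3, ... lie strictly inside the interval; one takes more of them than the
     degree allows. *)
  pose rs := [seq (i.+2%:R : R)^-1 | i <- iota 0 (size (Q - Q.[0]%:P))].
  suff : (size rs < size (Q - Q.[0]%:P)%R)%N by rewrite size_map size_iota ltnn.
  apply: max_poly_roots => //.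
  - apply/allP => y /mapP[i _ ->]; rewrite rootE hornerD hornerN hornerC Q0 ?subrr//.
    by rewrite invr_gt0 ltr0n /= invf_lt1 ?ltr0n// ltr1n.
  - rewrite map_inj_uniq ?iota_uniq// => i j /invr_inj /eqP.
    by rewrite eqr_nat => /eqP [].
have : p ^+ 2 = 0.
  rewrite -[LHS]deriv_primitive -/Q.
  by have /eqP := QC; rewrite subr_eq0 => /eqP ->; rewrite derivC.
by move=> /eqP; rewrite sqrf_eq0 => /eqP.
Qed.

End PolynomialIntegrals.

(** * Piecewise polynomials and inverse inequalities *)

Section PiecewiseIntegrals.
Variable R : realType.
Implicit Types (f F : R -> R) (a b : R).
Notation mu := (@lebesgue_measure R).

(** Half-open pieces are disjoint, and a node belongs to the piece on its right, as in [ind]. The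
    integrability needed to glue pieces is part of the invariant; the last endpoint is restored at
    the end as a null set. *)
Definition pw_int a b F v :=
  mu.-integrable `[a, b[ (EFin \o F) /\ Rintegral mu `[a, b[ F = v.

Lemma pw_int_poly a b f F : polyfun f -> (forall x, a <= x < b -> F x = f x) ->
  pw_int a b F (Rint a b f).
Proof.
move=> pf Ff.
have If : mu.-integrable `[a, b[ (EFin \o f).
  apply: integrableS (polyfun_integrable a b pf) => //.
  by apply: subset_itvl; rewrite bnd_simp.
split.
  apply: eq_integrable If => //= x; rewrite inE /= in_itv /= => h.
  by rewrite Ff.
rewrite /Rint -Rintegral_itv_bndo_bndc//; apply: eq_Rintegral => x.
by rewrite inE /= in_itv /= => /Ff.
Qed.

Lemma pw_int_cat a b c F v w : a <= b -> b <= c ->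
  pw_int a b F v -> pw_int b c F w -> pw_int a c F (v + w).
Proof.
move=> ab bc [I1 E1] [I2 E2].
have disj : [disjoint `[a, b[%classic & `[b, c[%classic].
  apply/disj_setPS => x [] /=; rewrite !in_itv /= => /andP[_ h1] /andP[h2 _].
  by move: (lt_le_trans h1 h2); rewrite ltxx.
have U : `[a, c[%classic = `[a, b[%classic `|` `[b, c[%classic.
  by apply: itv_bndbnd_setU; rewrite bnd_simp.
have IU : mu.-integrable `[a, c[ (EFin \o F).
  have /integrableP[m1 i1] := I1; have /integrableP[m2 i2] := I2.
  have mF := (measurable_funU _ (measurable_itv _) (measurable_itv _)).2 (conj m1 m2).
  rewrite U; apply/integrableP; split => //.
  rewrite ge0_integral_setU//; first exact: lte_add_pinfty.
  by apply: (measurable_funU _ (measurable_itv _) (measurable_itv _)).2 (conj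
    (measurable_int _ (integrable_abse I1)) (measurable_int _ (integrable_abse I2))).
split => //.
by rewrite U Rintegral_setU -?U ?E1 ?E2.
Qed.

Lemma pw_int_Rint a b F v : pw_int a b F v -> Rint a b F = v.
Proof. by move=> [I E]; rewrite /Rint -Rintegral_itv_bndo_bndc. Qed.

Lemma pw_int_sum n (t v : nat -> R) F : (forall i, (i < n)%N -> t i <= t i.+1) ->
  (forall i, (i < n)%N -> pw_int (t i) (t i.+1) F (v i)) ->
  pw_int (t 0%N) (t n) F (\sum_(i < n) v i).
Proof.
elim: n => [|n IH] tle tv.
  rewrite big_ord0 /pw_int set_itvco0; split; first exact: integrable_set0.
  by rewrite Rintegral_set0.
have t0n : t 0%N <= t n.
  have : forall m, (m <= n)%N -> t 0%N <= t m.
    elim=> // m IHm mn; apply: le_trans (IHm _) (tle _ _); lia.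
  by apply.
rewrite big_ord_recr /=; apply: pw_int_cat (tle n _) (IH _ _) (tv n _) => //.
- by move=> i h; apply: tle; lia.
- by move=> i h; apply: tv; lia.
Qed.

Lemma Rint_cells n (t c : nat -> R) F (fl fr : nat -> R -> R) :
  (forall i, (i < n)%N -> t i <= c i) -> (forall i, (i < n)%N -> c i <= t i.+1) ->
  (forall i, polyfun (fl i)) -> (forall i, polyfun (fr i)) ->
  (forall i x, (i < n)%N -> t i <= x < c i -> F x = fl i x) ->
  (forall i x, (i < n)%N -> c i <= x < t i.+1 -> F x = fr i x) ->
  Rint (t 0%N) (t n) F =
  \sum_(i < n) (Rint (t i) (c i) (fl i) + Rint (c i) (t i.+1) (fr i)).
Proof.
move=> tc ct pl pr Fl Fr; apply: pw_int_Rint.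
apply: (@pw_int_sum n t (fun i => Rint (t i) (c i) (fl i) + Rint (c i) (t i.+1) (fr i))).
  by move=> i h; apply: le_trans (tc i h) (ct i h).
move=> i h; apply: (pw_int_cat (tc i h) (ct i h)); apply: pw_int_poly => // x xi.
- exact: Fl.
- exact: Fr.
Qed.

Lemma Rint_split a c b F (fl fr : R -> R) : a <= c -> c <= b -> polyfun fl -> polyfun fr ->
  (forall x, a <= x < c -> F x = fl x) -> (forall x, c <= x < b -> F x = fr x) ->
  Rint a b F = Rint a c fl + Rint c b fr.
Proof.
move=> ac cb pl pr Fl Fr; apply: pw_int_Rint.
by apply: (pw_int_cat ac cb); apply: pw_int_poly.
Qed.

End PiecewiseIntegrals.

Section InverseInequalities.
Variable R : realType.
Implicit Types (p q : {poly R}) (a b : R).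

Lemma horner_le n (B t : R) q : (size q <= n)%N -> (forall i, `|q`_i| <= B) ->
  0 <= t <= 1 -> `|q.[t]| <= n%:R * B.
Proof.
move=> sq qB /andP[t0 t1]; rewrite (horner_coef_wide _ sq).
apply: (le_trans (ler_norm_sum _ _ _)).
have -> : n%:R * B = \sum_(i < n) B by rewrite sumr_const card_ord mulr_natl.
apply: ler_sum => i _; rewrite normrM -[leRHS]mulr1 ler_pM//.
by rewrite ger0_norm ?exprn_ge0// exprn_ile1.
Qed.

(** Rows of length [k.+1] are coefficient vectors. The integral form is definite on them by
    [Rint_sqr_eq0], so [riesz_bound] applies to each coordinate, and the sum of the constants serves
    all of them. *)
Lemma coef_bound k : exists2 C : R, 0 <= C & forall p, (size p <= k.+1)%N ->
  forall i, p`_i ^+ 2 <= C * Rint 0 1 (fun x => p.[x] ^+ 2).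
Proof.
pose ip (v w : 'rV[R]_k.+1) := Rint 0 1 (fun x => (rVpoly v).[x] * (rVpoly w).[x]).
have psd : psd_form ip.
  have pf (v w : 'rV[R]_k.+1) : polyfun (fun x => (rVpoly v).[x] * (rVpoly w).[x]).
    by apply: polyfunM; exact: polyfun_horner.
  split.
  - split=> c u v w; rewrite /ip -RintZ// -RintD//; try exact: polyfunM (polyfun_cst c) _.
      by apply: eq_Rint => x _; rewrite linearP /= hornerD hornerZ; ring.
    by apply: eq_Rint => x _; rewrite linearP /= hornerD hornerZ; ring.
  - by move=> u v; apply: eq_Rint => x _; rewrite mulrC.
  - by move=> u; apply: Rint_ge0 => x _; rewrite -expr2 sqr_ge0.
have ex (i : 'I_k.+1) : exists C, 0 <= C /\ forall v : 'rV[R]_k.+1, v 0 i ^+ 2 <= C * ip v v.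
  apply: (@riesz_bound R _ ip (fun v => v 0 i) k.+1 (fun j => delta_mx 0 j) psd).
  - by move=> c u v; rewrite !mxE.
  - move=> v v0; have /(congr1 (@poly_rV _ k.+1)) : rVpoly v = 0.
      by apply: Rint_sqr_eq0; rewrite -[RHS]v0; apply: eq_Rint => x _; rewrite expr2.
    by rewrite rVpolyK linear0 => ->; rewrite mxE.
  - move=> v; exists (fun i => v 0 i); rewrite -row_sum_delta subrr /=.
    by have [bi _ _] := psd; exact: bilin0l.
have [C hC] := fin_all_exists ex.
exists (\sum_i C i); first by apply: sumr_ge0 => i _; have [] := hC i.
move=> p sp i.
have I0 : 0 <= Rint 0 1 (fun x => p.[x] ^+ 2) by apply: Rint_ge0 => x _; exact: sqr_ge0.
have [ik|ik] := ltnP i k.+1; last first.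
  rewrite nth_default ?(leq_trans sp)// expr0n /= mulr_ge0// sumr_ge0// => j _.
  by have [] := hC j.
have [C0 /(_ (poly_rV p))] := hC (Ordinal ik).
rewrite mxE /= => h; apply: (le_trans h).
have -> : ip (poly_rV p) (poly_rV p) = Rint 0 1 (fun x => p.[x] ^+ 2).
  by apply: eq_Rint => x _; rewrite poly_rV_K// expr2.
rewrite ler_wpM2r// (bigD1 (Ordinal ik))//= lerDl sumr_ge0// => j _.
by have [] := hC j.
Qed.

(** Scaling to [[0, 1]]: the integral of the square brings one power of the length, and each
    derivative in the square one more, hence the exponents 1 and 3. *)
Lemma inverse_inequality k : exists2 K : R, 0 < K & forall a b p x, a < b ->
  (size p <= k.+1)%N -> a <= x <= b ->
  (b - a) * p.[x] ^+ 2 <= K * Rint a b (fun x => p.[x] ^+ 2) /\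
  (b - a) ^+ 3 * p^`().[x] ^+ 2 <= K * Rint a b (fun x => p.[x] ^+ 2).
Proof.
have [C C0 hC] := coef_bound k.
set n : R := k.+1%:R; have n1 : 1 <= n by rewrite ler1n.
(* One [n] counts the coefficients, the other bounds the factors that differentiation puts in front
   of them. *)
exists ((n * n) ^+ 2 * C + 1).
  by rewrite ltr_wpDl// mulr_ge0// sqr_ge0.
move=> a b p x ab sp /andP[ax xb].
have ba : 0 < b - a by rewrite subr_gt0.
pose l : {poly R} := a%:P + (b - a) *: 'X.
have lE t : l.[t] = a + (b - a) * t by rewrite hornerD hornerC hornerZ hornerX.
set q := p \Po l.
have sq : (size q <= k.+1)%N.
  have sl : (size l <= 2)%N.
    apply: (leq_trans (size_polyD _ _)); rewrite geq_max size_polyC.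
    apply/andP; split; first by case: (a != 0).
    by apply: (leq_trans (size_scale_leq _ _)); rewrite size_polyX.
  apply: (leq_trans (size_comp_poly_leq _ _)); rewrite ltnS.
  have : ((size p).-1 * (size l).-1 <= k * 1)%N by apply: leq_mul; lia.
  lia.
have IE : Rint a b (fun x => p.[x] ^+ 2) = (b - a) * Rint 0 1 (fun t => q.[t] ^+ 2).
  rewrite Rint_affine//; last first.
    by exists (p ^+ 2) => y; rewrite horner_exp.
  by congr (_ * _); apply: eq_Rint => t _; rewrite horner_comp lE.
set I := Rint 0 1 _ in IE.
have I0 : 0 <= I by apply: Rint_ge0 => t _; exact: sqr_ge0.
set B := Num.sqrt (C * I).
have B0 : 0 <= B := sqrtr_ge0 _.
have B2 : B ^+ 2 = C * I by rewrite sqr_sqrtr// mulr_ge0.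
have qB i : `|q`_i| <= B.
  by rewrite -sqrtr_sqr ler_wsqrtr// hC.
pose t := (x - a) / (b - a).
have t01 : 0 <= t <= 1.
  apply/andP; split; first by rewrite divr_ge0 ?subr_ge0// ltW.
  by rewrite /t ler_pdivrMr// mul1r lerB.
have xE : a + (b - a) * t = x by rewrite /t; field; rewrite gt_eqF.
have q'B i : `|q^`()`_i| <= n * B.
  rewrite coef_deriv -mulr_natl normrM.
  have [ik|ik] := ltnP i.+1 k.+1; last first.
    by rewrite nth_default ?(leq_trans sq)// normr0 mulr0 mulr_ge0// ltW// (lt_le_trans ltr01).
  by rewrite ler_pM// normr_nat ler_nat ltnW.
have sq' : (size q^`() <= k.+1)%N by apply: leq_trans (size_poly _ _) _; lia.
have h1 := horner_le sq qB t01; have h2 := horner_le sq' q'B t01.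
have qt : q.[t] = p.[x] by rewrite horner_comp lE xE.
have q't : q^`().[t] = (b - a) * p^`().[x].
  rewrite deriv_comp hornerM horner_comp lE xE mulrC; congr (_ * _).
  by rewrite derivD derivC add0r derivZ derivX hornerZ hornerC mulr1.
rewrite qt -/n in h1; rewrite q't -/n in h2.
have sqr_le (y z : R) : `|y| <= z -> y ^+ 2 <= z ^+ 2.
  move=> yz; rewrite -(real_normK (num_real y)) lerXn2r ?nnegrE//.
  exact: le_trans (normr_ge0 y) yz.
have n0 : 0 <= n by apply: le_trans n1.
have s1 : p.[x] ^+ 2 <= (n * n) ^+ 2 * (C * I).
  rewrite -B2 -exprMn; apply: sqr_le; apply: le_trans h1 _.
  by rewrite ler_wpM2r// ler_peMl.
have s2 : (b - a) ^+ 2 * p^`().[x] ^+ 2 <= (n * n) ^+ 2 * (C * I).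
  by rewrite -B2 -!exprMn; apply: sqr_le; rewrite -mulrA.
have I1 : 0 <= (b - a) * I by rewrite mulr_ge0// ltW.
rewrite IE; split.
  have : (b - a) * p.[x] ^+ 2 <= (b - a) * ((n * n) ^+ 2 * (C * I)) by rewrite ler_pM2l.
  lra.
have : (b - a) * ((b - a) ^+ 2 * p^`().[x] ^+ 2) <= (b - a) * ((n * n) ^+ 2 * (C * I)) by rewrite ler_pM2l.
rewrite exprS; lra.
Qed.

End InverseInequalities.

(** * The advection form on a half cell *)

Section LocalSchemes.
Variables (R : realType) (X : lmodType R).
Implicit Types (ip J A : X -> X -> R).

(** The skew form [A] is kept apart from the jump form [J], so that pieces can be summed over cells,
    combined over directions and integrated transversally; the weight of [J] is inserted only in
    [cdg_of_local]. *)
Record local_scheme (K h : R) ip J A : Prop := LocalScheme {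
  ls_ip : psd_form ip;
  ls_J : psd_form J;
  ls_jump : forall u, J u u <= 2 * ip u u;
  ls_A : bilin A;
  ls_skew : forall u v, A u v + A v u = 0;
  ls_bound : forall u v, h * (2 * `|A u v|) <= K * (ip u u + ip v v) }.

Lemma bilin_sum (I : finType) (f : I -> X -> X -> R) :
  (forall i, bilin (f i)) -> bilin (fun u v => \sum_i f i u v).
Proof.
move=> bf; split=> a u v w; rewrite mulr_sumr -big_split; apply: eq_bigr => i _.
- exact: (bf i).1.
- exact: (bf i).2.
Qed.

Lemma psd_sum (I : finType) (f : I -> X -> X -> R) :
  (forall i, psd_form (f i)) -> psd_form (fun u v => \sum_i f i u v).
Proof.
move=> pf; split=> [|u v|u].
- by apply: bilin_sum => i; have [] := pf i.
- by apply: eq_bigr => i _; have [] := pf i.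
- by apply: sumr_ge0 => i _; have [] := pf i.
Qed.

Lemma local_scheme_sum (I : finType) K h (ip J A : I -> X -> X -> R) : 0 <= h ->
  (forall i, local_scheme K h (ip i) (J i) (A i)) ->
  local_scheme K h (fun u v => \sum_i ip i u v) (fun u v => \sum_i J i u v)
    (fun u v => \sum_i A i u v).
Proof.
move=> h0 ls; split.
- by apply: psd_sum => i; exact: ls_ip (ls i).
- by apply: psd_sum => i; exact: ls_J (ls i).
- by move=> u; rewrite mulr_sumr; apply: ler_sum => i _; exact: ls_jump (ls i) _.
- by apply: bilin_sum => i; exact: ls_A (ls i).
- by move=> u v; rewrite -big_split big1// => i _; exact: ls_skew (ls i) _ _.
- move=> u v; rewrite -big_split mulr_sumr.
  apply: (@le_trans _ _ (h * (2 * \sum_i `|A i u v|))).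
    by rewrite ler_wpM2l// ler_pM2l// ler_norm_sum.
  by rewrite !mulr_sumr; apply: ler_sum => i _; exact: ls_bound (ls i) _ _.
Qed.

(** The two advection directions share the same [ip] and [J] on a piece; the [c]s are the components
    of the velocity. *)
Lemma local_scheme_lin K h ip J A1 A2 (c1 c2 : R) : 0 <= h ->
  local_scheme K h ip J A1 -> local_scheme K h ip J A2 ->
  local_scheme (K * (`|c1| + `|c2|)) h ip J (fun u v => c1 * A1 u v + c2 * A2 u v).
Proof.
move=> h0 l1 l2; split; first exact: ls_ip l1.
- exact: ls_J l1.
- exact: ls_jump l1.
- by split=> a u v w; rewrite ?(ls_A l1).1 ?(ls_A l1).2 ?(ls_A l2).1 ?(ls_A l2).2; ring.
- move=> u v; have := ls_skew l1 u v; have := ls_skew l2 u v; move=> e1 e2.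
  have -> : c1 * A1 u v + c2 * A2 u v + (c1 * A1 v u + c2 * A2 v u) =
    c1 * (A1 u v + A1 v u) + c2 * (A2 u v + A2 v u) by ring.
  by rewrite e1 e2 !mulr0 addr0.
- move=> u v; have b1 := ls_bound l1 u v; have b2 := ls_bound l2 u v.
  apply: (@le_trans _ _ (h * (2 * (`|c1| * `|A1 u v| + `|c2| * `|A2 u v|)))).
    by rewrite ler_wpM2l// ler_pM2l// -!normrM ler_normD.
  have q1 : `|c1| * (h * (2 * `|A1 u v|)) <= `|c1| * (K * (ip u u + ip v v)) by rewrite ler_wpM2l.
  have q2 : `|c2| * (h * (2 * `|A2 u v|)) <= `|c2| * (K * (ip u u + ip v v)) by rewrite ler_wpM2l.
  lra.
Qed.

Lemma bilin_Rint a b (f : R -> X -> X -> R) : (forall y, bilin (f y)) ->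
  (forall u v, polyfun (fun y => f y u v)) -> bilin (fun u v => Rint a b (fun y => f y u v)).
Proof.
move=> bf pf; split=> c u v w; rewrite -RintZ// -RintD//; try exact: polyfunM (polyfun_cst c) _.
- by apply: eq_Rint => y _; exact: (bf y).1.
- by apply: eq_Rint => y _; exact: (bf y).2.
Qed.

Lemma psd_Rint a b (f : R -> X -> X -> R) : (forall y, psd_form (f y)) ->
  (forall u v, polyfun (fun y => f y u v)) -> psd_form (fun u v => Rint a b (fun y => f y u v)).
Proof.
move=> pf pl; split=> [|u v|u].
- by apply: bilin_Rint => // y; have [] := pf y.
- by apply: eq_Rint => y _; have [] := pf y.
- by apply: Rint_ge0 => y _; have [] := pf y.
Qed.

Lemma local_scheme_Rint K h a b (ip J A : R -> X -> X -> R) : 0 <= h -> a < b ->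
  (forall y, local_scheme K h (ip y) (J y) (A y)) ->
  (forall u v, polyfun (fun y => ip y u v)) -> (forall u v, polyfun (fun y => J y u v)) ->
  (forall u v, polyfun (fun y => A y u v)) ->
  local_scheme K h (fun u v => Rint a b (fun y => ip y u v))
    (fun u v => Rint a b (fun y => J y u v)) (fun u v => Rint a b (fun y => A y u v)).
Proof.
move=> h0 ab ls pi pJ pA; split.
- by apply: psd_Rint => // y; exact: ls_ip (ls y).
- by apply: psd_Rint => // y; exact: ls_J (ls y).
- move=> u; rewrite -RintZ//; apply: le_Rint => //; first exact: polyfunM (polyfun_cst _) _.
  by move=> y _; exact: ls_jump (ls y) _.
- by apply: bilin_Rint => // y; exact: ls_A (ls y).
- move=> u v; rewrite -RintD// -[RHS](Rint0 a b); apply: eq_Rint => y _.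
  exact: ls_skew (ls y) _ _.
- move=> u v; rewrite -RintD//.
  (* The modulus of a polynomial is not polynomial, so the integral and its opposite are bounded
     separately and the modulus stays outside. *)
  have s1 (s : R) : `|s| = 1 -> h * (2 * (s * Rint a b (fun y => A y u v))) <=
      K * Rint a b (fun y => ip y u u + ip y v v).
    move=> sE; rewrite !mulrA -!RintZ//; last exact: polyfunD.
    apply: le_Rint => [||y _].
    + exact: polyfunM (polyfun_cst _) _.
    + exact: polyfunM (polyfun_cst _) (polyfunD _ _).
    + apply: le_trans (ls_bound (ls y) u v); rewrite -!mulrA ler_wpM2l// ler_pM2l//.
      by apply: le_trans (ler_norm _) _; rewrite normrM sE mul1r.
  case: (ger0P (Rint a b (fun y => A y u v))) => _.
    by have := s1 1; rewrite normr1 mul1r; apply.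
  by have := s1 (-1); rewrite normrN1 mulN1r; apply.
Qed.

(** The jump part costs [2 * K']: [h * th] is at most [K'] and [J] is at most twice [ip] on the
    diagonal. Skewness removes [A] from the symmetric part of [H]. *)
Lemma cdg_of_local K K' h th ip J A (H : X -> X -> R) : 0 < h -> 0 <= th -> 0 <= K ->
  h * th <= K' -> local_scheme K h ip J A ->
  (forall u v, H u v = - th * J u v + A u v) ->
  (exists n (e : 'I_n -> X), forall x, exists c : 'I_n -> R,
    let z := x - \sum_i c i *: e i in ip z z = 0) ->
  cdg_scheme (K + 2 * K') h ip H.
Proof.
move=> h0 th0 K0 hth ls HE sp; have [bJ sJ pJ] := ls_J ls; have [bi si pi] := ls_ip ls.
have K'0 : 0 <= K' by apply: le_trans hth; rewrite mulr_ge0// ltW.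
split => //.
- by split=> a u v w; rewrite !HE ?bJ.1 ?bJ.2 ?(ls_A ls).1 ?(ls_A ls).2; ring.
- move=> u v; rewrite HE.
  apply: (@le_trans _ _ (h * (2 * (th * `|J u v| + `|A u v|)))).
    rewrite ler_pM2l// ler_pM2l//; apply: le_trans (ler_normD _ _) _.
    by rewrite normrM normrN (ger0_norm th0).
  have := ls_bound ls u v => b1.
  have := psd_amgm bJ sJ pJ u v ltr01; rewrite invr1 !mul1r => b2.
  have j1 := ls_jump ls u; have j2 := ls_jump ls v.
  have b3 : h * th * (2 * `|J u v|) <= K' * (2 * (ip u u + ip v v)).
    apply: (@le_trans _ _ (K' * (2 * `|J u v|))); first by rewrite ler_wpM2r// mulr_ge0.
    by apply: ler_wpM2l => //; lra.
  lra.
- exists J, th; split => //; first exact: ls_jump ls.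
  + move=> u v; rewrite !HE (sJ v u); have := ls_skew ls u v; lra.
  + by apply: le_trans hth _; lra.
Qed.

End LocalSchemes.

(** * Skew symmetry and boundedness in one dimension *)

Section Advection.
Variable R : realType.
Implicit Types (f g df dg : R -> R) (a b : R).

(** The derivative is a separate function because the scheme evaluates it from the coefficients by
    its own formula. *)
Definition polyk k f df := exists p : {poly R},
  [/\ (size p <= k.+1)%N, forall x, f x = p.[x] & forall x, df x = p^`().[x]].

(* A half cell [a, b] joins a primal node to a dual node; [right] tells that the
   primal node is [b].  At the primal node it is the first test component that
   jumps, at the dual node the second one. *)
Definition advect a b (right : bool) f1 f2 g1 g2 dg1 dg2 : R :=
  let: (xp, xd) := if right then (b, a) else (a, b) in
  Rint a b (fun x => f2 x * dg1 x + f1 x * dg2 x)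
  - (if right then 1 else -1) * (f2 xp * g1 xp - f1 xd * g2 xd).

(** The two volume terms form the derivative of [f2 * g1 + f1 * g2]. At each end one flux term of
    either form supplies one of these two products, with the sign that cancels the boundary
    value. *)
Lemma advect_skew k a b right f1 f2 g1 g2 df1 df2 dg1 dg2 : a < b ->
  polyk k f1 df1 -> polyk k f2 df2 -> polyk k g1 dg1 -> polyk k g2 dg2 ->
  advect a b right f1 f2 g1 g2 dg1 dg2 + advect a b right g1 g2 f1 f2 df1 df2 = 0.
Proof.
move=> ab [p1 [_ f1E df1E]] [p2 [_ f2E df2E]] [q1 [_ g1E dg1E]] [q2 [_ g2E dg2E]].
have E : Rint a b (fun x => f2 x * dg1 x + f1 x * dg2 x) +
    Rint a b (fun x => g2 x * df1 x + g1 x * df2 x) =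
    (p2 * q1 + p1 * q2).[b] - (p2 * q1 + p1 * q2).[a].
  rewrite -Rint_deriv// -RintD.
  - apply: eq_Rint => x _; rewrite derivD !derivM !hornerE f1E f2E g1E g2E df1E df2E dg1E dg2E /=; ring.
  - by exists (p2 * q1^`() + p1 * q2^`()) => x; rewrite !hornerE f1E f2E dg1E dg2E.
  - by exists (q2 * p1^`() + q1 * p2^`()) => x; rewrite !hornerE g1E g2E df1E df2E.
rewrite !hornerE /= -!f1E -!f2E -!g1E -!g2E in E.
by rewrite /advect; case: right; lra.
Qed.

Lemma Rint_norm_le a b f (c : R) : a < b -> polyfun f ->
  (forall x, a <= x <= b -> `|f x| <= c) -> `|Rint a b f| <= (b - a) * c.
Proof.
move=> ab pf fc.
have cst (e : R) : Rint a b (fun=> e) = (b - a) * e.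
  have -> : Rint a b (fun=> e) = Rint a b (fun x => ((e *: 'X)^`()).[x]).
    by apply: eq_Rint => x _; rewrite derivZ derivX hornerZ hornerC mulr1.
  by rewrite Rint_deriv// !hornerE; ring.
rewrite ler_norml -mulrN -!cst; apply/andP; split; apply: le_Rint => //;
  try exact: polyfun_cst; by move=> x /fc; rewrite ler_norml => /andP[].
Qed.

(** The inverse inequalities cost one power of the length for a product of values and two for a
    value times a derivative; integration returns one of these two. In the constant, one [K] is for
    the volume term and one for the two flux terms. *)
Lemma advect_bound k : exists2 K : R, 0 < K & forall a b right f1 f2 g1 g2 df1 df2 dg1 dg2,
  a < b -> polyk k f1 df1 -> polyk k f2 df2 -> polyk k g1 dg1 -> polyk k g2 dg2 ->
  (b - a) * (2 * `|advect a b right f1 f2 g1 g2 dg1 dg2|) <=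
    K * (Rint a b (fun x => f1 x * f1 x + f2 x * f2 x) +
         Rint a b (fun x => g1 x * g1 x + g2 x * g2 x)).
Proof.
have [K K0 inv] := inverse_inequality R k; exists (2 * K + 1); first lra.
move=> a b right f1 f2 g1 g2 df1 df2 dg1 dg2 ab pf1 pf2 pg1 pg2.
have ba : 0 < b - a by rewrite subr_gt0.
have sup f df : polyk k f df -> [/\ polyfun f, polyfun df, polyfun (fun x => f x * f x),
    0 <= Rint a b (fun x => f x * f x) & forall x, a <= x <= b ->
    (b - a) * f x ^+ 2 <= K * Rint a b (fun x => f x * f x) /\
    (b - a) ^+ 3 * df x ^+ 2 <= K * Rint a b (fun x => f x * f x)].
  move=> [p [sp fE dfE]].
  have pf : polyfun f by exists p.
  split => //; first by exists p^`().
  - exact: polyfunM.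
  - by apply: Rint_ge0 => x _; rewrite -expr2 sqr_ge0.
  - move=> x xab; have [] := inv a b p x ab sp xab; rewrite -fE -dfE.
    have -> : Rint a b (fun x => p.[x] ^+ 2) = Rint a b (fun x => f x * f x).
      by apply: eq_Rint => y _; rewrite fE expr2.
    by [].
have [qf1 _ sf1 If1 Hf1] := sup _ _ pf1; have [qf2 _ sf2 If2 Hf2] := sup _ _ pf2.
have [qg1 qdg1 sg1 Ig1 Hg1] := sup _ _ pg1; have [qg2 qdg2 sg2 Ig2 Hg2] := sup _ _ pg2.
rewrite !RintD//.
move: If1 If2 Ig1 Ig2 Hf1 Hf2 Hg1 Hg2.
set F1 := Rint a b _; set F2 := Rint a b _; set G1 := Rint a b _; set G2 := Rint a b _.
move=> If1 If2 Ig1 Ig2 Hf1 Hf2 Hg1 Hg2.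
have edge (y z : R) Y Z : (b - a) * y ^+ 2 <= Y -> (b - a) * z ^+ 2 <= Z ->
    (b - a) * (2 * `|y * z|) <= Y + Z.
  move=> hy hz; apply: (@le_trans _ _ ((b - a) * (y ^+ 2 + z ^+ 2))); last by rewrite mulrDr lerD.
  rewrite ler_pM2l// normrM -(real_normK (num_real y)) -(real_normK (num_real z)).
  rewrite -subr_ge0; have := sqr_ge0 (`|y| - `|z|); congr (_ <= _); ring.
have volp (y z : R) Y Z : (b - a) * y ^+ 2 <= Y -> (b - a) ^+ 3 * z ^+ 2 <= Z ->
    (b - a) ^+ 2 * (2 * `|y * z|) <= Y + Z.
  move=> hy hz; have := @edge y ((b - a) * z) Y Z hy.
  have -> : (b - a) * ((b - a) * z) ^+ 2 = (b - a) ^+ 3 * z ^+ 2 by ring.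
  move=> /(_ hz); congr (_ <= _).
  by rewrite !normrM (gtr0_norm ba); ring.
have aab : a <= a <= b by rewrite lexx ltW.
have bab : a <= b <= b by rewrite lexx ltW.
have vol : (b - a) * (2 * `|Rint a b (fun x => f2 x * dg1 x + f1 x * dg2 x)|) <=
    K * (F1 + F2 + (G1 + G2)).
  set c := K * (F1 + F2 + (G1 + G2)) / (2 * (b - a) ^+ 2).
  have := @Rint_norm_le a b (fun x => f2 x * dg1 x + f1 x * dg2 x) c ab.
  have pp : polyfun (fun x => f2 x * dg1 x + f1 x * dg2 x) by apply: polyfunD; exact: polyfunM.
  move=> /(_ pp) hc.
  have {}hc : `|Rint a b (fun x => f2 x * dg1 x + f1 x * dg2 x)| <= (b - a) * c.
    apply: hc => x xab; rewrite /c ler_pdivlMr ?mulr_gt0 ?exprn_gt0//.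
    have [h1 _] := Hf1 x xab; have [h2 _] := Hf2 x xab.
    have [_ h3] := Hg1 x xab; have [_ h4] := Hg2 x xab.
    have v1 := volp _ _ _ _ h2 h3; have v2 := volp _ _ _ _ h1 h4.
    apply: (@le_trans _ _ ((`|f2 x * dg1 x| + `|f1 x * dg2 x|) * (2 * (b - a) ^+ 2))).
      by rewrite ler_wpM2r ?ler_normD// mulr_ge0// sqr_ge0.
    lra.
  have : (b - a) * (2 * `|Rint a b (fun x => f2 x * dg1 x + f1 x * dg2 x)|) <= (b - a) * (2 * ((b - a) * c)).
    by rewrite ler_pM2l// ler_pM2l.
  suff -> : (b - a) * (2 * ((b - a) * c)) = K * (F1 + F2 + (G1 + G2)) by [].
  by rewrite /c; field; rewrite gt_eqF.
have fin (xp xd s : R) : a <= xp <= b -> a <= xd <= b -> `|s| = 1 ->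
   (b - a) * (2 * `|Rint a b (fun x => f2 x * dg1 x + f1 x * dg2 x)
     - s * (f2 xp * g1 xp - f1 xd * g2 xd)|) <= (2 * K + 1) * (F1 + F2 + (G1 + G2)).
  move=> hp hd s1.
  have [h2 _] := Hf2 _ hp; have [h3 _] := Hg1 _ hp.
  have [h1 _] := Hf1 _ hd; have [h4 _] := Hg2 _ hd.
  have e1 := edge _ _ _ _ h2 h3; have e2 := edge _ _ _ _ h1 h4.
  apply: (@le_trans _ _ ((b - a) * (2 * (`|Rint a b (fun x => f2 x * dg1 x + f1 x * dg2 x)|
     + (`|f2 xp * g1 xp| + `|f1 xd * g2 xd|))))).
    rewrite ler_pM2l// ler_pM2l//; apply: le_trans (ler_normB _ _) _.
    by rewrite normrM s1 mul1r lerD2l ler_normB.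
  lra.
by rewrite /advect; case: right; apply: fin => //; rewrite ?normr1 ?normrN1.
Qed.

Section Piece.
Variables (X : lmodType R) (k : nat) (l1 l2 d1 d2 : X -> R -> R).
Definition pw_linear (l : X -> R -> R) :=
  forall c u v x, l (c *: u + v) x = c * l u x + l v x.
Hypotheses (ll1 : pw_linear l1) (ll2 : pw_linear l2) (ld1 : pw_linear d1) (ld2 : pw_linear d2).
Hypotheses (pk1 : forall u, polyk k (l1 u) (d1 u)) (pk2 : forall u, polyk k (l2 u) (d2 u)).
Variables (a b : R) (right : bool).
Hypothesis ab : a < b.

Lemma polyk_polyfun f df : polyk k f df -> polyfun f /\ polyfun df.
Proof. by move=> [p [_ fE dfE]]; split; [exists p|exists p^`()]. Qed.

(** [K] must be fixed before the cell is known, hence [bound] as a hypothesis; [kap] compares the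
    mesh size with the length of this cell. *)
Lemma piece_scheme (K h kap : R) :
  (forall u v, (b - a) * (2 * `|advect a b right (l1 u) (l2 u) (l1 v) (l2 v) (d1 v) (d2 v)|) <=
    K * (Rint a b (fun x => l1 u x * l1 u x + l2 u x * l2 u x) +
         Rint a b (fun x => l1 v x * l1 v x + l2 v x * l2 v x))) ->
  0 <= kap -> h <= kap * (b - a) ->
  local_scheme (kap * K) h
    (fun u v => Rint a b (fun x => l1 u x * l1 v x + l2 u x * l2 v x))
    (fun u v => Rint a b (fun x => (l1 u x - l2 u x) * (l1 v x - l2 v x)))
    (fun u v => advect a b right (l1 u) (l2 u) (l1 v) (l2 v) (d1 v) (d2 v)).
Proof.
move=> bound kap0 hk.
have q1 u := (polyk_polyfun (pk1 u)).1; have q2 u := (polyk_polyfun (pk2 u)).1.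
have e1 u := (polyk_polyfun (pk1 u)).2; have e2 u := (polyk_polyfun (pk2 u)).2.
have pI u v : polyfun (fun x => l1 u x * l1 v x + l2 u x * l2 v x).
  by apply: polyfunD; exact: polyfunM.
have pJ u v : polyfun (fun x => (l1 u x - l2 u x) * (l1 v x - l2 v x)).
  by apply: polyfunM; apply: polyfunD => //; exact: polyfunN.
have pV u v : polyfun (fun x => l2 u x * d1 v x + l1 u x * d2 v x).
  by apply: polyfunD; exact: polyfunM.
split.
- apply: (@psd_Rint R X a b (fun x u v => l1 u x * l1 v x + l2 u x * l2 v x)) => // x.
  split=> [|u v|u]; [split=> c u v w; rewrite !ll1 !ll2; ring|ring|].
  by rewrite addr_ge0// -expr2 sqr_ge0.
- apply: (@psd_Rint R X a b (fun x u v => (l1 u x - l2 u x) * (l1 v x - l2 v x))) => // x.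
  split=> [|u v|u]; [split=> c u v w; rewrite !ll1 !ll2; ring|ring|].
  by rewrite -expr2 sqr_ge0.
- move=> u; rewrite -RintZ//; apply: le_Rint => //; first exact: polyfunM (polyfun_cst _) _.
  move=> x _; rewrite -subr_ge0; have := sqr_ge0 (l1 u x + l2 u x); congr (_ <= _); ring.
- have bV : bilin (fun u v => Rint a b (fun x => l2 u x * d1 v x + l1 u x * d2 v x)).
    apply: (@bilin_Rint R X a b (fun x u v => l2 u x * d1 v x + l1 u x * d2 v x)) => // x.
    by split=> c u v w; rewrite ?ll1 ?ll2 ?ld1 ?ld2; ring.
  split=> c u v w; rewrite /advect.
    by case: right; rewrite !(bV.1) !ll1 !ll2; ring.
  by case: right; rewrite !(bV.2) !ll1 !ll2; ring.
- by move=> u v; exact: (@advect_skew k).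
- move=> u v; rewrite -mulrA; apply: le_trans (ler_wpM2l kap0 (bound u v)).
  by rewrite [leRHS]mulrA ler_wpM2r// mulr_ge0.
Qed.

End Piece.
End Advection.

(** * The one-dimensional scheme *)

Section Tools.
Variable R : realType.

(** Subtracting from [x] its coordinates along the dual vectors [e] leaves a vector on which every
    [kap t] vanishes, hence a null vector. *)
Lemma span_coords (X : lmodType R) (ip : X -> X -> R) (T : finType)
    (kap : T -> X -> R) (e : T -> X) :
  (forall t c u v, kap t (c *: u + v) = c * kap t u + kap t v) ->
  (forall t t', kap t (e t') = (t == t')%:R) ->
  (forall z, (forall t, kap t z = 0) -> ip z z = 0) ->
  exists n (b : 'I_n -> X), forall x, exists c : 'I_n -> R,
    let z := x - \sum_i c i *: b i in ip z z = 0.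
Proof.
move=> lin dual null; exists #|T|, (fun i => e (enum_val i)) => x.
exists (fun i => kap (enum_val i) x) => /=; apply: null => t.
have k0 : kap t 0 = 0.
  by have := lin t 1 0 0; rewrite scale1r mul1r addr0 -{1}[kap t 0]addr0 => /addrI.
have ksum : kap t (\sum_(i < #|T|) kap (enum_val i) x *: e (enum_val i)) =
    \sum_(i < #|T|) kap (enum_val i) x * (t == enum_val i)%:R.
  have kD u v : kap t (u + v) = kap t u + kap t v.
    by have := lin t 1 u v; rewrite scale1r mul1r.
  rewrite (big_morph (kap t) kD k0); apply: eq_bigr => i _.
  by have := lin t (kap (enum_val i) x) (e (enum_val i)) 0; rewrite !addr0 k0 addr0 dual.
rewrite addrC -scaleN1r lin ksum (bigD1 (enum_rank t))//= enum_rankK eqxx mulr1 big1 ?addr0.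
  by rewrite mulN1r addNr.
move=> i it; case: eqP => [tE|_]; last by rewrite mulr0.
by move: it; rewrite tE enum_valK eqxx.
Qed.

Lemma mesh_le N (t : nat -> R) : (forall i, (i < N)%N -> t i <= t i.+1) ->
  forall i j, (i <= j)%N -> (j <= N)%N -> t i <= t j.
Proof.
move=> tS i j /subnKC <-; elim: (j - i)%N => [|n IH] h; first by rewrite addn0.
rewrite addnS; apply: (le_trans (IH _)); [lia|apply: tS; lia].
Qed.

Lemma indT (a b x : R) : a <= x -> x < b -> ind a b x = 1.
Proof. by rewrite /ind => -> ->. Qed.
Lemma ind_ge (a b x : R) : b <= x -> ind a b x = 0.
Proof. by rewrite /ind ltNge => ->; rewrite andbF. Qed.
Lemma ind_lt (a b x : R) : x < a -> ind a b x = 0.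
Proof. by rewrite /ind leNgt => ->. Qed.

Lemma sum_ind N (t : nat -> R) (x : R) (G : nat -> R) i :
  (forall i, (i < N)%N -> t i <= t i.+1) -> (i < N)%N -> t i <= x -> x < t i.+1 ->
  \sum_(j < N) ind (t j) (t j.+1) x * G j = G i.
Proof.
move=> tS iN tx xt; have tm := mesh_le tS.
rewrite (bigD1 (Ordinal iN))//= indT// mul1r big1 ?addr0// => j ji.
have {}ji : j != i :> nat by [].
case: (ltngtP (j : nat) i) => h; last by rewrite h eqxx in ji.
  by rewrite ind_ge ?mul0r//; apply: le_trans tx; apply: tm; lia.
by rewrite ind_lt ?mul0r//; apply: lt_le_trans xt _; apply: tm; have := ltn_ord j; lia.
Qed.

Lemma sum_ind0 N (t : nat -> R) (x : R) (G : nat -> R) :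
  (forall i, (i < N)%N -> t i <= t i.+1) -> x < t 0%N ->
  \sum_(j < N) ind (t j) (t j.+1) x * G j = 0.
Proof.
move=> tS xt; have tm := mesh_le tS; apply: big1 => j _.
rewrite ind_lt ?mul0r//; apply: lt_le_trans xt _; apply: tm => //.
exact/ltnW/ltn_ord.
Qed.

Lemma sum_rot N (T : nat -> R) : \sum_(i < N) T (i.+1 %% N)%N = \sum_(i < N) T i.
Proof.
case: N => [|n]; first by rewrite !big_ord0.
rewrite big_ord_recr /= modnn [RHS]big_ord_recl addrC; congr (_ + _).
by apply: eq_bigr => i _; rewrite modn_small// ltnS.
Qed.

Lemma sum_halves N (F : nat -> bool -> R) :
  \sum_(p : 'I_N * bool) F p.1 p.2 = \sum_(i < N) (F i false + F i true).
Proof.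
rewrite -(pair_bigA _ (fun (i : 'I_N) b => F i b)) /=; apply: eq_bigr => i _.
by rewrite big_bool addrC.
Qed.

Lemma polyk_peval k (c : nat -> R) : polyk k (peval k c) (pderiv k c).
Proof.
exists (\poly_(a < k.+1) c a); split; first exact: size_poly.
- by move=> x; rewrite horner_poly.
- move=> x; rewrite poly_def raddf_sum /= horner_sum; apply: eq_bigr => a _.
  by rewrite derivZ derivXn hornerZ hornerMn hornerXn -mulr_natl; ring.
Qed.

Lemma polyk_shift k (f df : R -> R) s : polyk k f df ->
  polyk k (fun x => f (x + s)) (fun x => df (x + s)).
Proof.
move=> [p [sp fE dfE]]; exists (p \Po ('X + s%:P)); split.
- by rewrite size_comp_poly2// size_XaddC.
- by move=> x; rewrite horner_comp !hornerE fE.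
- by move=> x; rewrite deriv_comp derivD derivX derivC addr0 mulr1 horner_comp !hornerE dfE.
Qed.

End Tools.

Section OneDimension.
Variables (R : realType) (k : nat) (L : R).

Definition lo_half (t c : nat -> R) (i : nat) (right : bool) := if right then c i else t i.
Definition hi_half (t c : nat -> R) (i : nat) (right : bool) := if right then t i.+1 else c i.

(** The dual cell that contains the given half of primal cell [i]: the left half lies in the
    preceding dual cell, which for [i = 0] is the last one, translated by a period. *)
Definition dual_cell N (i : nat) (right : bool) : nat := if right then i else didx N i.
Definition dual_shift (i : nat) (right : bool) : R := if right then 0 else dsh L i.

Variables (N : nat) (xf : nat -> R).
Hypotheses (N0 : (0 < N)%N) (xf0 : xf 0%N = 0) (xfN : xf N = L)
  (xfS : forall i, (i < N)%N -> xf i < xf i.+1).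

Let c := cen xf.
Lemma cen_gt i : (i < N)%N -> xf i < c i.
Proof. by move=> /xfS h; rewrite /c /cen; lra. Qed.
Lemma cen_lt i : (i < N)%N -> c i < xf i.+1.
Proof. by move=> /xfS h; rewrite /c /cen; lra. Qed.
Lemma xf_le i j : (i <= j)%N -> (j <= N)%N -> xf i <= xf j.
Proof. by apply: mesh_le => l /xfS /ltW. Qed.

Lemma cenpE i : (i < N)%N -> cenp N L xf i = c i.
Proof. by rewrite /cenp; case: eqP => // ->; rewrite ltnn. Qed.
Lemma cenp_gt i : (i < N)%N -> xf i.+1 < cenp N L xf i.+1.
Proof.
move=> iN; rewrite /cenp; case: eqP => [->|ne].
  by rewrite xfN; have := cen_gt N0; rewrite xf0 /c; lra.
by apply: cen_gt; lia.
Qed.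
Lemma cenpS i : (i < N)%N -> cenp N L xf i <= cenp N L xf i.+1.
Proof.
move=> iN; rewrite cenpE//; apply: ltW; exact: lt_trans (cen_lt iN) (cenp_gt iN).
Qed.

Lemma ev1_cell (ev : (nat -> R) -> R -> R) (u : nat -> nat -> R) i x :
  (i < N)%N -> xf i <= x -> x < xf i.+1 ->
  \sum_(j < N) ind (xf j) (xf j.+1) x * ev (u j) x = ev (u i) x.
Proof.
move=> iN h1 h2; apply: (sum_ind (fun j => ev (u j) x)) => // j jN.
exact/ltW/xfS.
Qed.

(** Closed at [xf i.+1], because the primal flux samples the dual component there, in the interior
    of its cell. The abstract [ev] covers values and derivatives. *)
Lemma ev2_right (ev : (nat -> R) -> R -> R) (v : nat -> nat -> R) i x :
  (i < N)%N -> c i <= x -> x <= xf i.+1 ->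
  \sum_(j < N) ind (cenp N L xf j) (cenp N L xf j.+1) x * ev (v j) x
  + ind 0 (cen xf 0) x * ev (v N.-1) (x + L) = ev (v i) x.
Proof.
move=> iN h1 h2; rewrite (sum_ind (i := i) (fun j => ev (v j) x) cenpS)//.
- rewrite ind_ge ?mul0r ?addr0//; apply: le_trans h1.
  case: i iN {h2} => [//|i] iN; apply/ltW/(lt_trans (cen_lt N0)).
  by apply: le_lt_trans (cen_gt iN); apply: xf_le; lia.
- by rewrite cenpE.
- exact: le_lt_trans h2 (cenp_gt iN).
Qed.

Lemma ev2_left (ev : (nat -> R) -> R -> R) (v : nat -> nat -> R) i x :
  (i < N)%N -> xf i <= x -> x < c i ->
  \sum_(j < N) ind (cenp N L xf j) (cenp N L xf j.+1) x * ev (v j) x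
  + ind 0 (cen xf 0) x * ev (v N.-1) (x + L) = ev (v (didx N i)) (x + dsh L i).
Proof.
case: i => [|i] iN h1 h2; rewrite /didx /dsh /=.
  rewrite (sum_ind0 (fun j => ev (v j) x) cenpS) ?cenpE//.
  by rewrite add0r indT ?mul1r// -xf0.
rewrite addr0 (sum_ind (i := i) (fun j => ev (v j) x) cenpS)//.
- rewrite ind_ge ?mul0r ?addr0//; apply: le_trans h1; apply/ltW/(lt_le_trans (cen_lt N0)).
  by apply: xf_le; lia.
- lia.
- by rewrite cenpE; [apply/ltW/(lt_le_trans (cen_lt _) h1); lia|lia].
- by rewrite cenpE.
Qed.

Definition loc1 (ev : (nat -> R) -> R -> R) (u : state1 R) (i : nat) (right : bool) (x : R) :=
  ev (u.1 i) x.
Definition loc2 (ev : (nat -> R) -> R -> R) (u : state1 R) (i : nat) (right : bool) (x : R) :=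
  ev (u.2 (dual_cell N i right)) (x + dual_shift i right).

Lemma Rint_halves (F : R -> R) (f : nat -> bool -> R -> R) :
  (forall i r, polyfun (f i r)) ->
  (forall i r x, (i < N)%N -> lo_half xf c i r <= x < hi_half xf c i r -> F x = f i r x) ->
  Rint 0 L F = \sum_(p : 'I_N * bool) Rint (lo_half xf c p.1 p.2) (hi_half xf c p.1 p.2) (f p.1 p.2).
Proof.
move=> pf Ff; rewrite -[X in Rint X]xf0 -xfN.
rewrite (@Rint_cells R N xf c F (fun i => f i false) (fun i => f i true)) //.
- by rewrite (sum_halves N (fun i r => Rint (lo_half xf c i r) (hi_half xf c i r) (f i r))).
- by move=> i /cen_gt/ltW.
- by move=> i /cen_lt/ltW.
- by move=> i x iN h; apply: Ff.
- by move=> i x iN h; apply: Ff.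
Qed.

Lemma half_lt i r : (i < N)%N -> lo_half xf c i r < hi_half xf c i r.
Proof. by case: r => /=; [exact: cen_lt|exact: cen_gt]. Qed.

Lemma half_in i r x : (i < N)%N -> lo_half xf c i r <= x < hi_half xf c i r ->
  xf i <= x /\ x < xf i.+1.
Proof.
move=> iN; have := cen_gt iN; have := cen_lt iN.
by case: r => /= h1 h2 /andP[h3 h4]; split; lra.
Qed.

Lemma ev1_half (ev : (nat -> R) -> R -> R) (u : state1 R) i r x : (i < N)%N ->
  lo_half xf c i r <= x < hi_half xf c i r ->
  \sum_(j < N) ind (xf j) (xf j.+1) x * ev (u.1 j) x = loc1 ev u i r x.
Proof. by move=> iN h; have [h1 h2] := half_in iN h; exact: ev1_cell. Qed.

Lemma ev2_half (ev : (nat -> R) -> R -> R) (u : state1 R) i r x : (i < N)%N ->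
  lo_half xf c i r <= x < hi_half xf c i r ->
  \sum_(j < N) ind (cenp N L xf j) (cenp N L xf j.+1) x * ev (u.2 j) x
  + ind 0 (cen xf 0) x * ev (u.2 N.-1) (x + L) = loc2 ev u i r x.
Proof.
move=> iN /andP[]; case: r => /= h1 h2; rewrite /loc2 /=.
  by rewrite addr0; apply: ev2_right => //; exact: ltW.
exact: ev2_left.
Qed.

Lemma polyk_loc1 u i r : polyk k (loc1 (peval k) u i r) (loc1 (pderiv k) u i r).
Proof. exact: polyk_peval. Qed.
Lemma polyk_loc2 u i r : polyk k (loc2 (peval k) u i r) (loc2 (pderiv k) u i r).
Proof. by apply: polyk_shift; exact: polyk_peval. Qed.

Let pl1 u i r := (polyk_polyfun (polyk_loc1 u i r)).1.
Let pl2 u i r := (polyk_polyfun (polyk_loc2 u i r)).1.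
Let pd1 u i r := (polyk_polyfun (polyk_loc1 u i r)).2.
Let pd2 u i r := (polyk_polyfun (polyk_loc2 u i r)).2.

Lemma ip1E u v : ip1 k L (N, xf) u v = \sum_(p : 'I_N * bool)
  Rint (lo_half xf c p.1 p.2) (hi_half xf c p.1 p.2) (fun x =>
    loc1 (peval k) u p.1 p.2 x * loc1 (peval k) v p.1 p.2 x +
    loc2 (peval k) u p.1 p.2 x * loc2 (peval k) v p.1 p.2 x).
Proof.
rewrite /ip1.
rewrite (@Rint_halves _ (fun i r x => loc1 (peval k) u i r x * loc1 (peval k) v i r x)); last 2 first.
- by move=> i r; apply: polyfunM.
- by move=> i r x iN h; rewrite /ev1 !(ev1_half _ _ iN h).
rewrite (@Rint_halves _ (fun i r x => loc2 (peval k) u i r x * loc2 (peval k) v i r x)); last 2 first.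
- by move=> i r; apply: polyfunM.
- by move=> i r x iN h; rewrite /ev2 !(ev2_half _ _ iN h).
rewrite -big_split; apply: eq_bigr => p _ /=.
by rewrite RintD//; exact: polyfunM.
Qed.

Variables (beta CFL : R).

(** The right end of dual cell [i] is the centre of the next primal cell, seen from its left half; a
    cyclic shift of these terms groups everything by halves of primal cells. *)
Lemma boundary1E (u phi : state1 R) :
  \sum_(i < N)
      (  beta * ev2 k N L xf u.2 (xf i.+1) * peval k (phi.1 i) (xf i.+1)
       - beta * ev2 k N L xf u.2 (xf i) * peval k (phi.1 i) (xf i)
       + beta * peval k (u.1 (i.+1 %% N)%N) (cen xf (i.+1 %% N)%N)
              * peval k (phi.2 i) (cenp N L xf i.+1)
       - beta * peval k (u.1 i) (cen xf i) * peval k (phi.2 i) (cen xf i)) =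
  \sum_(i < N)
      (beta * (loc2 (peval k) u i true (xf i.+1) * loc1 (peval k) phi i true (xf i.+1)
               - loc1 (peval k) u i true (c i) * loc2 (peval k) phi i true (c i))
     - beta * (loc2 (peval k) u i false (xf i) * loc1 (peval k) phi i false (xf i)
               - loc1 (peval k) u i false (c i) * loc2 (peval k) phi i false (c i))).
Proof.
pose T i := loc1 (peval k) u i false (c i) * loc2 (peval k) phi i false (c i).
pose S i := loc2 (peval k) u i true (xf i.+1) * loc1 (peval k) phi i true (xf i.+1)
               - loc1 (peval k) u i true (c i) * loc2 (peval k) phi i true (c i)
      - loc2 (peval k) u i false (xf i) * loc1 (peval k) phi i false (xf i).
transitivity (\sum_(i < N) (beta * S i + beta * T (i.+1 %% N)%N)); last first.
  rewrite big_split /= -!mulr_sumr (sum_rot N T) -mulrDr -big_split /= mulr_sumr.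
  by apply: eq_bigr => i _; rewrite /S /T /=; ring.
apply: eq_bigr => i _; have iN := ltn_ord i.
have -> : ev2 k N L xf u.2 (xf i.+1) = loc2 (peval k) u i true (xf i.+1).
  by rewrite /ev2 (@ev2_right _ _ i)// /loc2 /= ?addr0//; apply/ltW; exact: cen_lt.
have -> : ev2 k N L xf u.2 (xf i) = loc2 (peval k) u i false (xf i).
  by rewrite /ev2 (@ev2_left _ _ i)//; exact: cen_gt.
rewrite -!(mulrA beta).
have -> : peval k (u.1 (i.+1 %% N)%N) (cen xf (i.+1 %% N)%N) * peval k (phi.2 i) (cenp N L xf i.+1)
    = T (i.+1 %% N)%N.
  rewrite /T /loc1 /loc2 /=; congr (_ * _).
  have [iN1|iN1] := ltnP i.+1 N.
    by rewrite modn_small// cenpE// /didx /dsh /= addr0.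
  have -> : (i : nat) = N.-1 by lia.
  by rewrite prednK// modnn /didx /dsh /= /cenp eqxx.
rewrite -/T /S /loc1 /loc2 /= !addr0; ring.
Qed.

Lemma H1E u v : beta != 0 -> H1 k beta CFL L (N, xf) u v =
  - (CFL * h1 N xf / `|beta|)^-1 * \sum_(p : 'I_N * bool)
    Rint (lo_half xf c p.1 p.2) (hi_half xf c p.1 p.2) (fun x =>
      (loc1 (peval k) u p.1 p.2 x - loc2 (peval k) u p.1 p.2 x) *
      (loc1 (peval k) v p.1 p.2 x - loc2 (peval k) v p.1 p.2 x))
  + \sum_(p : 'I_N * bool) beta * advect (lo_half xf c p.1 p.2) (hi_half xf c p.1 p.2) p.2
     (loc1 (peval k) u p.1 p.2) (loc2 (peval k) u p.1 p.2)
     (loc1 (peval k) v p.1 p.2) (loc2 (peval k) v p.1 p.2)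
     (loc1 (pderiv k) v p.1 p.2) (loc2 (pderiv k) v p.1 p.2).
Proof.
move=> beta0; rewrite /H1 boundary1E -addrA; congr (_ + _).
  congr (_ * _); apply: (@Rint_halves _ (fun i r x =>
      (loc1 (peval k) u i r x - loc2 (peval k) u i r x) *
      (loc1 (peval k) v i r x - loc2 (peval k) v i r x))) => [i r|i r x iN h].
    by apply: polyfunM; apply: polyfunD => //; exact: polyfunN.
  by rewrite /ev1 /ev2 !(ev1_half _ _ iN h) !(ev2_half _ _ iN h).
rewrite (@Rint_halves _ (fun i r x => beta * (loc2 (peval k) u i r x * loc1 (pderiv k) v i r x
   + loc1 (peval k) u i r x * loc2 (pderiv k) v i r x))); last 2 first.
- by move=> i r; apply: polyfunM (polyfun_cst _) _; apply: polyfunD; exact: polyfunM.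
- move=> i r x iN h; rewrite /ev1 /ev2 /ev1' /ev2' !(ev1_half _ _ iN h) !(ev2_half _ _ iN h).
  by rewrite mulrDr !mulrA.
pose V i r := Rint (lo_half xf c i r) (hi_half xf c i r) (fun x => loc2 (peval k) u i r x * loc1 (pderiv k) v i r x
   + loc1 (peval k) u i r x * loc2 (pderiv k) v i r x).
rewrite (eq_bigr (fun p : 'I_N * bool => beta * V p.1 p.2)); last first.
  by move=> p _; rewrite RintZ//; apply: polyfunD; exact: polyfunM.
rewrite (sum_halves N (fun i r => beta * V i r)).
rewrite (sum_halves N (fun i r => beta * advect (lo_half xf c i r) (hi_half xf c i r) r
     (loc1 (peval k) u i r) (loc2 (peval k) u i r)
     (loc1 (peval k) v i r) (loc2 (peval k) v i r)
     (loc1 (pderiv k) v i r) (loc2 (pderiv k) v i r))).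
rewrite -sumrB; apply: eq_bigr => i _.
rewrite /advect /= -/(V i true) -/(V i false); ring.
Qed.

End OneDimension.

Section OneDimensionScheme.
Variables (R : realType) (k : nat) (L CFL sigma beta : R).
Hypotheses (CFL0 : 0 < CFL) (beta0 : beta != 0) (L0 : 0 < L).

(* Convertible to [state1 R]; the regular module [R^o] supplies the linear structure. *)
Definition lstate1 : lmodType R := ((nat -> nat -> R^o) * (nat -> nat -> R^o))%type.

Lemma lstate1_fst (a : R) (u v : lstate1) i j :
  (a *: u + v).1 i j = a * u.1 i j + v.1 i j :> R.
Proof.
rewrite (linearP (fst : lstate1 -> (nat -> nat -> R^o))).
by rewrite addrfctE scalrfctE addrfctE scalrfctE.
Qed.

Lemma lstate1_snd (a : R) (u v : lstate1) i j :
  (a *: u + v).2 i j = a * u.2 i j + v.2 i j :> R.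
Proof.
rewrite (linearP (snd : lstate1 -> (nat -> nat -> R^o))).
by rewrite addrfctE scalrfctE addrfctE scalrfctE.
Qed.

Lemma peval_linear (c1 c2 c3 : nat -> R) (a x : R) :
  (forall j, c3 j = a * c1 j + c2 j) -> peval k c3 x = a * peval k c1 x + peval k c2 x.
Proof.
move=> h; rewrite /peval mulr_sumr -big_split; apply: eq_bigr => i _ /=.
by rewrite h; ring.
Qed.

Lemma pderiv_linear (c1 c2 c3 : nat -> R) (a x : R) :
  (forall j, c3 j = a * c1 j + c2 j) -> pderiv k c3 x = a * pderiv k c1 x + pderiv k c2 x.
Proof.
move=> h; rewrite /pderiv mulr_sumr -big_split; apply: eq_bigr => i _ /=.
by rewrite h; ring.
Qed.

Lemma cdg_scheme1 : exists2 K : R, 0 < K & forall M : nat * (nat -> R), adm1 L sigma M ->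
  @cdg_scheme R lstate1 K (h1 M.1 M.2) (ip1 k L M) (H1 k beta CFL L M).
Proof.
have [K K0 bnd] := advect_bound R k.
(* The first summand is for advection, with weight 0 on the missing second direction; [|beta| / CFL]
   is the value of [h * th]. *)
exists (2 * `|sigma| * K * (`|beta| + `|0 : R|) + 2 * (`|beta| / CFL)).
  rewrite normr0 addr0 ltr_wpDl//; first by rewrite !mulr_ge0// ltW.
  by rewrite mulr_gt0// divr_gt0// normr_gt0.
move=> [N xf] /= [N0 [xf0 [xfN [xfS qu]]]].
have h0 : 0 < h1 N xf.
  apply: (@lt_le_trans _ _ (xf 1%N - xf 0%N)); first by rewrite subr_gt0 xfS.
  exact: (@le_bigmax _ R _ 0 (fun i : 'I_N => xf i.+1 - xf i) (Ordinal N0)).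
(* The factor 2 is the ratio of a cell to its half, [sigma] the ratio of the largest cell to this
   one. *)
have hle i r : (i < N)%N ->
    h1 N xf <= 2 * `|sigma| * (hi_half xf (cen xf) i r - lo_half xf (cen xf) i r).
  move=> iN; have -> : hi_half xf (cen xf) i r - lo_half xf (cen xf) i r = (xf i.+1 - xf i) / 2.
    by case: r; rewrite /= /cen; field.
  have d0 : 0 < xf i.+1 - xf i by rewrite subr_gt0 xfS.
  have -> : 2 * `|sigma| * ((xf i.+1 - xf i) / 2) = `|sigma| * (xf i.+1 - xf i) by field.
  apply/bigmax_leP; split; first by rewrite mulr_ge0// ltW.
  move=> j _; apply: (le_trans (qu j i (ltn_ord j) iN)).
  by rewrite ler_wpM2r ?ler_norm// ltW.
pose A1 (p : 'I_N * bool) (u v : lstate1) := advect (lo_half xf (cen xf) p.1 p.2) (hi_half xf (cen xf) p.1 p.2) p.2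
     (loc1 (peval k) u p.1 p.2) (loc2 L N (peval k) u p.1 p.2)
     (loc1 (peval k) v p.1 p.2) (loc2 L N (peval k) v p.1 p.2)
     (loc1 (pderiv k) v p.1 p.2) (loc2 L N (pderiv k) v p.1 p.2).
pose I1 (p : 'I_N * bool) (u v : lstate1) :=
  Rint (lo_half xf (cen xf) p.1 p.2) (hi_half xf (cen xf) p.1 p.2) (fun x =>
    loc1 (peval k) u p.1 p.2 x * loc1 (peval k) v p.1 p.2 x +
    loc2 L N (peval k) u p.1 p.2 x * loc2 L N (peval k) v p.1 p.2 x).
pose J1 (p : 'I_N * bool) (u v : lstate1) :=
  Rint (lo_half xf (cen xf) p.1 p.2) (hi_half xf (cen xf) p.1 p.2) (fun x =>
      (loc1 (peval k) u p.1 p.2 x - loc2 L N (peval k) u p.1 p.2 x) *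
      (loc1 (peval k) v p.1 p.2 x - loc2 L N (peval k) v p.1 p.2 x)).
have ls p : local_scheme (2 * `|sigma| * K) (h1 N xf) (I1 p) (J1 p) (A1 p).
  have plt := half_lt xfS p.2 (ltn_ord p.1).
  apply: (@piece_scheme R lstate1 k (fun u => loc1 (peval k) u p.1 p.2)
    (fun u => loc2 L N (peval k) u p.1 p.2) (fun u => loc1 (pderiv k) u p.1 p.2)
    (fun u => loc2 L N (pderiv k) u p.1 p.2)) => //.
  - by move=> a u v x; apply: peval_linear => j; exact: lstate1_fst.
  - by move=> a u v x; apply: peval_linear => j; exact: lstate1_snd.
  - by move=> a u v x; apply: pderiv_linear => j; exact: lstate1_fst.
  - by move=> a u v x; apply: pderiv_linear => j; exact: lstate1_snd.
  - by move=> u; exact: polyk_loc1.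
  - by move=> u; exact: polyk_loc2.
  - move=> u v; apply: bnd => //; try exact: polyk_loc1; exact: polyk_loc2.
  - exact: hle.
have := local_scheme_sum (ltW h0) (fun p => local_scheme_lin beta 0 (ltW h0) (ls p) (ls p)).
set ipS := fun u v => \sum_i I1 i u v.
move=> lsS.
have ipE u v : ip1 k L (N, xf) u v = ipS u v by exact: ip1E.
have -> : ip1 k L (N, xf) = ipS by do 2 apply/funext => ?; exact: ipE.
have th0 : 0 < (CFL * h1 N xf / `|beta|)^-1.
  by rewrite invr_gt0 divr_gt0 ?mulr_gt0// normr_gt0.
apply: (cdg_of_local h0 (ltW th0) _ _ lsS).
- by rewrite !mulr_ge0// ?addr_ge0// ltW.
- rewrite le_eqVlt; apply/orP; left; apply/eqP; field.
  by rewrite normr_eq0 beta0 !gt_eqF.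
- move=> u v; rewrite H1E//; congr (_ + _).
  by apply: eq_bigr => p _; rewrite mul0r addr0.
apply: (@span_coords R lstate1 ipS (bool * ('I_N * 'I_k.+1))%type
  (fun t u => if t.1 then u.1 t.2.1 t.2.2 else u.2 t.2.1 t.2.2)
  (fun t => ((fun i a => (t.1 && (t.2.1 == i :> nat) && (t.2.2 == a :> nat))%:R),
             (fun i a => (~~ t.1 && (t.2.1 == i :> nat) && (t.2.2 == a :> nat))%:R)))).
- by move=> [[] [i a]] c u v; [exact: lstate1_fst|exact: lstate1_snd].
- move=> [b [i a]] [b' [i' a']]; rewrite !xpair_eqE (eq_sym i) (eq_sym a).
  by case: b b' => [] [].
- move=> z z0.
  have z1 i a : (i < N)%N -> (a < k.+1)%N -> z.1 i a = 0.
    by move=> iN ak; exact: (z0 (true, (Ordinal iN, Ordinal ak))).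
  have z2 i a : (i < N)%N -> (a < k.+1)%N -> z.2 i a = 0.
    by move=> iN ak; exact: (z0 (false, (Ordinal iN, Ordinal ak))).
  rewrite /ipS; apply: big1 => p _; rewrite /I1 -[RHS](Rint0 (lo_half xf (cen xf) p.1 p.2) (hi_half xf (cen xf) p.1 p.2)).
  apply: eq_Rint => x _.
  have -> : loc1 (peval k) z p.1 p.2 x = 0.
    by rewrite /loc1 /peval big1// => a _; rewrite z1 ?mul0r.
  have -> : loc2 L N (peval k) z p.1 p.2 x = 0.
    rewrite /loc2 /peval big1// => a _; rewrite z2 ?mul0r//.
    rewrite /dual_cell /didx; have := ltn_ord p.1; case: ifP => // _; case: ifP => // _; lia.
  by rewrite !mul0r addr0.
Qed.

End OneDimensionScheme.

(** * Bivariate polynomials and uniform meshes *)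

Section BivariatePolynomials.
Variable R : realType.
Implicit Types (F G : R -> R -> R).

(** The outer variable is [y]: evaluation at the constant polynomial leaves a polynomial in [x]. *)
Definition poly2 F := exists P : {poly {poly R}}, forall x y, F x y = P.[y%:P].[x].

Lemma poly2_x (f : R -> R) : polyfun f -> poly2 (fun x _ => f x).
Proof. by move=> [p fE]; exists p%:P => x y; rewrite hornerC fE. Qed.
Lemma poly2_y (f : R -> R) : polyfun f -> poly2 (fun _ y => f y).
Proof. by move=> [p fE]; exists (map_poly polyC p) => x y; rewrite horner_map hornerC fE. Qed.
Lemma poly2D F G : poly2 F -> poly2 G -> poly2 (fun x y => F x y + G x y).
Proof. by move=> [P hP] [Q hQ]; exists (P + Q) => x y; rewrite !hornerD hP hQ. Qed.
Lemma poly2M F G : poly2 F -> poly2 G -> poly2 (fun x y => F x y * G x y).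
Proof. by move=> [P hP] [Q hQ]; exists (P * Q) => x y; rewrite !hornerM hP hQ. Qed.
Lemma poly2_cst (c : R) : poly2 (fun _ _ => c).
Proof. exact/poly2_x/polyfun_cst. Qed.
Lemma poly2N F : poly2 F -> poly2 (fun x y => - F x y).
Proof. by move=> [P hP]; exists (- P) => x y; rewrite !hornerN hP. Qed.
Lemma poly2_sum (I : Type) (r : seq I) (F : I -> R -> R -> R) :
  (forall i, poly2 (F i)) -> poly2 (fun x y => \sum_(i <- r) F i x y).
Proof.
move=> pf; elim: r => [|i r IH].
  by exists 0 => x y; rewrite big_nil !horner0.
by have [P hP] := poly2D (pf i) IH; exists P => x y; rewrite big_cons hP.
Qed.
Lemma poly2_shift F (s t : R) : poly2 F -> poly2 (fun x y => F (x + s) (y + t)).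
Proof.
move=> [P hP]; exists ((map_poly (fun p => p \Po ('X + s%:P)) P) \Po ('X + (t%:P)%:P)) => x y.
rewrite hP horner_comp hornerD hornerX hornerC -polyCD.
have -> : (y + t)%:P = ((y + t)%:P \Po ('X + s%:P)) :> {poly R} by rewrite comp_polyC.
by rewrite (horner_map (comp_poly ('X + s%:P))) /= horner_comp !hornerE comp_polyC.
Qed.

Lemma poly2_expand F : poly2 F -> exists n (g : nat -> {poly R}),
  forall x y, F x y = \sum_(i < n) (g i).[x] * y ^+ i.
Proof.
move=> [P hP]; exists (size P), (fun i => P`_i) => x y.
rewrite hP (horner_coef P) horner_sum; apply: eq_bigr => i _.
by rewrite hornerM horner_exp hornerC.
Qed.

Lemma polyfun_exp (i : nat) : polyfun (fun x : R => x ^+ i).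
Proof. by exists 'X^i => x; rewrite hornerXn. Qed.

Lemma poly2_fixx F x : poly2 F -> polyfun (F x).
Proof.
move=> /poly2_expand[n [g gE]].
have -> : F x = fun y => \sum_(i < n) (g i).[x] * y ^+ i by apply/funext => y.
by apply: polyfun_sum => i; apply: polyfunM (polyfun_cst _) (polyfun_exp _).
Qed.

Lemma poly2_fixy F y : poly2 F -> polyfun (F^~ y).
Proof. by move=> [P hP]; exists P.[y%:P] => x. Qed.

Lemma poly2_Rint_y F c d : poly2 F -> polyfun (fun x => Rint c d (F x)).
Proof.
move=> /poly2_expand[n [g gE]].
have -> : (fun x => Rint c d (F x)) = fun x => \sum_(i < n) (g i).[x] * Rint c d (fun y => y ^+ i).
  apply/funext => x; have -> : F x = fun y => \sum_(i < n) (g i).[x] * y ^+ i by apply/funext => y.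
  rewrite Rint_sum => [|i]; last exact: polyfunM (polyfun_cst _) (polyfun_exp _).
  by apply: eq_bigr => i _; rewrite RintZ//; exact: polyfun_exp.
by apply: polyfun_sum => i; apply: polyfunM (polyfun_horner _) (polyfun_cst _).
Qed.

Lemma poly2_swap F : poly2 F -> poly2 (fun x y => F y x).
Proof.
move=> /poly2_expand[n [g gE]].
have -> : (fun x y => F y x) = fun x y => \sum_(i < n) (x ^+ i * (g i).[y]).
  by apply/funext => x; apply/funext => y; rewrite gE; apply: eq_bigr => i _; rewrite mulrC.
apply: poly2_sum => i; apply: poly2M; first exact/poly2_x/polyfun_exp.
exact/poly2_y/polyfun_horner.
Qed.

Lemma poly2_Rint_x F a b : poly2 F -> polyfun (fun y => Rint a b (F^~ y)).
Proof. by move=> /poly2_swap pf; exact: (poly2_Rint_y a b pf). Qed.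

(** By [poly2_expand] this concerns a finite sum of products of one-variable polynomials, on each of
    which both sides are the product of the integrals. *)
Lemma poly2_fubini F a b c d : poly2 F ->
  Rint a b (fun x => Rint c d (F x)) = Rint c d (fun y => Rint a b (F^~ y)).
Proof.
move=> /poly2_expand[n [g gE]].
have -> : (fun x => Rint c d (F x)) = fun x => \sum_(i < n) Rint c d (fun y => y ^+ i) * (g i).[x].
  apply/funext => x; have -> : F x = fun y => \sum_(i < n) (g i).[x] * y ^+ i by apply/funext => y.
  rewrite Rint_sum => [|i]; last exact: polyfunM (polyfun_cst _) (polyfun_exp _).
  by apply: eq_bigr => i _; rewrite RintZ; [exact: mulrC|exact: polyfun_exp].
have -> : (fun y => Rint a b (F^~ y)) = fun y => \sum_(i < n) Rint a b (horner (g i)) * y ^+ i.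
  apply/funext => y; have -> : F^~ y = fun x => \sum_(i < n) (y ^+ i * (g i).[x]).
    by apply/funext => x; rewrite gE; apply: eq_bigr => i _; rewrite mulrC.
  rewrite Rint_sum => [|i]; last exact: polyfunM (polyfun_cst _) (polyfun_horner _).
  by apply: eq_bigr => i _; rewrite RintZ; [exact: mulrC|exact: polyfun_horner].
rewrite Rint_sum => [|i]; last exact: polyfunM (polyfun_cst _) (polyfun_horner _).
rewrite Rint_sum => [|i]; last exact: polyfunM (polyfun_cst _) (polyfun_exp _).
apply: eq_bigr => i _; rewrite RintZ; last exact: polyfun_horner.
rewrite RintZ; last exact: polyfun_exp.
exact: mulrC.
Qed.

Variable k : nat.
Implicit Type p : nat -> nat -> R.

(** Both sums run over [a + b <= k]; the exchange lets a bivariate polynomial be read as one of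
    degree at most [k] in [y]. *)
Lemma triangle_exchange (F : nat -> nat -> R) :
  \sum_(a < k.+1) \sum_(b < (k.+1 - a)%N) F a b =
  \sum_(b < k.+1) \sum_(a < (k.+1 - b)%N) F a b.
Proof.
have E (G : nat -> R) a : \sum_(b < (k.+1 - a)%N) G b = \sum_(b < k.+1) if (a + b < k.+1)%N then G b else 0.
  rewrite (big_ord_widen k.+1 G (leq_subr a k.+1)) big_mkcond /=.
  by apply: eq_bigr => b _; have -> : (b < k.+1 - a)%N = (a + b < k.+1)%N by lia.
under eq_bigr => a _ do rewrite (E (F a)).
rewrite exchange_big /=; apply: eq_bigr => b _; rewrite (E (F^~ b)).
by apply: eq_bigr => a _; rewrite addnC.
Qed.

Lemma peval2_x p x y : peval2 k p x y = peval k (fun a => \sum_(b < (k.+1 - a)%N) p a b * y ^+ b) x.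
Proof.
apply: eq_bigr => a _; rewrite mulr_suml; apply: eq_bigr => b _; ring.
Qed.
Lemma pdx2_x p x y : pdx2 k p x y = pderiv k (fun a => \sum_(b < (k.+1 - a)%N) p a b * y ^+ b) x.
Proof.
apply: eq_bigr => a _; rewrite -mulrA mulr_suml; apply: eq_bigr => b _; ring.
Qed.
Lemma peval2_y p x y : peval2 k p x y = peval k (fun b => \sum_(a < (k.+1 - b)%N) p a b * x ^+ a) y.
Proof.
rewrite /peval2 (triangle_exchange (fun a b => p a b * x ^+ a * y ^+ b)).
by apply: eq_bigr => a _; rewrite mulr_suml.
Qed.
Lemma pdy2_y p x y : pdy2 k p x y = pderiv k (fun b => \sum_(a < (k.+1 - b)%N) p a b * x ^+ a) y.
Proof.
rewrite /pdy2 (triangle_exchange (fun a b => p a b * b%:R * x ^+ a * y ^+ b.-1)).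
apply: eq_bigr => a _; rewrite -mulrA mulr_suml; apply: eq_bigr => b _; ring.
Qed.

Lemma polyk_peval2_x p y : polyk k (fun x => peval2 k p x y) (fun x => pdx2 k p x y).
Proof.
have [q [sq qE dqE]] := polyk_peval k (fun a => \sum_(b < (k.+1 - a)%N) p a b * y ^+ b).
by exists q; split => // x; rewrite ?peval2_x ?pdx2_x.
Qed.
Lemma polyk_peval2_y p x : polyk k (peval2 k p x) (pdy2 k p x).
Proof.
have [q [sq qE dqE]] := polyk_peval k (fun b => \sum_(a < (k.+1 - b)%N) p a b * x ^+ a).
by exists q; split => // y; rewrite ?peval2_y ?pdy2_y.
Qed.

Lemma poly2_monomial (c : R) a b : poly2 (fun x y => c * x ^+ a * y ^+ b).
Proof.
apply: poly2M; last exact/poly2_y/polyfun_exp.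
by apply: poly2M (poly2_cst _) _; exact/poly2_x/polyfun_exp.
Qed.

(** What the value and the two partial derivatives have in common: polynomial in the point, linear
    in the coefficients, and determined by finitely many of them. *)
Definition is_peval2 (ev : (nat -> nat -> R) -> R -> R -> R) :=
  (forall p, poly2 (ev p)) /\
  (forall p1 p2 p3 c x y, (forall a b, p3 a b = c * p1 a b + p2 a b) ->
     ev p3 x y = c * ev p1 x y + ev p2 x y) /\
  (forall p x y, (forall a b, (a < k.+1)%N -> (b < k.+1)%N -> p a b = 0) -> ev p x y = 0).

Lemma is_peval2_sum (w : nat -> nat -> R) (ea eb : nat -> nat) :
  is_peval2 (fun p x y => \sum_(a < k.+1) \sum_(b < (k.+1 - a)%N) p a b * w a b * x ^+ (ea a) * y ^+ (eb b)).
Proof.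
split=> [p|]; first by do 2 apply: poly2_sum => ?; exact: poly2_monomial.
split=> [p1 p2 p3 c x y h|p x y h].
  rewrite mulr_sumr -big_split; apply: eq_bigr => a _ /=.
  rewrite mulr_sumr -big_split; apply: eq_bigr => b _ /=.
  by rewrite h; ring.
apply: big1 => a _; apply: big1 => b _; rewrite h ?mul0r//.
by have := ltn_ord b; lia.
Qed.

Lemma is_peval2_peval2 : is_peval2 (peval2 k).
Proof.
have -> : peval2 k = fun p (x y : R) => \sum_(a < k.+1) \sum_(b < (k.+1 - a)%N) p a b * 1 * x ^+ a * y ^+ b.
  by apply/funext => p; apply/funext => x; apply/funext => y;
    apply: eq_bigr => a _; apply: eq_bigr => b _; rewrite mulr1.
exact: (is_peval2_sum (fun _ _ => 1) id id).
Qed.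
Lemma is_peval2_pdx2 : is_peval2 (pdx2 k).
Proof. exact: (is_peval2_sum (fun a _ => a%:R) predn id). Qed.
Lemma is_peval2_pdy2 : is_peval2 (pdy2 k).
Proof. exact: (is_peval2_sum (fun _ b => b%:R) id predn). Qed.

End BivariatePolynomials.

Lemma dual_cell_wrap N i : (i < N)%N -> dual_cell N (i.+1 %% N)%N false = i.
Proof.
move=> iN; rewrite /dual_cell /didx; have [i1|i1] := ltnP i.+1 N.
  by rewrite modn_small.
have -> : i = N.-1 by lia.
by rewrite prednK ?modnn//; lia.
Qed.

(** * Periodic uniform meshes in one direction *)

Section UniformMesh.
Variables (R : realType) (N : nat) (L : R).
Hypotheses (N0 : (0 < N)%N) (L0 : 0 < L).
Let h := L / N%:R.

(** Gives each direction the form of a one-dimensional mesh, so that the half-cell lemmas apply;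
    nodes beyond [L] describe the periodic copy. *)
Definition unode (i : nat) : R := i%:R * h.

Lemma unif_h0 : 0 < h. Proof. by rewrite divr_gt0// ltr0n. Qed.
Lemma unode0 : unode 0 = 0. Proof. by rewrite /unode mul0r. Qed.
Lemma unodeN : unode N = L.
Proof. by rewrite /unode /h; field; rewrite pnatr_eq0 -lt0n. Qed.
Lemma unodeS i : unode i.+1 = unode i + h.
Proof. by rewrite /unode -natr1 mulrDl mul1r. Qed.
Lemma unode_lt i : (i < N)%N -> unode i < unode i.+1.
Proof. by rewrite unodeS ltrDl unif_h0. Qed.
Lemma cen_unode i : cen unode i = unode i + h / 2.
Proof. by rewrite /cen unodeS; field. Qed.
Lemma cen_unodeE i : (i%:R + 2^-1) * h = cen unode i.
Proof. by rewrite cen_unode /unode; field. Qed.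

Lemma dlo0 : dlo h 0 = 0. Proof. by []. Qed.
Lemma dloS i : dlo h i.+1 = cen unode i.
Proof. by rewrite /dlo /= -cen_unodeE -natr1; field. Qed.
Lemma dhiE i : dhi h i = cen unode i.
Proof.
rewrite /dhi; case: eqP => [->|_]; last by rewrite cen_unodeE.
by rewrite cen_unode unode0 add0r.
Qed.

Lemma cen_unodeS i : cen unode i < cen unode i.+1.
Proof. by rewrite !cen_unode unodeS; have := unif_h0; lra. Qed.

Lemma dlo_le i : (i < N.+1)%N -> dlo h i <= dlo h i.+1.
Proof.
case: i => [|i] _; rewrite dloS.
  by rewrite dlo0 cen_unode unode0 add0r divr_ge0// ltW// unif_h0.
by rewrite dloS ltW// cen_unodeS.
Qed.

Lemma primal_pick (G : nat -> R) i x : (i <= N)%N -> unode i <= x -> x < unode i.+1 ->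
  \sum_(j < N.+1) ind (j%:R * h) (j.+1%:R * h) x * G j = G i.
Proof.
move=> iN; apply: (sum_ind (t := unode)) => // j _.
by rewrite unodeS lerDl ltW// unif_h0.
Qed.

Lemma dual_pick (G : nat -> R) i x : (i <= N)%N -> dlo h i <= x -> x < cen unode i ->
  \sum_(j < N.+1) ind (dlo h j) (dhi h j) x * G j = G i.
Proof.
move=> iN h1 h2; under eq_bigr => j _ do rewrite dhiE -dloS.
by apply: (sum_ind (t := dlo h)) => //; [exact: dlo_le|rewrite dloS].
Qed.

(** The distance between node [i.+1] and its representative of index [i.+1 %% N]. *)
Definition wrap (i : nat) : R := if i.+1 == N then L else 0.
Lemma psh_wrap i : psh N L i.+1 = - wrap i.
Proof. by rewrite /psh /wrap; case: eqP => // _; rewrite oppr0. Qed.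
Lemma pidx_small i : (i < N)%N -> pidx N i = i. Proof. exact: modn_small. Qed.
Lemma psh_small i : (i < N)%N -> psh N L i = 0.
Proof. by rewrite /psh; case: eqP => // ->; rewrite ltnn. Qed.
Lemma dual_shift_wrap i : (i < N)%N -> dual_shift L (i.+1 %% N)%N false = wrap i.
Proof.
move=> iN; rewrite /dual_shift /dsh /wrap; have [i1|i1] := ltnP i.+1 N.
  by rewrite modn_small//; have -> : (i.+1 == N) = false by lia.
have -> : i = N.-1 by lia.
by rewrite prednK// modnn !eqxx.
Qed.
Lemma unode_wrap i : (i < N)%N -> unode i.+1 = unode (i.+1 %% N)%N + wrap i.
Proof.
move=> iN; rewrite /wrap; have [i1|i1] := ltnP i.+1 N.
  by rewrite modn_small// (_ : (i.+1 == N) = false) ?addr0//; lia.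
have -> : i.+1 = N by lia.
by rewrite modnn eqxx unode0 add0r unodeN.
Qed.
Lemma cen_wrap i : (i < N)%N -> cen unode i.+1 = cen unode (i.+1 %% N)%N + wrap i.
Proof. by move=> iN; rewrite !cen_unode unode_wrap// addrAC. Qed.

Lemma primal_split (F : R -> R) (g : nat -> bool -> R -> R) j : (j < N)%N ->
  (forall r, polyfun (g j r)) ->
  (forall r y, lo_half unode (cen unode) j r <= y < hi_half unode (cen unode) j r -> F y = g j r y) ->
  Rint (j%:R * h) (j.+1%:R * h) F =
  Rint (lo_half unode (cen unode) j false) (hi_half unode (cen unode) j false) (g j false) +
  Rint (lo_half unode (cen unode) j true) (hi_half unode (cen unode) j true) (g j true).
Proof.
move=> jN pg Fg; apply: (@Rint_split R _ (cen unode j)) => //.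
- exact: ltW (cen_gt unode_lt jN).
- exact: ltW (cen_lt unode_lt jN).
- by move=> y hy; apply: Fg.
- by move=> y hy; apply: Fg.
Qed.

(** A dual cell is the right half of primal cell [j] followed by the left half of its successor; for
    the last [j] that half lies beyond [L], and [wrap] translates it back. *)
Lemma dual_split (F : R -> R) (g : nat -> bool -> R -> R) j : (j < N)%N ->
  (forall i r, polyfun (g i r)) ->
  (forall y, cen unode j <= y < unode j.+1 -> F y = g j true y) ->
  (forall y, unode j.+1 <= y < cen unode j.+1 -> F y = g (j.+1 %% N)%N false (y - wrap j)) ->
  Rint ((j%:R + 2^-1) * h) ((j.+1%:R + 2^-1) * h) F =
  Rint (lo_half unode (cen unode) j true) (hi_half unode (cen unode) j true) (g j true) +
  Rint (lo_half unode (cen unode) (j.+1 %% N)%N false) (hi_half unode (cen unode) (j.+1 %% N)%N false)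
    (g (j.+1 %% N)%N false).
Proof.
move=> jN pg F1 F2; rewrite !cen_unodeE.
have l2 : unode j.+1 < cen unode j.+1 by rewrite cen_unode ltrDl divr_gt0// unif_h0.
rewrite (@Rint_split R _ (unode j.+1) _ _ (g j true) (fun y => g (j.+1 %% N)%N false (y - wrap j))) //.
- congr (_ + _); rewrite cen_wrap// unode_wrap// Rint_shift//=.
  + by apply: eq_Rint => y _; rewrite addrK.
  + by move: l2; rewrite cen_wrap// unode_wrap// ltrD2r.
  + exact: polyfun_comp (pg _ _) (polyfunD (polyfun_id R) (polyfun_cst _)).
- exact: ltW (cen_lt unode_lt jN).
- exact: ltW.
- exact: polyfun_comp (pg _ _) (polyfunD (polyfun_id R) (polyfun_cst _)).
Qed.

End UniformMesh.

(** * Quarter cells and edge integrals *)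

Section UniformHalves.
Variables (R : realType) (N : nat) (L : R).
Hypotheses (N0 : (0 < N)%N) (L0 : 0 < L).
Let h := L / N%:R.
Let t := unode N L.

(** A range on which one dual polynomial gives the dual component. It includes the primal node,
    where the primal edge integrals sample that component. *)
Definition in_half (i : nat) (r : bool) (x : R) :=
  if r then cen t i <= x <= t i.+1 else t i <= x < cen t i.

(** Position among the pieces summed in [ev2_2], offset by one because piece 0 is the wrapped half
    at the origin. *)
Definition dual_piece (i : nat) (r : bool) := if r then i.+1 else i.

Lemma in_half_of i r x : (i < N)%N ->
  lo_half t (cen t) i r <= x < hi_half t (cen t) i r -> in_half i r x.
Proof. by case: r => //= _ /andP[h1 h2]; rewrite /in_half h1 ltW. Qed.

Lemma dual_piece_in i r x : (i < N)%N -> in_half i r x ->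
  dlo h (dual_piece i r) <= x < cen t (dual_piece i r).
Proof.
move=> iN; case: r => /= /andP[h1 h2].
  rewrite /h dloS// h1 /=; apply: le_lt_trans h2 _.
  by rewrite cen_unode// ltrDl divr_gt0// unif_h0.
rewrite h2 andbT; case: i iN h1 {h2} => [|i] iN h1.
  by rewrite dlo0// -(unode0 N L).
by rewrite /h dloS//; apply: le_trans h1; apply/ltW/(cen_lt (unode_lt N0 L0)); lia.
Qed.

Lemma dual_piece_le i r : (i < N)%N -> (dual_piece i r <= N)%N.
Proof. by case: r => //= /ltnW. Qed.
Lemma didx_piece i r : didx N (dual_piece i r) = dual_cell N i r.
Proof. by case: r. Qed.
Lemma dsh_piece i r : dsh L (dual_piece i r) = dual_shift L i r.
Proof. by case: r. Qed.

Definition node_of (i : nat) (r : bool) : R := if r then t i.+1 else t i.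
Lemma node_of_in i r : (i < N)%N -> in_half i r (node_of i r).
Proof.
move=> iN; case: r => /=; rewrite lexx ?andbT.
  exact/ltW/(cen_lt (unode_lt N0 L0)).
exact: (cen_gt (unode_lt N0 L0)).
Qed.

End UniformHalves.

Section TwoDimensions.
Variables (R : realType) (k Nx Ny : nat) (Lx Ly : R).
Hypotheses (Nx0 : (0 < Nx)%N) (Ny0 : (0 < Ny)%N) (Lx0 : 0 < Lx) (Ly0 : 0 < Ly).
Implicit Types (ev : (nat -> nat -> R) -> R -> R -> R) (u v : state2 R).
Let hx := Lx / Nx%:R.
Let hy := Ly / Ny%:R.
Let tx := unode Nx Lx.
Let ty := unode Ny Ly.
Let lox := lo_half tx (cen tx).
Let hix := hi_half tx (cen tx).
Let loy := lo_half ty (cen ty).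
Let hiy := hi_half ty (cen ty).

Definition bloc1 ev u (i : nat) (r : bool) (j : nat) (s : bool) x y := ev (u.1 i j) x y.
Definition bloc2 ev u (i : nat) (r : bool) (j : nat) (s : bool) x y :=
  ev (u.2 (dual_cell Nx i r) (dual_cell Ny j s))
     (x + dual_shift Lx i r) (y + dual_shift Ly j s).

(** The indices [Nx] and [Ny] are included: edges of the last dual cells reach the periodic copy of
    the first primal cells. *)
Lemma ev1_2_pick ev w i j x y : (i <= Nx)%N -> (j <= Ny)%N ->
  tx i <= x < tx i.+1 -> ty j <= y < ty j.+1 ->
  ev1_2 Nx Ny Lx Ly ev w x y =
  ev (w (pidx Nx i) (pidx Ny j)) (x + psh Nx Lx i) (y + psh Ny Ly j).
Proof.
move=> iN jN /andP[x1 x2] /andP[y1 y2]; rewrite /ev1_2.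
pose G i' j' := ev (w (pidx Nx i') (pidx Ny j')) (x + psh Nx Lx i') (y + psh Ny Ly j').
transitivity (\sum_(i' < Nx.+1) ind (i'%:R * hx) (i'.+1%:R * hx) x *
  \sum_(j' < Ny.+1) ind (j'%:R * hy) (j'.+1%:R * hy) y * G i' j').
  by apply: eq_bigr => i' _; rewrite mulr_sumr; apply: eq_bigr => j' _; exact/esym/mulrA.
under eq_bigr => i' _ do rewrite (primal_pick Ny0 Ly0 (G i') jN y1 y2).
exact: (primal_pick Nx0 Lx0 (fun i' => G i' j) iN x1 x2).
Qed.

Lemma ev2_2_half ev u i r j s x y : (i < Nx)%N -> (j < Ny)%N ->
  in_half Nx Lx i r x -> in_half Ny Ly j s y ->
  ev2_2 Nx Ny Lx Ly ev u.2 x y = bloc2 ev u i r j s x y.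
Proof.
move=> iN jN /(dual_piece_in Nx0 Lx0 iN) /andP[x1 x2] /(dual_piece_in Ny0 Ly0 jN) /andP[y1 y2].
pose G i' j' := ev (u.2 (didx Nx i') (didx Ny j')) (x + dsh Lx i') (y + dsh Ly j').
transitivity (\sum_(i' < Nx.+1) ind (dlo hx i') (dhi hx i') x *
  \sum_(j' < Ny.+1) ind (dlo hy j') (dhi hy j') y * G i' j').
  by apply: eq_bigr => i' _; rewrite mulr_sumr; apply: eq_bigr => j' _; exact/esym/mulrA.
under eq_bigr => i' _ do rewrite (dual_pick Ny0 Ly0 (G i') (dual_piece_le s jN) y1 y2).
rewrite (dual_pick Nx0 Lx0 (fun i' => G i' _) (dual_piece_le r iN) x1 x2).
by rewrite /G !didx_piece !dsh_piece.
Qed.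

Lemma ev1_2_half ev u i r j s x y : (i < Nx)%N -> (j < Ny)%N ->
  tx i <= x < tx i.+1 -> ty j <= y < ty j.+1 ->
  ev1_2 Nx Ny Lx Ly ev u.1 x y = bloc1 ev u i r j s x y.
Proof.
move=> iN jN xi yj; rewrite (ev1_2_pick _ _ (ltnW iN) (ltnW jN) xi yj).
by rewrite !pidx_small// !psh_small// !addr0.
Qed.

Lemma half_cell_x i r x : (i < Nx)%N -> lox i r <= x < hix i r -> tx i <= x < tx i.+1.
Proof.
by move=> iN h; have [h1 h2] := half_in (unode_lt Nx0 Lx0) iN h; apply/andP.
Qed.
Lemma half_cell_y j s y : (j < Ny)%N -> loy j s <= y < hiy j s -> ty j <= y < ty j.+1.
Proof.
by move=> iN h; have [h1 h2] := half_in (unode_lt Ny0 Ly0) iN h; apply/andP.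
Qed.

Lemma poly2_bloc1 ev u i r j s : is_peval2 k ev -> poly2 (bloc1 ev u i r j s).
Proof. by move=> [pe _]; exact: pe. Qed.
Lemma poly2_bloc2 ev u i r j s : is_peval2 k ev -> poly2 (bloc2 ev u i r j s).
Proof. by move=> [pe _]; apply: poly2_shift; exact: pe. Qed.

Lemma Rint_halves_x (F : R -> R) (f : nat -> bool -> R -> R) :
  (forall i r, polyfun (f i r)) ->
  (forall i r x, (i < Nx)%N -> lox i r <= x < hix i r -> F x = f i r x) ->
  Rint 0 Lx F = \sum_(p : 'I_Nx * bool) Rint (lox p.1 p.2) (hix p.1 p.2) (f p.1 p.2).
Proof. by apply: Rint_halves => //; [exact: unode0|exact: unodeN|exact: unode_lt]. Qed.
Lemma Rint_halves_y (F : R -> R) (f : nat -> bool -> R -> R) :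
  (forall i r, polyfun (f i r)) ->
  (forall i r x, (i < Ny)%N -> loy i r <= x < hiy i r -> F x = f i r x) ->
  Rint 0 Ly F = \sum_(p : 'I_Ny * bool) Rint (loy p.1 p.2) (hiy p.1 p.2) (f p.1 p.2).
Proof. by apply: Rint_halves => //; [exact: unode0|exact: unodeN|exact: unode_lt]. Qed.

(** A quarter cell is an overlap of a primal and a dual cell, where both components are single
    polynomials. *)
Definition quarter_int i r j s (f : R -> R -> R) :=
  Rint (lox i r) (hix i r) (fun x => Rint (loy j s) (hiy j s) (f x)).

Lemma intO2_quarters (F : R -> R -> R) (f : nat -> bool -> nat -> bool -> R -> R -> R) :
  (forall i r j s, poly2 (f i r j s)) ->
  (forall i r j s x y, (i < Nx)%N -> (j < Ny)%N -> lox i r <= x < hix i r ->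
     loy j s <= y < hiy j s -> F x y = f i r j s x y) ->
  intO2 Lx Ly F = \sum_(p : 'I_Nx * bool) \sum_(q : 'I_Ny * bool)
    quarter_int p.1 p.2 q.1 q.2 (f p.1 p.2 q.1 q.2).
Proof.
move=> pf Ff; rewrite /intO2.
rewrite (@Rint_halves_x _ (fun i r x => \sum_(q : 'I_Ny * bool)
    Rint (loy q.1 q.2) (hiy q.1 q.2) (f i r q.1 q.2 x))).
- apply: eq_bigr => p _; rewrite Rint_sum// => q; exact: poly2_Rint_y.
- by move=> i r; apply: polyfun_sum => q; exact: poly2_Rint_y.
- move=> i r x iN xi; rewrite (@Rint_halves_y _ (fun j s => f i r j s x))//.
    by move=> j s; exact: poly2_fixx.
  by move=> j s y jN yj; exact: Ff.
Qed.

Lemma ip2E u v : ip2 k Lx Ly (Nx, Ny) u v = \sum_(p : 'I_Nx * bool) \sum_(q : 'I_Ny * bool)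
  quarter_int p.1 p.2 q.1 q.2 (fun x y =>
    bloc1 (peval2 k) u p.1 p.2 q.1 q.2 x y * bloc1 (peval2 k) v p.1 p.2 q.1 q.2 x y +
    bloc2 (peval2 k) u p.1 p.2 q.1 q.2 x y * bloc2 (peval2 k) v p.1 p.2 q.1 q.2 x y).
Proof.
have ev := is_peval2_peval2 R k.
have p1 w i r j s := poly2_bloc1 w i r j s ev.
have p2 w i r j s := poly2_bloc2 w i r j s ev.
rewrite /ip2 (@intO2_quarters _ (fun i r j s x y =>
  bloc1 (peval2 k) u i r j s x y * bloc1 (peval2 k) v i r j s x y)); last 2 first.
- by move=> i r j s; exact: poly2M.
- move=> i r j s x y iN jN xi yj.
  have cx := half_cell_x iN xi; have cy := half_cell_y jN yj.
  by rewrite !(ev1_2_half _ _ r s iN jN cx cy).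
rewrite (@intO2_quarters _ (fun i r j s x y =>
  bloc2 (peval2 k) u i r j s x y * bloc2 (peval2 k) v i r j s x y)); last 2 first.
- by move=> i r j s; exact: poly2M.
- move=> i r j s x y iN jN xi yj.
  by rewrite !(ev2_2_half _ _ iN jN (in_half_of iN xi) (in_half_of jN yj)).
rewrite -big_split; apply: eq_bigr => p _; rewrite -big_split; apply: eq_bigr => q _ /=.
rewrite /quarter_int -RintD; try (by apply: poly2_Rint_y; exact: poly2M).
by apply: eq_Rint => x _; rewrite RintD//; apply: poly2_fixx (poly2M _ _).
Qed.

Let e1 u i r j s := bloc1 (peval2 k) u i r j s.
Let e2 u i r j s := bloc2 (peval2 k) u i r j s.
Let pe1 u i r j s : poly2 (e1 u i r j s) := poly2_bloc1 u i r j s (is_peval2_peval2 R k).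
Let pe2 u i r j s : poly2 (e2 u i r j s) := poly2_bloc2 u i r j s (is_peval2_peval2 R k).

(** In the four edge terms of a quarter cell, the letter is the direction of the normal and the
    digit the component of the test function: 1 on primal edges, 2 on dual ones. *)
Definition edge_x1 u v i r j s := Rint (loy j s) (hiy j s) (fun y =>
  e2 u i r j s (node_of Nx Lx i r) y * e1 v i r j s (node_of Nx Lx i r) y).
Definition edge_x2 u v i r j s := Rint (loy j s) (hiy j s) (fun y =>
  e1 u i r j s (cen tx i) y * e2 v i r j s (cen tx i) y).
Definition edge_y1 u v i r j s := Rint (lox i r) (hix i r) (fun x =>
  e2 u i r j s x (node_of Ny Ly j s) * e1 v i r j s x (node_of Ny Ly j s)).
Definition edge_y2 u v i r j s := Rint (lox i r) (hix i r) (fun x =>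
  e1 u i r j s x (cen ty j) * e2 v i r j s x (cen ty j)).

Let U1 u := ev1_2 Nx Ny Lx Ly (peval2 k) u.1.
Let U2 u := ev2_2 Nx Ny Lx Ly (peval2 k) u.2.

Lemma primal_edge_x (b : R) u v i r j : (i < Nx)%N -> (j < Ny)%N ->
  Rint (j%:R * hy) (j.+1%:R * hy) (fun y => b * U2 u (node_of Nx Lx i r) y *
      peval2 k (v.1 i j) (node_of Nx Lx i r) y) =
  b * (edge_x1 u v i r j false + edge_x1 u v i r j true).
Proof.
move=> iN jN; set X := node_of Nx Lx i r.
have pg s : polyfun (fun y => e2 u i r j s X y * e1 v i r j s X y).
  exact: (poly2_fixx X (poly2M (pe2 u i r j s) (pe1 v i r j s))).
rewrite (@primal_split R Ny Ly Ny0 Ly0 _ (fun j s y => b * (e2 u i r j s X y * e1 v i r j s X y)))//.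
- by rewrite !RintZ// mulrDr.
- by move=> s; exact: polyfunM (polyfun_cst _) (pg s).
- move=> s y yj; rewrite -mulrA; congr (_ * (_ * _)).
  exact: ev2_2_half (node_of_in Nx0 Lx0 r iN) (in_half_of jN yj).
Qed.

Lemma primal_edge_y (b : R) u v i j s : (i < Nx)%N -> (j < Ny)%N ->
  Rint (i%:R * hx) (i.+1%:R * hx) (fun x => b * U2 u x (node_of Ny Ly j s) *
      peval2 k (v.1 i j) x (node_of Ny Ly j s)) =
  b * (edge_y1 u v i false j s + edge_y1 u v i true j s).
Proof.
move=> iN jN; set Y := node_of Ny Ly j s.
have pg r : polyfun (fun x => e2 u i r j s x Y * e1 v i r j s x Y).
  exact: (poly2_fixy Y (poly2M (pe2 u i r j s) (pe1 v i r j s))).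
rewrite (@primal_split R Nx Lx Nx0 Lx0 _ (fun i r x => b * (e2 u i r j s x Y * e1 v i r j s x Y)))//.
- by rewrite !RintZ// mulrDr.
- by move=> r; exact: polyfunM (polyfun_cst _) (pg r).
- move=> r x xi; rewrite -mulrA; congr (_ * (_ * _)).
  exact: ev2_2_half (in_half_of iN xi) (node_of_in Ny0 Ly0 s jN).
Qed.

(* The dual edge through the centre of the primal cell [i], seen from its left
   half ([r = false], the edge is the right one of its dual cell) or from its
   right half. *)
Definition centre_of (N : nat) (L : R) (i : nat) (r : bool) : R :=
  if r then cen (unode N L) i else cen (unode N L) i.+1.
Definition wrapped (N i : nat) (r : bool) : nat := if r then i else (i.+1 %% N)%N.

Lemma wrapped_cell N i r : (i < N)%N -> dual_cell N (wrapped N i r) r = i.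
Proof. by case: r => //= iN; exact: dual_cell_wrap. Qed.

(** [i0] is the primal piece containing the centre, [i] or [i.+1]; for the last dual cell the latter
    is the extra piece [N] beyond [L]. *)
Lemma centre_in N (L : R) i r : (0 < N)%N -> 0 < L -> (i < N)%N -> exists2 i0, (i0 <= N)%N &
  [/\ unode N L i0 <= centre_of N L i r < unode N L i0.+1, pidx N i0 = wrapped N i r,
     centre_of N L i r + psh N L i0 = cen (unode N L) (wrapped N i r) &
     centre_of N L i r = cen (unode N L) (wrapped N i r) + dual_shift L (wrapped N i r) r].
Proof.
move=> N0 L0 iN; have h0 := unif_h0 N0 L0.
have cin j : unode N L j <= cen (unode N L) j < unode N L j.+1.
  by rewrite unodeS// cen_unode//; apply/andP; split; lra.
case: r; rewrite /centre_of /wrapped.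
  by exists i; [exact: ltnW|split; rewrite ?cin ?pidx_small ?psh_small ?addr0// /dual_shift addr0].
exists i.+1; first by [].
by split; rewrite ?cin// ?psh_wrap// ?dual_shift_wrap// cen_wrap// addrK.
Qed.

(** A dual edge crosses a primal edge in its middle, so it splits into edges of two quarter cells,
    the second in the next row modulo the period. *)
Lemma dual_edge_x (b : R) u v i r j : (i < Nx)%N -> (j < Ny)%N ->
  Rint ((j%:R + 2^-1) * hy) ((j.+1%:R + 2^-1) * hy) (fun y => b * U1 u (centre_of Nx Lx i r) y *
      peval2 k (v.2 i j) (centre_of Nx Lx i r) y) =
  b * (edge_x2 u v (wrapped Nx i r) r j true + edge_x2 u v (wrapped Nx i r) r (j.+1 %% Ny)%N false).
Proof.
move=> iN jN; have [i0 i0N [i0in i0p i0c i0s]] := centre_in r Nx0 Lx0 iN.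
set i' := wrapped Nx i r in i0p i0c i0s *; set X := cen tx i' in i0c i0s.
have pg l s : polyfun (fun y => e1 u i' r l s X y * e2 v i' r l s X y).
  exact: (poly2_fixx X (poly2M (pe1 u i' r l s) (pe2 v i' r l s))).
rewrite (@dual_split R Ny Ly Ny0 Ly0 _ (fun j s y => b * (e1 u i' r j s X y * e2 v i' r j s X y)))//.
- by rewrite !RintZ// mulrDr.
- by move=> j' s; exact: polyfunM (polyfun_cst _) (pg j' s).
- move=> y /andP[y1 y2].
  have yin : ty j <= y < ty j.+1.
    rewrite y2 andbT; by apply: le_trans y1; exact/ltW/(cen_gt (unode_lt Ny0 Ly0)).
  rewrite -mulrA /U1 (ev1_2_pick _ _ i0N (ltnW jN) i0in yin) i0p i0c.
  rewrite pidx_small// psh_small// addr0 /e1 /e2 /bloc1 /bloc2 wrapped_cell// -i0s.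
  by rewrite /dual_shift addr0.
- move=> y yin.
  have {}yin : ty j.+1 <= y < ty j.+2.
    have /andP[y1 y2] := yin; rewrite y1 /=; apply: lt_trans y2 _.
    by rewrite /ty unodeS// cen_unode//; have := unif_h0 Ny0 Ly0; lra.
  rewrite -mulrA /U1 (ev1_2_pick _ _ i0N jN i0in yin) i0p i0c.
  rewrite psh_wrap /e1 /e2 /bloc1 /bloc2 wrapped_cell// -i0s.
  by rewrite dual_cell_wrap// (dual_shift_wrap Ny0)// subrK.
Qed.

Lemma dual_edge_y (b : R) u v i j s : (i < Nx)%N -> (j < Ny)%N ->
  Rint ((i%:R + 2^-1) * hx) ((i.+1%:R + 2^-1) * hx) (fun x => b * U1 u x (centre_of Ny Ly j s) *
      peval2 k (v.2 i j) x (centre_of Ny Ly j s)) =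
  b * (edge_y2 u v i true (wrapped Ny j s) s + edge_y2 u v (i.+1 %% Nx)%N false (wrapped Ny j s) s).
Proof.
move=> iN jN; have [j0 j0N [j0in j0p j0c j0s]] := centre_in s Ny0 Ly0 jN.
set j' := wrapped Ny j s in j0p j0c j0s *; set Y := cen ty j' in j0c j0s.
have pg l r : polyfun (fun x => e1 u l r j' s x Y * e2 v l r j' s x Y).
  exact: (poly2_fixy Y (poly2M (pe1 u l r j' s) (pe2 v l r j' s))).
rewrite (@dual_split R Nx Lx Nx0 Lx0 _ (fun i r x => b * (e1 u i r j' s x Y * e2 v i r j' s x Y)))//.
- by rewrite !RintZ// mulrDr.
- by move=> i' r; exact: polyfunM (polyfun_cst _) (pg i' r).
- move=> x /andP[x1 x2].
  have xin : tx i <= x < tx i.+1.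
    rewrite x2 andbT; by apply: le_trans x1; exact/ltW/(cen_gt (unode_lt Nx0 Lx0)).
  rewrite -mulrA /U1 (ev1_2_pick _ _ (ltnW iN) j0N xin j0in) j0p j0c.
  rewrite pidx_small// psh_small// addr0 /e1 /e2 /bloc1 /bloc2 wrapped_cell// -j0s.
  by rewrite /dual_shift addr0.
- move=> x xin.
  have {}xin : tx i.+1 <= x < tx i.+2.
    have /andP[x1 x2] := xin; rewrite x1 /=; apply: lt_trans x2 _.
    by rewrite /tx unodeS// cen_unode//; have := unif_h0 Nx0 Lx0; lra.
  rewrite -mulrA /U1 (ev1_2_pick _ _ iN j0N xin j0in) j0p j0c.
  rewrite psh_wrap /e1 /e2 /bloc1 /bloc2 wrapped_cell// -j0s.
  by rewrite dual_cell_wrap// (dual_shift_wrap Nx0)// subrK.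
Qed.

End TwoDimensions.

(** * The two-dimensional scheme *)

Section TwoDimensionalOperator.
Variables (R : realType) (k Nx Ny : nat) (Lx Ly : R).
Hypotheses (Nx0 : (0 < Nx)%N) (Ny0 : (0 < Ny)%N) (Lx0 : 0 < Lx) (Ly0 : 0 < Ly).
Implicit Types (u v : state2 R).
Let hx := Lx / Nx%:R.
Let hy := Ly / Ny%:R.
Let tx := unode Nx Lx.
Let ty := unode Ny Ly.
Let lox := lo_half tx (cen tx).
Let hix := hi_half tx (cen tx).
Let loy := lo_half ty (cen ty).
Let hiy := hi_half ty (cen ty).
Let e1 u i r j s := bloc1 (peval2 k) u i r j s.
Let e2 u i r j s := bloc2 Nx Ny Lx Ly (peval2 k) u i r j s.
Let x1 u i r j s := bloc1 (pdx2 k) u i r j s.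
Let x2 u i r j s := bloc2 Nx Ny Lx Ly (pdx2 k) u i r j s.
Let y1 u i r j s := bloc1 (pdy2 k) u i r j s.
Let y2 u i r j s := bloc2 Nx Ny Lx Ly (pdy2 k) u i r j s.
Let pe1 u i r j s : poly2 (e1 u i r j s) := poly2_bloc1 u i r j s (is_peval2_peval2 R k).
Let pe2 u i r j s : poly2 (e2 u i r j s) := poly2_bloc2 _ _ _ _ u i r j s (is_peval2_peval2 R k).
Let px1 u i r j s : poly2 (x1 u i r j s) := poly2_bloc1 u i r j s (is_peval2_pdx2 R k).
Let px2 u i r j s : poly2 (x2 u i r j s) := poly2_bloc2 _ _ _ _ u i r j s (is_peval2_pdx2 R k).
Let py1 u i r j s : poly2 (y1 u i r j s) := poly2_bloc1 u i r j s (is_peval2_pdy2 R k).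
Let py2 u i r j s : poly2 (y2 u i r j s) := poly2_bloc2 _ _ _ _ u i r j s (is_peval2_pdy2 R k).
Let Q i r j s := @quarter_int R Nx Ny Lx Ly i r j s.

Definition advect_x u v i r j s y := advect (lox i r) (hix i r) r
  (e1 u i r j s ^~ y) (e2 u i r j s ^~ y) (e1 v i r j s ^~ y) (e2 v i r j s ^~ y)
  (x1 v i r j s ^~ y) (x2 v i r j s ^~ y).
Definition advect_y u v i r j s x := advect (loy j s) (hiy j s) s
  (e1 u i r j s x) (e2 u i r j s x) (e1 v i r j s x) (e2 v i r j s x)
  (y1 v i r j s x) (y2 v i r j s x).

Let sg (r : bool) : R := if r then 1 else -1.
Let vx u v i r j s x y := e2 u i r j s x y * x1 v i r j s x y + e1 u i r j s x y * x2 v i r j s x y.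
Let vy u v i r j s x y := e2 u i r j s x y * y1 v i r j s x y + e1 u i r j s x y * y2 v i r j s x y.
Let pvx u v i r j s : poly2 (vx u v i r j s).
Proof. by apply: poly2D; exact: poly2M. Qed.
Let pvy u v i r j s : poly2 (vy u v i r j s).
Proof. by apply: poly2D; exact: poly2M. Qed.

Lemma advect_xE u v i r j s y : advect_x u v i r j s y =
  Rint (lox i r) (hix i r) (fun x => vx u v i r j s x y) -
  sg r * (e2 u i r j s (node_of Nx Lx i r) y * e1 v i r j s (node_of Nx Lx i r) y -
          e1 u i r j s (cen tx i) y * e2 v i r j s (cen tx i) y).
Proof. by rewrite /advect_x /advect; case: r. Qed.

Lemma advect_yE u v i r j s x : advect_y u v i r j s x =
  Rint (loy j s) (hiy j s) (vy u v i r j s x) -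
  sg s * (e2 u i r j s x (node_of Ny Ly j s) * e1 v i r j s x (node_of Ny Ly j s) -
          e1 u i r j s x (cen ty j) * e2 v i r j s x (cen ty j)).
Proof. by rewrite /advect_y /advect; case: s. Qed.

Lemma polyfun_advect_x u v i r j s : polyfun (advect_x u v i r j s).
Proof.
have -> : advect_x u v i r j s = fun y => advect_x u v i r j s y by [].
under [X in polyfun X]eq_fun => y do rewrite advect_xE.
apply: polyfunD; first exact: poly2_Rint_x (pvx _ _ _ _ _ _).
apply/polyfunN/(polyfunM (polyfun_cst _))/polyfunD.
  exact: (poly2_fixx _ (poly2M (pe2 u i r j s) (pe1 v i r j s))).
exact/polyfunN/(poly2_fixx _ (poly2M (pe1 u i r j s) (pe2 v i r j s))).
Qed.

Lemma polyfun_advect_y u v i r j s : polyfun (advect_y u v i r j s).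
Proof.
have -> : advect_y u v i r j s = fun x => advect_y u v i r j s x by [].
under [X in polyfun X]eq_fun => x do rewrite advect_yE.
apply: polyfunD; first exact: poly2_Rint_y (pvy _ _ _ _ _ _).
apply/polyfunN/(polyfunM (polyfun_cst _))/polyfunD.
  exact: (poly2_fixy _ (poly2M (pe2 u i r j s) (pe1 v i r j s))).
exact/polyfunN/(poly2_fixy _ (poly2M (pe1 u i r j s) (pe2 v i r j s))).
Qed.

Let Ex := edge_x1 k Nx Ny Lx Ly.
Let Dx := edge_x2 k Nx Ny Lx Ly.
Let Ey := edge_y1 k Nx Ny Lx Ly.
Let Dy := edge_y2 k Nx Ny Lx Ly.

(** The inner variable of [quarter_int] is [y], so this direction, unlike the other, goes through
    Fubini. *)
Lemma Rint_advect_x u v i r j s : Rint (loy j s) (hiy j s) (advect_x u v i r j s) =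
  Q i r j s (vx u v i r j s) - sg r * (Ex u v i r j s - Dx u v i r j s).
Proof.
have q1 : polyfun (fun y => e2 u i r j s (node_of Nx Lx i r) y * e1 v i r j s (node_of Nx Lx i r) y).
  exact: (poly2_fixx _ (poly2M (pe2 u i r j s) (pe1 v i r j s))).
have q2 : polyfun (fun y => e1 u i r j s (cen tx i) y * e2 v i r j s (cen tx i) y).
  exact: (poly2_fixx _ (poly2M (pe1 u i r j s) (pe2 v i r j s))).
rewrite /Q /quarter_int poly2_fubini// /Ex /Dx /edge_x1 /edge_x2.
rewrite -RintB// -RintZ//; last exact: polyfunD q1 (polyfunN q2).
rewrite -RintB//; [|exact: poly2_Rint_x|exact: polyfunM (polyfun_cst _) (polyfunD q1 (polyfunN q2))].
by apply: eq_Rint => y _; exact: advect_xE.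
Qed.

Lemma Rint_advect_y u v i r j s : Rint (lox i r) (hix i r) (advect_y u v i r j s) =
  Q i r j s (vy u v i r j s) - sg s * (Ey u v i r j s - Dy u v i r j s).
Proof.
have q1 : polyfun (fun x => e2 u i r j s x (node_of Ny Ly j s) * e1 v i r j s x (node_of Ny Ly j s)).
  exact: (poly2_fixy _ (poly2M (pe2 u i r j s) (pe1 v i r j s))).
have q2 : polyfun (fun x => e1 u i r j s x (cen ty j) * e2 v i r j s x (cen ty j)).
  exact: (poly2_fixy _ (poly2M (pe1 u i r j s) (pe2 v i r j s))).
rewrite /Q /quarter_int /Ey /Dy /edge_y1 /edge_y2.
rewrite -RintB// -RintZ//; last exact: polyfunD q1 (polyfunN q2).
rewrite -RintB//; [|exact: poly2_Rint_y|exact: polyfunM (polyfun_cst _) (polyfunD q1 (polyfunN q2))].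
by apply: eq_Rint => x _; exact: advect_yE.
Qed.

Lemma quarter_intD i r j s F G : poly2 F -> poly2 G ->
  Q i r j s (fun x y => F x y + G x y) = Q i r j s F + Q i r j s G.
Proof.
move=> pF pG; rewrite /Q /quarter_int -RintD; try exact: poly2_Rint_y.
by apply: eq_Rint => x _; rewrite RintD//; exact: poly2_fixx.
Qed.
Lemma quarter_intZ i r j s c F : poly2 F ->
  Q i r j s (fun x y => c * F x y) = c * Q i r j s F.
Proof.
move=> pF; rewrite /Q /quarter_int -RintZ; last exact: poly2_Rint_y.
by apply: eq_Rint => x _; rewrite RintZ//; exact: poly2_fixx.
Qed.

Lemma sum_quarters (F : nat -> bool -> nat -> bool -> R) :
  \sum_(p : 'I_Nx * bool) \sum_(q : 'I_Ny * bool) F p.1 p.2 q.1 q.2 =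
  \sum_(i < Nx) \sum_(j < Ny) (F i false j false + F i false j true + (F i true j false + F i true j true)).
Proof.
rewrite (sum_halves Nx (fun i r => \sum_(q : 'I_Ny * bool) F i r q.1 q.2)).
apply: eq_bigr => i _; rewrite (sum_halves Ny (F i false)) (sum_halves Ny (F i true)).
by rewrite -big_split.
Qed.

Lemma sum_rot2 (A B C D : nat -> nat -> R) :
  \sum_(i < Nx) \sum_(j < Ny) (A (i.+1 %% Nx)%N j + B (i.+1 %% Nx)%N (j.+1 %% Ny)%N + C i j + D i (j.+1 %% Ny)%N) =
  \sum_(i < Nx) \sum_(j < Ny) (A i j + B i j + C i j + D i j).
Proof.
under eq_bigr => i _ do rewrite !big_split /= (sum_rot Ny (B _)) (sum_rot Ny (D _)).
rewrite !big_split /= (sum_rot Nx (fun i => \sum_(j < Ny) A i j)) (sum_rot Nx (fun i => \sum_(j < Ny) B i j)).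
rewrite -!big_split /=; apply: eq_bigr => i _; by rewrite -!big_split.
Qed.

Variables (b1 b2 : R).
Let U1 u := ev1_2 Nx Ny Lx Ly (peval2 k) u.1.
Let U2 u := ev2_2 Nx Ny Lx Ly (peval2 k) u.2.

Lemma primal_boundary u v :
  \sum_(i < Nx) \sum_(j < Ny)
      (Rint (j%:R * hy) (j.+1%:R * hy) (fun y => b1 * U2 u (i.+1%:R * hx) y * peval2 k (v.1 i j) (i.+1%:R * hx) y)
       - Rint (j%:R * hy) (j.+1%:R * hy) (fun y => b1 * U2 u (i%:R * hx) y * peval2 k (v.1 i j) (i%:R * hx) y)
       + Rint (i%:R * hx) (i.+1%:R * hx) (fun x => b2 * U2 u x (j.+1%:R * hy) * peval2 k (v.1 i j) x (j.+1%:R * hy))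
       - Rint (i%:R * hx) (i.+1%:R * hx) (fun x => b2 * U2 u x (j%:R * hy) * peval2 k (v.1 i j) x (j%:R * hy))) =
  \sum_(p : 'I_Nx * bool) \sum_(q : 'I_Ny * bool)
    (b1 * (sg p.2 * Ex u v p.1 p.2 q.1 q.2) + b2 * (sg q.2 * Ey u v p.1 p.2 q.1 q.2)).
Proof.
rewrite (sum_quarters (fun i r j s => b1 * (sg r * Ex u v i r j s) + b2 * (sg s * Ey u v i r j s))).
apply: eq_bigr => i _; apply: eq_bigr => j _; have iN := ltn_ord i; have jN := ltn_ord j.
have h1 := primal_edge_x k Nx0 Ny0 Lx0 Ly0 b1 u v true iN jN.
have h2 := primal_edge_x k Nx0 Ny0 Lx0 Ly0 b1 u v false iN jN.
have h3 := primal_edge_y k Nx0 Ny0 Lx0 Ly0 b2 u v true iN jN.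
have h4 := primal_edge_y k Nx0 Ny0 Lx0 Ly0 b2 u v false iN jN.
rewrite [X in X - _ + _ - _](h1 : _ = _) [X in _ - X + _ - _](h2 : _ = _).
rewrite [X in _ + X - _](h3 : _ = _) [X in _ - X](h4 : _ = _).
rewrite -/Ex -/Ey /sg; ring.
Qed.

Lemma dual_boundary u v :
  \sum_(i < Nx) \sum_(j < Ny)
      (Rint ((j%:R + 2^-1) * hy) ((j.+1%:R + 2^-1) * hy) (fun y => b1 * U1 u ((i.+1%:R + 2^-1) * hx) y * peval2 k (v.2 i j) ((i.+1%:R + 2^-1) * hx) y)
       - Rint ((j%:R + 2^-1) * hy) ((j.+1%:R + 2^-1) * hy) (fun y => b1 * U1 u ((i%:R + 2^-1) * hx) y * peval2 k (v.2 i j) ((i%:R + 2^-1) * hx) y)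
       + Rint ((i%:R + 2^-1) * hx) ((i.+1%:R + 2^-1) * hx) (fun x => b2 * U1 u x ((j.+1%:R + 2^-1) * hy) * peval2 k (v.2 i j) x ((j.+1%:R + 2^-1) * hy))
       - Rint ((i%:R + 2^-1) * hx) ((i.+1%:R + 2^-1) * hx) (fun x => b2 * U1 u x ((j%:R + 2^-1) * hy) * peval2 k (v.2 i j) x ((j%:R + 2^-1) * hy))) =
  - \sum_(p : 'I_Nx * bool) \sum_(q : 'I_Ny * bool)
    (b1 * (sg p.2 * Dx u v p.1 p.2 q.1 q.2) + b2 * (sg q.2 * Dy u v p.1 p.2 q.1 q.2)).
Proof.
rewrite (sum_quarters (fun i r j s => b1 * (sg r * Dx u v i r j s) + b2 * (sg s * Dy u v i r j s))).
(* Dual edge terms sorted by the quarter of the primal cell they lie in. A dual cell takes its four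
   quarters from four primal cells, whence the cyclic shifts of [sum_rot2]. *)
pose A i j := b1 * Dx u v i false j true - b2 * Dy u v i false j true.
pose B i j := b1 * Dx u v i false j false + b2 * Dy u v i false j false.
pose C i j := - b1 * Dx u v i true j true - b2 * Dy u v i true j true.
pose D i j := - b1 * Dx u v i true j false + b2 * Dy u v i true j false.
transitivity (\sum_(i < Nx) \sum_(j < Ny) (A i j + B i j + C i j + D i j)); last first.
  rewrite -sumrN; apply: eq_bigr => i _; rewrite -sumrN; apply: eq_bigr => j _.
  rewrite /A /B /C /D /sg; ring.
rewrite -sum_rot2.
apply: eq_bigr => i _; apply: eq_bigr => j _; have iN := ltn_ord i; have jN := ltn_ord j.
have h1 := dual_edge_x k Nx0 Ny0 Lx0 Ly0 b1 u v false iN jN.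
have h2 := dual_edge_x k Nx0 Ny0 Lx0 Ly0 b1 u v true iN jN.
have h3 := dual_edge_y k Nx0 Ny0 Lx0 Ly0 b2 u v false iN jN.
have h4 := dual_edge_y k Nx0 Ny0 Lx0 Ly0 b2 u v true iN jN.
rewrite /centre_of -cen_unodeE in h1; rewrite /centre_of -cen_unodeE in h2.
rewrite /centre_of -cen_unodeE in h3; rewrite /centre_of -cen_unodeE in h4.
rewrite [X in X - _ + _ - _](h1 : _ = _) [X in _ - X + _ - _](h2 : _ = _).
rewrite [X in _ + X - _](h3 : _ = _) [X in _ - X](h4 : _ = _).
rewrite /wrapped -/Dx -/Dy /A /B /C /D; ring.
Qed.

Lemma H2E CFL u v : H2 k b1 b2 CFL Lx Ly (Nx, Ny) u v =
  - (CFL / (`|b1| / hx + `|b2| / hy))^-1 *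
     \sum_(p : 'I_Nx * bool) \sum_(q : 'I_Ny * bool) Q p.1 p.2 q.1 q.2 (fun x y =>
       (e1 u p.1 p.2 q.1 q.2 x y - e2 u p.1 p.2 q.1 q.2 x y) *
       (e1 v p.1 p.2 q.1 q.2 x y - e2 v p.1 p.2 q.1 q.2 x y))
  + \sum_(p : 'I_Nx * bool) \sum_(q : 'I_Ny * bool)
      (b1 * Rint (loy q.1 q.2) (hiy q.1 q.2) (advect_x u v p.1 p.2 q.1 q.2) +
       b2 * Rint (lox p.1 p.2) (hix p.1 p.2) (advect_y u v p.1 p.2 q.1 q.2)).
Proof.
set V1x := ev1_2 Nx Ny Lx Ly (pdx2 k) v.1; set V1y := ev1_2 Nx Ny Lx Ly (pdy2 k) v.1.
set V2x := ev2_2 Nx Ny Lx Ly (pdx2 k) v.2; set V2y := ev2_2 Nx Ny Lx Ly (pdy2 k) v.2.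
transitivity (- (CFL / (`|b1| / hx + `|b2| / hy))^-1 *
    intO2 Lx Ly (fun x y => (U1 u x y - U2 u x y) * (U1 v x y - U2 v x y))
  + intO2 Lx Ly (fun x y => b1 * U2 u x y * V1x x y + b2 * U2 u x y * V1y x y
                            + b1 * U1 u x y * V2x x y + b2 * U1 u x y * V2y x y)
  - \sum_(p : 'I_Nx * bool) \sum_(q : 'I_Ny * bool)
    (b1 * (sg p.2 * Ex u v p.1 p.2 q.1 q.2) + b2 * (sg q.2 * Ey u v p.1 p.2 q.1 q.2))
  - - \sum_(p : 'I_Nx * bool) \sum_(q : 'I_Ny * bool)
    (b1 * (sg p.2 * Dx u v p.1 p.2 q.1 q.2) + b2 * (sg q.2 * Dy u v p.1 p.2 q.1 q.2))).
  by rewrite -primal_boundary -dual_boundary.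
rewrite (@intO2_quarters R Nx Ny Lx Ly Nx0 Ny0 Lx0 Ly0 _ (fun i r j s x y =>
   (e1 u i r j s x y - e2 u i r j s x y) * (e1 v i r j s x y - e2 v i r j s x y))); last 2 first.
- by move=> i r j s; apply: poly2M; apply: poly2D => //; exact: poly2N.
- move=> i r j s x y iN jN xi yj.
  have cx := half_cell_x Nx0 Lx0 iN xi; have cy := half_cell_y Ny0 Ly0 jN yj.
  rewrite /U1 /U2 !(ev1_2_half Nx0 Ny0 Lx0 Ly0 _ _ r s iN jN cx cy).
  by rewrite !(ev2_2_half Nx0 Ny0 Lx0 Ly0 _ _ iN jN (in_half_of iN xi) (in_half_of jN yj)).
rewrite (@intO2_quarters R Nx Ny Lx Ly Nx0 Ny0 Lx0 Ly0 _ (fun i r j s x y =>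
   b1 * vx u v i r j s x y + b2 * vy u v i r j s x y)); last 2 first.
- by move=> i r j s; apply: poly2D; apply: poly2M (poly2_cst _) _.
- move=> i r j s x y iN jN xi yj.
  have cx := half_cell_x Nx0 Lx0 iN xi; have cy := half_cell_y Ny0 Ly0 jN yj.
  rewrite /U1 /U2 /V1x /V1y /V2x /V2y !(ev1_2_half Nx0 Ny0 Lx0 Ly0 _ _ r s iN jN cx cy).
  rewrite !(ev2_2_half Nx0 Ny0 Lx0 Ly0 _ _ iN jN (in_half_of iN xi) (in_half_of jN yj)).
  rewrite /vx /vy /e1 /e2 /x1 /x2 /y1 /y2; ring.
rewrite -!addrA; congr (_ + _); rewrite opprK -sumrN -!big_split.
apply: eq_bigr => p _; rewrite -sumrN -!big_split; apply: eq_bigr => q _ /=.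
rewrite Rint_advect_x Rint_advect_y.
rewrite -/(Q p.1 p.2 q.1 q.2 _) (quarter_intD p.1 p.2 q.1 q.2
  (poly2M (poly2_cst b1) (pvx u v p.1 p.2 q.1 q.2))
  (poly2M (poly2_cst b2) (pvy u v p.1 p.2 q.1 q.2))).
rewrite !quarter_intZ//.
move: (Ex _ _ _ _ _ _) (Dx _ _ _ _ _ _) (Ey _ _ _ _ _ _) (Dy _ _ _ _ _ _).
move: (Q _ _ _ _ (vx _ _ _ _ _ _)) (Q _ _ _ _ (vy _ _ _ _ _ _)) => *; ring.
Qed.

End TwoDimensionalOperator.

Lemma dual_cell_lt N i r : (i < N)%N -> (dual_cell N i r < N)%N.
Proof. by rewrite /dual_cell /didx; case: r => //; case: ifP => // _; lia. Qed.

Section TwoDimensionalScheme.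
Variables (R : realType) (k : nat) (Lx Ly CFL sigma b1 b2 : R).
Hypotheses (CFL0 : 0 < CFL) (b0 : (b1 != 0) || (b2 != 0)) (Lx0 : 0 < Lx) (Ly0 : 0 < Ly).

Definition lstate2 : lmodType R :=
  ((nat -> nat -> nat -> nat -> R^o) * (nat -> nat -> nat -> nat -> R^o))%type.

Lemma lstate2_fst (a : R) (u v : lstate2) i j l n :
  (a *: u + v).1 i j l n = a * u.1 i j l n + v.1 i j l n :> R.
Proof.
rewrite (linearP (fst : lstate2 -> (nat -> nat -> nat -> nat -> R^o))).
by do 4 rewrite addrfctE scalrfctE.
Qed.

Lemma lstate2_snd (a : R) (u v : lstate2) i j l n :
  (a *: u + v).2 i j l n = a * u.2 i j l n + v.2 i j l n :> R.
Proof.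
rewrite (linearP (snd : lstate2 -> (nat -> nat -> nat -> nat -> R^o))).
by do 4 rewrite addrfctE scalrfctE.
Qed.

Lemma bloc1_linear ev (a : R) (u v : lstate2) i r j s x y : is_peval2 k ev ->
  bloc1 ev (a *: u + v : lstate2) i r j s x y = a * bloc1 ev u i r j s x y + bloc1 ev v i r j s x y.
Proof. by move=> [_ [lin _]]; apply: lin => l n; exact: lstate2_fst. Qed.

Lemma bloc2_linear Nx Ny ev (a : R) (u v : lstate2) i r j s x y : is_peval2 k ev ->
  bloc2 Nx Ny Lx Ly ev (a *: u + v : lstate2) i r j s x y =
  a * bloc2 Nx Ny Lx Ly ev u i r j s x y + bloc2 Nx Ny Lx Ly ev v i r j s x y.
Proof. by move=> [_ [lin _]]; apply: lin => l n; exact: lstate2_snd. Qed.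

Lemma cdg_scheme2 : exists2 K : R, 0 < K & forall M : nat * nat, adm2 Lx Ly sigma M ->
  @cdg_scheme R lstate2 K (h2 Lx Ly M) (ip2 k Lx Ly M) (H2 k b1 b2 CFL Lx Ly M).
Proof.
have [K K0 bnd] := advect_bound R k.
(* [S] dominates both 1 and [sigma], so the larger mesh width is at most [S] times either width. *)
set S := 1 + `|sigma|; have S0 : 0 < S by rewrite ltr_pwDl.
have S1 : 1 <= S by rewrite /S lerDl.
have sS : sigma <= S by apply: le_trans (ler_norm _) _; rewrite /S lerDr.
set b := `|b1| + `|b2|.
have bp : 0 < b.
  by case/orP: b0 => bn; [apply: ltr_pwDl|apply: ltr_wpDl]; rewrite ?normr_gt0.
exists (2 * S * K * b + 2 * (S * b / CFL)).
  by rewrite addr_gt0// !mulr_gt0// invr_gt0.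
move=> [Nx Ny] /= [Nx0 [Ny0 [hxy hyx]]].
set hx := Lx / Nx%:R in hxy hyx; set hy := Ly / Ny%:R in hxy hyx.
have hx0 : 0 < hx by rewrite divr_gt0// ltr0n.
have hy0 : 0 < hy by rewrite divr_gt0// ltr0n.
rewrite /h2 /= -/hx -/hy; set h := Num.max hx hy.
have h0 : 0 < h by rewrite lt_max hx0.
have hSx : h <= S * hx.
  rewrite ge_max; apply/andP; split; first by apply: ler_peMl => //; exact: ltW.
  by apply: le_trans hyx _; apply: ler_wpM2r => //; exact: ltW.
have hSy : h <= S * hy.
  rewrite ge_max; apply/andP; split; last by apply: ler_peMl => //; exact: ltW.
  by apply: le_trans hxy _; apply: ler_wpM2r => //; exact: ltW.
pose tx := unode Nx Lx; pose ty := unode Ny Ly.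
pose lox := lo_half tx (cen tx); pose hix := hi_half tx (cen tx).
pose loy := lo_half ty (cen ty); pose hiy := hi_half ty (cen ty).
pose e1 (u : lstate2) i r j s := bloc1 (peval2 k) u i r j s.
pose e2 (u : lstate2) i r j s := bloc2 Nx Ny Lx Ly (peval2 k) u i r j s.
have ev0 := is_peval2_peval2 R k; have evx := is_peval2_pdx2 R k; have evy := is_peval2_pdy2 R k.
have pe1 u i r j s : poly2 (e1 u i r j s) := poly2_bloc1 u i r j s ev0.
have pe2 u i r j s : poly2 (e2 u i r j s) := poly2_bloc2 _ _ _ _ u i r j s ev0.
pose fI i r j s (u v : lstate2) x y := e1 u i r j s x y * e1 v i r j s x y + e2 u i r j s x y * e2 v i r j s x y.
pose fJ i r j s (u v : lstate2) x y := (e1 u i r j s x y - e2 u i r j s x y) * (e1 v i r j s x y - e2 v i r j s x y).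
have pI i r j s u v : poly2 (fI i r j s u v) by apply: poly2D; exact: poly2M.
have pJ i r j s u v : poly2 (fJ i r j s u v).
  by apply: poly2M; apply: poly2D => //; exact: poly2N.
pose I2 i r j s (u v : lstate2) := @quarter_int R Nx Ny Lx Ly i r j s (fI i r j s u v).
pose J2 i r j s (u v : lstate2) := @quarter_int R Nx Ny Lx Ly i r j s (fJ i r j s u v).
have lenx i r : hix i r - lox i r = hx / 2.
  by rewrite /hix /lox /tx; case: r; rewrite /= cen_unode// ?unodeS// -/hx; field.
have leny j s : hiy j s - loy j s = hy / 2.
  by rewrite /hiy /loy /ty; case: s; rewrite /= cen_unode// ?unodeS// -/hy; field.
have hkx i r : h <= 2 * S * (hix i r - lox i r) by rewrite lenx; lra.
have hky j s : h <= 2 * S * (hiy j s - loy j s) by rewrite leny; lra.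
have ltx i r : lox i r < hix i r by rewrite -subr_gt0 lenx divr_gt0.
have lty j s : loy j s < hiy j s by rewrite -subr_gt0 leny divr_gt0.
have S20 : 0 <= 2 * S by rewrite mulr_ge0// ltW.
have pk1x u i r j s y : polyk k (e1 u i r j s ^~ y) (bloc1 (pdx2 k) u i r j s ^~ y).
  exact: polyk_peval2_x.
have pk2x u i r j s y : polyk k (e2 u i r j s ^~ y) (bloc2 Nx Ny Lx Ly (pdx2 k) u i r j s ^~ y).
  exact: (polyk_shift (dual_shift Lx i r) (polyk_peval2_x k (u.2 _ _) (y + dual_shift Ly j s))).
have pk1y u i r j s x : polyk k (e1 u i r j s x) (bloc1 (pdy2 k) u i r j s x).
  exact: polyk_peval2_y.
have pk2y u i r j s x : polyk k (e2 u i r j s x) (bloc2 Nx Ny Lx Ly (pdy2 k) u i r j s x).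
  exact: (polyk_shift (dual_shift Ly j s) (polyk_peval2_y k (u.2 _ _) (x + dual_shift Lx i r))).
have lsx i r j s : local_scheme (2 * S * K) h (I2 i r j s) (J2 i r j s)
    (fun u v => Rint (loy j s) (hiy j s) (@advect_x R k Nx Ny Lx Ly u v i r j s)).
  (* The transverse variable [y] is moved outside, so that the one-dimensional piece in [x] can be
     integrated over it. *)
  have -> : I2 i r j s = fun u v => Rint (loy j s) (hiy j s) (fun y => Rint (lox i r) (hix i r) (fI i r j s u v ^~ y)).
    by do 2 apply/funext => ?; rewrite /I2 /quarter_int poly2_fubini.
  have -> : J2 i r j s = fun u v => Rint (loy j s) (hiy j s) (fun y => Rint (lox i r) (hix i r) (fJ i r j s u v ^~ y)).
    by do 2 apply/funext => ?; rewrite /J2 /quarter_int poly2_fubini.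
  apply: (@local_scheme_Rint R lstate2 _ _ _ _
    (fun y u v => Rint (lox i r) (hix i r) (fI i r j s u v ^~ y))
    (fun y u v => Rint (lox i r) (hix i r) (fJ i r j s u v ^~ y))
    (fun y u v => @advect_x R k Nx Ny Lx Ly u v i r j s y) (ltW h0) (lty j s)).
  - move=> y; apply: (@piece_scheme R lstate2 k
      (fun u => e1 u i r j s ^~ y) (fun u => e2 u i r j s ^~ y)
      (fun u => bloc1 (pdx2 k) u i r j s ^~ y) (fun u => bloc2 Nx Ny Lx Ly (pdx2 k) u i r j s ^~ y)) => //.
    + by move=> a u v x; exact: bloc1_linear.
    + by move=> a u v x; exact: bloc2_linear.
    + by move=> a u v x; exact: bloc1_linear.
    + by move=> a u v x; exact: bloc2_linear.
    + by move=> u v; exact: (bnd _ _ r _ _ _ _ _ _ _ _ (ltx i r) (pk1x _ _ _ _ _ _) (pk2x _ _ _ _ _ _) (pk1x _ _ _ _ _ _) (pk2x _ _ _ _ _ _)).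
  - by move=> u v; exact: poly2_Rint_x.
  - by move=> u v; exact: poly2_Rint_x.
  - by move=> u v; exact: polyfun_advect_x.
have lsy i r j s : local_scheme (2 * S * K) h (I2 i r j s) (J2 i r j s)
    (fun u v => Rint (lox i r) (hix i r) (@advect_y R k Nx Ny Lx Ly u v i r j s)).
  apply: (@local_scheme_Rint R lstate2 _ _ _ _
    (fun x u v => Rint (loy j s) (hiy j s) (fI i r j s u v x))
    (fun x u v => Rint (loy j s) (hiy j s) (fJ i r j s u v x))
    (fun x u v => @advect_y R k Nx Ny Lx Ly u v i r j s x) (ltW h0) (ltx i r)).
  - move=> x; apply: (@piece_scheme R lstate2 k
      (fun u => e1 u i r j s x) (fun u => e2 u i r j s x)
      (fun u => bloc1 (pdy2 k) u i r j s x) (fun u => bloc2 Nx Ny Lx Ly (pdy2 k) u i r j s x)) => //.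
    + by move=> a u v y; exact: bloc1_linear.
    + by move=> a u v y; exact: bloc2_linear.
    + by move=> a u v y; exact: bloc1_linear.
    + by move=> a u v y; exact: bloc2_linear.
    + by move=> u v; exact: (bnd _ _ s _ _ _ _ _ _ _ _ (lty j s) (pk1y _ _ _ _ _ _) (pk2y _ _ _ _ _ _) (pk1y _ _ _ _ _ _) (pk2y _ _ _ _ _ _)).
  - by move=> u v; exact: poly2_Rint_y.
  - by move=> u v; exact: poly2_Rint_y.
  - by move=> u v; exact: polyfun_advect_y.
have lsS := local_scheme_sum (ltW h0) (fun p : 'I_Nx * bool =>
  local_scheme_sum (ltW h0) (fun q : 'I_Ny * bool =>
    local_scheme_lin b1 b2 (ltW h0) (lsx p.1 p.2 q.1 q.2) (lsy p.1 p.2 q.1 q.2))).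
set ipS := fun u v : lstate2 => \sum_(p : 'I_Nx * bool) \sum_(q : 'I_Ny * bool) I2 p.1 p.2 q.1 q.2 u v.
have -> : ip2 k Lx Ly (Nx, Ny) = ipS.
  by do 2 apply/funext => ?; exact: ip2E.
have den0 : 0 <= `|b1| / hx + `|b2| / hy by rewrite addr_ge0// divr_ge0// ltW.
have th0 : 0 <= (CFL / (`|b1| / hx + `|b2| / hy))^-1.
  by rewrite invr_ge0 divr_ge0// ltW.
apply: (cdg_of_local h0 th0 _ _ lsS).
- by rewrite !mulr_ge0 ?addr_ge0// ltW.
- rewrite invf_div mulrA ler_pM2r ?invr_gt0// /b !mulrDr.
  by apply: lerD; rewrite mulrCA [leRHS]mulrC ler_wpM2l// ler_pdivrMr.
- by move=> u v; exact: H2E.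
(* The coordinates run over a square of exponents containing the triangle of total degree at most
   [k]; if all vanish, so do the polynomials on every cell. *)
apply: (@span_coords R lstate2 ipS (bool * (('I_Nx * 'I_Ny) * ('I_k.+1 * 'I_k.+1)))%type
  (fun t u => if t.1 then u.1 t.2.1.1 t.2.1.2 t.2.2.1 t.2.2.2 else u.2 t.2.1.1 t.2.1.2 t.2.2.1 t.2.2.2)
  (fun t => ((fun i j l n => (t.1 && ((t.2.1.1 == i :> nat) && (t.2.1.2 == j :> nat) && ((t.2.2.1 == l :> nat) && (t.2.2.2 == n :> nat))))%:R),
             (fun i j l n => (~~ t.1 && ((t.2.1.1 == i :> nat) && (t.2.1.2 == j :> nat) && ((t.2.2.1 == l :> nat) && (t.2.2.2 == n :> nat))))%:R)))).
- by move=> [[] [[i j] [l n]]] c u v; [exact: lstate2_fst|exact: lstate2_snd].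
- move=> [c [[i j] [l n]]] [c' [[i' j'] [l' n']]].
  rewrite !xpair_eqE (eq_sym i) (eq_sym j) (eq_sym l) (eq_sym n).
  by case: c c' => [] [].
- move=> z z0.
  have z1 i j l n : (i < Nx)%N -> (j < Ny)%N -> (l < k.+1)%N -> (n < k.+1)%N -> z.1 i j l n = 0.
    by move=> iN jN lk nk; exact: (z0 (true, ((Ordinal iN, Ordinal jN), (Ordinal lk, Ordinal nk)))).
  have z2 i j l n : (i < Nx)%N -> (j < Ny)%N -> (l < k.+1)%N -> (n < k.+1)%N -> z.2 i j l n = 0.
    by move=> iN jN lk nk; exact: (z0 (false, ((Ordinal iN, Ordinal jN), (Ordinal lk, Ordinal nk)))).
  rewrite /ipS; apply: big1 => p _; apply: big1 => q _; rewrite /I2 /quarter_int.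
  have [_ [_ vanish]] := ev0.
  rewrite -[RHS](Rint0 (lox p.1 p.2) (hix p.1 p.2)); apply: eq_Rint => x _.
  rewrite -[RHS](Rint0 (loy q.1 q.2) (hiy q.1 q.2)); apply: eq_Rint => y _.
  rewrite /fI.
  have -> : e1 z p.1 p.2 q.1 q.2 x y = 0.
    by apply: vanish => l n lk nk; exact: z1.
  have -> : e2 z p.1 p.2 q.1 q.2 x y = 0.
    by apply: vanish => l n lk nk; apply: z2 => //; exact: dual_cell_lt.
  by rewrite !mul0r addr0.
Qed.

End TwoDimensionalScheme.

Theorem theorem3p5 :
  forall (R : realType) (k : nat) (CFL : R), 0 < CFL ->
  forall (s r : nat) (c d : nat -> nat -> R), rk_method s r c d ->
  forall m : nat, (1 <= m)%N ->
  forall zeta rho : nat,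
    termination_index c d s m zeta ->
    contribution_index c d s m zeta rho ->
  (* 1D: quasi-uniform periodic mesh of [0, L] with mesh ratio bound sigma *)
  (forall (beta L sigma : R), beta != 0 -> 0 < L ->
     stability_conclusions (adm1 L sigma) (fun M => h1 M.1 M.2)
       (ip1 k L) (H1 k beta CFL L) s c d m zeta rho) /\
  (* 2D: uniform periodic Cartesian mesh of [0, Lx] x [0, Ly] *)
  (forall (beta1 beta2 Lx Ly sigma : R), (beta1 != 0) || (beta2 != 0) ->
     0 < Lx -> 0 < Ly ->
     stability_conclusions (adm2 Lx Ly sigma) (h2 Lx Ly)
       (ip2 k Lx Ly) (H2 k beta1 beta2 CFL Lx Ly) s c d m zeta rho).
Proof.
move=> R k CFL CFL0 s r c d rk m m0 zeta rho term contrib; split.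
  move=> beta L sigma beta0 L0.
  have [K K0 cdg] := cdg_scheme1 k sigma CFL0 beta0 L0.
  exact: (stability_of_scheme rk m0 term contrib K0 cdg).
move=> beta1 beta2 Lx Ly sigma beta0 Lx0 Ly0.
have [K K0 cdg] := cdg_scheme2 k sigma CFL0 beta0 Lx0 Ly0.
exact: (stability_of_scheme rk m0 term contrib K0 cdg).
Qed.
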